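(* Let $T\in(0,\infty)$. Suppose that $\mu=a+b$ and $\xi$ satisfy the following: $\mu\colon\mathbb{R}\to\mathbb{R}$ is measurable, $\mu\neq 0$; $a,b\colon\mathbb{R}\to\mathbb{R}$ are bounded; $a\in C_b^2(\mathbb{R})$; $b\in L^1(\mathbb{R})$; and $\xi\in L^2(\Omega,\mathcal{F}_0,\mathbb{P})$. Suppose moreover that $\kappa\in(0,1)$ is such that $|b|_\kappa<\infty$. Then there exist constants $C^{(Q),equi}_{b,T,\kappa}>0$ and $C^{(Q),*}_{b,T,\kappa}>0$, depending only on $b,T,\kappa$, such that for all $n\in\mathbb{N}$ $$\sup_{t\in[0,T]}\mathcal{W}_t^{(\pi_n^{equi})}\le C^{(Q),equi}_{b,T,\kappa}\cdot\left(\frac{1}{n^{1+\kappa}}+\frac{1}{n^{3/2}}\right)$$ and $$\sup_{t\in[0,T]}\mathcal{W}_t^{(\pi_n^{*})}\le C^{(Q),*}_{b,T,\kappa}\cdot\frac{1+\log(n)}{n^{1+\kappa}}.$$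
   Context: $(\Omega,\mathcal{F},(\mathcal{F}_t)_{t\in[0,T]},\mathbb{P})$ is a filtered probability space whose filtration satisfies the usual conditions, $W=(W_t)_{t\in[0,T]}$ is a standard $(\mathcal{F}_t)$-Brownian motion, and $\xi$ is independent of $W$. $C_b^2(\mathbb{R})$ denotes twice continuously differentiable functions with bounded derivatives. For measurable $f\colon\mathbb{R}\to\mathbb{R}$ the Sobolev-Slobodeckij semi-norm is $$|f|_\kappa=\left(\int_{\mathbb{R}}\int_{\mathbb{R}}\frac{|f(x)-f(y)|^2}{|x-y|^{2\kappa+1}}\,dx\,dy\right)^{1/2}.$$ For a discretization $\pi_n=\{t_0,\dots,t_n\}$ with $0=t_0<t_1<\dots<t_n=T$, set $\underline{s}=\max\{t_k:t_k\le s\}$ and $$\mathcal{W}_t^{(\pi_n)}=\mathbb{E}\left[\left|\int_0^t\varphi'(W_s+\xi)\left(b(W_s+\xi)-b(W_{\underline{s}}+\xi)\right)ds\right|^2\right],\qquad t\in[0,T],$$ where $\varphi'(x)=\exp\left(-2\int_0^x b(z)\,dz\right)$. The equidistant discretization $\pi_n^{equi}$ is given by $t_k^{equi}=T\frac{k}{n}$, $k=0,\dots,n$, and the non-equidistant discretization $\pi_n^*$ by $t_k^*=T\left(\frac{k}{n}\right)^2$, $k=0,\dots,n$. *)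

(* Defs.v *)
From HB Require Import structures.
From mathcomp Require Import all_boot all_order all_algebra.
From mathcomp Require Import all_classical all_reals all_analysis.
Set Implicit Arguments.
Unset Strict Implicit.
Unset Printing Implicit Defensive.
Import Order.TTheory GRing.Theory Num.Theory.
Import numFieldNormedType.Exports.
Local Open Scope classical_set_scope.
Local Open Scope ring_scope.

(* Only the derivatives are required to be bounded, not the function itself. *)
Definition Cb2 (R : realType) (f : R -> R) : Prop :=
  [/\ forall x, derivable f x 1,
      forall x, derivable (derive1 f) x 1,
      continuous (derive1 (derive1 f)),
      bounded_fun (derive1 f) &
      bounded_fun (derive1 (derive1 f))].

(* The diagonal [x = y], where the quotient is a junk value, is a null set. *)
Definition sobolev_slobodeckij (R : realType) (kappa : R) (f : R -> R) : \bar R :=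
  ((\int[@lebesgue_measure R]_y \int[@lebesgue_measure R]_x
      (`|f x - f y| ^+ 2 / `|x - y| `^ (2 * kappa + 1))%:E) `^ 2^-1)%E.

Definition oriented_integral (R : realType) (f : R -> R) (u v : R) : R :=
  if u <= v then \int[@lebesgue_measure R]_(z in `[u, v]) f z
  else - \int[@lebesgue_measure R]_(z in `[v, u]) f z.

Definition phi' (R : realType) (b : R -> R) (x : R) : R :=
  expR (- 2 * oriented_integral b 0 x).

(* Independence of two families of events; for sigma-algebras this is the usual
   notion. *)
Definition independent_systems (d : measure_display) (Omega : measurableType d)
    (R : realType) (P : probability Omega R) (G H : set (set Omega)) : Prop :=
  forall A B, G A -> H B -> P (A `&` B) = (P A * P B)%E.

Definition sigma_rv (d : measure_display) (Omega : measurableType d)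
    (R : realType) (X : Omega -> R) : set (set Omega) :=
  preimage_set_system setT X measurable.

Definition sigma_process (d : measure_display) (Omega : measurableType d)
    (R : realType) (T : R) (X : R -> Omega -> R) : set (set Omega) :=
  <<s \bigcup_(t in `[0, T]) sigma_rv (X t) >>.

(* Processes and filtrations on [0, T] are indexed by all of [R]; their values
   outside [0, T] are never constrained nor used. *)
Record filtration (d : measure_display) (Omega : measurableType d)
    (R : realType) (T : R) (F : R -> set (set Omega)) : Prop := Filtration {
  filtration_sigma_algebra :
    forall t, t \in `[0, T] -> sigma_algebra setT (F t);
  filtration_measurable : forall t, t \in `[0, T] -> F t `<=` measurable;
  filtration_monotone :
    forall s t, 0 <= s -> s <= t -> t <= T -> F s `<=` F t }.

(* [negligible] sets are arbitrary subsets of measurable null sets, so the first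
   field also forces the probability space itself to be complete. *)
Record usual_conditions (d : measure_display) (Omega : measurableType d)
    (R : realType) (P : probability Omega R) (T : R)
    (F : R -> set (set Omega)) : Prop := UsualConditions {
  usual_complete : forall N, P.-negligible N -> F 0 N;
  usual_right_continuous :
    forall t, 0 <= t -> t < T -> \bigcap_(s in `]t, T]) F s = F t }.

Record brownian_motion (d : measure_display) (Omega : measurableType d)
    (R : realType) (P : probability Omega R) (T : R)
    (F : R -> set (set Omega)) (W : R -> Omega -> R) : Prop := BrownianMotion {
  brownian_adapted : forall t, t \in `[0, T] -> sigma_rv (W t) `<=` F t;
  brownian_start : {ae P, forall w, W 0 w = 0};
  brownian_continuous :
    {ae P, forall w, {within `[0, T], continuous (fun t => W t w)}};
  brownian_independent : forall s t, 0 <= s -> s < t -> t <= T ->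
    independent_systems P (F s) (sigma_rv (W t \- W s));
  (* [normal_prob] takes the standard deviation as second parameter *)
  brownian_increments : forall s t, 0 <= s -> s < t -> t <= T ->
    forall B : set R, measurable B ->
      P ((W t \- W s) @^-1` B) = normal_prob 0 (Num.sqrt (t - s)) B }.

(* A discretization with n steps is given by the nodes t 0, .., t n. The result
   is the largest node below s, provided t 0 <= s, which makes the default value
   t 0 of the maximum harmless. *)
Definition last_node (R : realType) (n : nat) (t : nat -> R) (s : R) : R :=
  \big[Num.max/t 0%N]_(k < n.+1 | t k <= s) t k.

Definition quad_error (d : measure_display) (Omega : measurableType d)
    (R : realType) (P : probability Omega R) (W : R -> Omega -> R)
    (xi : Omega -> R) (b : R -> R) (n : nat) (grid : nat -> R) (t : R) : \bar R :=
  'E_P[fun w =>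
    `| \int[@lebesgue_measure R]_(s in `[0, t])
         (phi' b (W s w + xi w) *
          (b (W s w + xi w) - b (W (last_node n grid s) w + xi w))) | ^+ 2].

Definition equi_grid (R : realType) (T : R) (n k : nat) : R :=
  T * (k%:R / n%:R).

Definition star_grid (R : realType) (T : R) (n k : nat) : R :=
  T * (k%:R / n%:R) ^+ 2.

Definition sup_quad_error (d : measure_display) (Omega : measurableType d)
    (R : realType) (P : probability Omega R) (T : R) (W : R -> Omega -> R)
    (xi : Omega -> R) (b : R -> R) (n : nat) (grid : nat -> R) : \bar R :=
  ereal_sup [set quad_error P W xi b n grid t | t in `[0, T]].

(* Main.v *)
(* Put X = W + xi, let eta s be the last node before s, h the mesh, and
   psi = phi' b. The local error phi'(X_s) (b(X_s) - b(X_(eta s))) is the sum of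
   psi(X_s) - psi(X_(eta s)), of 2 phi'(X_(eta s)) b(X_(eta s))^2 (truncated)
   times W_s - W_(eta s), and of a remainder. On a time block [t/2, t] the density
   of X is at most of order t^(-1/2), so that the starting point may be averaged
   over the Lebesgue measure. The covariances of the first term are then second
   differences of the convex function t |-> E[autocorrelation of psi at W_t]:
   they are nonpositive across distinct cells and of order h^kappa within a cell,
   which gives h^(1+kappa) after integration. The second term is a martingale
   difference, and the remainder is of order h^((1+kappa)/2) in L^2. Summing the
   blocks [t/2, t], [t/4, t/2], ... handles the singularity of the density at 0.
   Only the mesh matters, so both discretizations have error O(n^-(1+kappa)). *)
Require Import Defs.
From HB Require Import structures.
From mathcomp Require Import all_boot all_order all_algebra.
From mathcomp Require Import all_classical all_reals all_analysis.
From mathcomp Require Import measurable_realfun ring lra.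
Set Implicit Arguments.
Unset Strict Implicit.
Unset Printing Implicit Defensive.
Import Order.TTheory GRing.Theory Num.Theory.
Import numFieldNormedType.Exports.
Local Open Scope classical_set_scope.
Local Open Scope ring_scope.

(** * Lebesgue integrals *)

(** The increments of [psi] are only known to have L^2 size h^(kappa/2), and [psi] need not be
    differentiable, so the missing factor h has to come from cancellation between cells. A sign is
    enough for this: the covariances across cells only have to be bounded above by 0, and no rate of
    decay enters. In Fourier terms the mean autocorrelation at time t is, up to a constant, the
    integral of |F psi|^2 exp(- t x^2 / 2), a convex function of t. Here convexity is derived from
    the Gaussian kernel being a convolution square, applied to [psi] and to its increments. The
    obstacle is the starting point. A density bound controls the means of nonnegative functions
    only, whereas a single covariance has no sign. Hence the whole square is first conditioned on
    the position at a time before the block, this position is then averaged over the Lebesgue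
    measure, and only afterwards is the square expanded into covariances. A block [t/2, t] costs
    t^(-1/2) for the density and t for its length, hence sqrt t times h^(1+kappa). These bounds
    decay geometrically along the dyadic blocks, which is why no logarithm appears. *)

Section integral_affine.
Context {R : realType}.
Notation mu := (@lebesgue_measure R).

Let shift (a : R) : measurableTypeR R -> measurableTypeR R := fun x => x + a.

Let measurable_shift (a : R) : measurable_fun setT (shift a).
Proof. exact: measurable_funD. Qed.

Let lebesgue_measure_shift (a : R) (A : set R) : measurable A ->
  pushforward mu (shift a) A = mu A.
Proof.
pose nu : {measure set (measurableTypeR R) -> \bar R} :=
  [the measure _ _ of pushforward mu (shift a)].
move=> mA; apply/esym.
apply: (@lebesgue_measure_unique R (nu (@measurable_shift a))) => // _ [[x y] _ <-].
rewrite /nu /= /pushforward.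
have -> : shift a @^-1` `]x, y] = `]x - a, y - a]%classic.
  by apply/seteqP; split => z /=; rewrite !in_itv /= ltrBlDr lerBrDr.
rewrite !lebesgue_measure_itv /= !lte_fin ltrD2r.
by case: ifP => // _; rewrite -!EFinB; congr EFin; ring.
Qed.

Let integral_measure_preserving (phi : measurableTypeR R -> measurableTypeR R)
    (f : R -> \bar R) : measurable_fun setT phi ->
  (forall A, measurable A -> pushforward mu phi A = mu A) ->
  measurable_fun setT f -> (\int[mu]_x f (phi x) = \int[mu]_x f x)%E.
Proof.
move=> mphi phiE.
have ge0_pres g : measurable_fun setT g -> (forall x, 0 <= g x)%E ->
    (\int[mu]_x g (phi x) = \int[mu]_x g x)%E.
  move=> mg g0; transitivity (\int[pushforward mu phi]_x g x)%E.
    by rewrite ge0_integral_pushforward.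
  by apply: eq_measure_integral => A mA _; exact: phiE.
move=> mf; rewrite -[LHS]/(\int[mu]_x (f \o phi) x)%E integralE [RHS]integralE.
rewrite -(ge0_pres f^\+%E) //; last exact: measurable_funepos.
rewrite -(ge0_pres f^\-%E) //; last exact: measurable_funeneg.
by rewrite (funepos_comp f phi) (funeneg_comp f phi).
Qed.

Lemma lebesgue_integral_shift (a : R) (f : R -> \bar R) : measurable_fun setT f ->
  (\int[mu]_x f (x + a)%R = \int[mu]_x f x)%E.
Proof.
by apply: (@integral_measure_preserving (shift a)) => // A mA;
  exact: lebesgue_measure_shift.
Qed.

Lemma lebesgue_integral_opp (f : R -> \bar R) : measurable_fun setT f ->
  (\int[mu]_x f (- x)%R = \int[mu]_x f x)%E.
Proof.
by apply: integral_measure_preserving => // A mA; exact: lebesgue_measureN.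
Qed.

End integral_affine.

Lemma lebesgue_itv_lty {R : realType} (u v : R) :
  (@lebesgue_measure R `[u, v]%classic < +oo)%E.
Proof.
by rewrite lebesgue_measure_itv /=; case: ifP; rewrite // -?EFinB ltry.
Qed.

Lemma lebesgue_itv_le {R : realType} (u v c : R) : 0 <= c -> v - u <= c ->
  (@lebesgue_measure R `[u, v]%classic <= c%:E)%E.
Proof.
move=> c0 uvc; rewrite lebesgue_measure_itv /=.
by case: ifP => _; rewrite ?lee_fin // -EFinB lee_fin.
Qed.

Section integralT.
Context d (T : measurableType d) (R : realType) (m : {measure set T -> \bar R}).
Local Open Scope ereal_scope.

Lemma ge0_integralTZl (k : R) (f : T -> \bar R) : (0 <= k)%R ->
  measurable_fun setT f -> (forall x, 0 <= f x) ->
  \int[m]_x (k%:E * f x) = k%:E * \int[m]_x f x.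
Proof. by move=> k0 mf f0; rewrite ge0_integralZl. Qed.

Lemma ge0_le_integralT (f g : T -> \bar R) :
  measurable_fun setT f -> measurable_fun setT g ->
  (forall x, 0 <= f x) -> (forall x, f x <= g x) ->
  \int[m]_x f x <= \int[m]_x g x.
Proof. by move=> mf mg f0 fg; apply: ge0_le_integral. Qed.

Lemma ge0_integralTD (f g : T -> \bar R) :
  measurable_fun setT f -> measurable_fun setT g ->
  (forall x, 0 <= f x) -> (forall x, 0 <= g x) ->
  \int[m]_x (f x + g x) = \int[m]_x f x + \int[m]_x g x.
Proof. by move=> mf mg f0 g0; rewrite ge0_integralD. Qed.

End integralT.

(** No integrability is assumed: the extended integral is a difference of two Tonelli integrals,
    measurable in the parameter even where they are infinite, and [fine] is measurable. *)
Lemma measurable_Rintegral_param d1 d2 (T1 : measurableType d1)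
    (T2 : measurableType d2) (R : realType)
    (m2 : {sigma_finite_measure set T2 -> \bar R}) (f : T1 * T2 -> R) :
  measurable_fun setT f -> measurable_fun setT (fun x => \int[m2]_y f (x, y)).
Proof.
move=> mf; have mfE : measurable_fun setT (EFin \o f) by exact/measurable_EFinP.
apply: (measurableT_comp (f := fine)) => //.
rewrite (_ : (fun x => _) = fun x => \int[m2]_y (EFin \o f)^\+ (x, y) -
    \int[m2]_y (EFin \o f)^\- (x, y))%E.
  apply: emeasurable_funB.
    apply: (@measurable_fun_fubini_tonelli_F _ _ _ _ _ m2 (EFin \o f)^\+%E) => //.
    exact: measurable_funepos.
  apply: (@measurable_fun_fubini_tonelli_F _ _ _ _ _ m2 (EFin \o f)^\-%E) => //.
  exact: measurable_funeneg.
apply/funext => x; rewrite integralE; congr (_ - _)%E;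
  by apply: eq_integral => y _; rewrite ?funeposE ?funenegE.
Qed.

(** * Squares of time integrals *)

(* The library's canonical sigma-finite structure on [m1 \x m2] only covers
   subprobabilities, whence this alias. *)
Section sigma_finite_product.
Local Open Scope ereal_scope.
Context d1 d2 (T1 : measurableType d1) (T2 : measurableType d2) (R : realType).
Variables (m1 : {sigma_finite_measure set T1 -> \bar R})
  (m2 : {sigma_finite_measure set T2 -> \bar R}).

Definition sprod : set (T1 * T2) -> \bar R := m1 \x m2.

HB.instance Definition _ := Measure.on sprod.

Let sprod_sigma_finite : sigma_finite setT sprod.
Proof.
have /sigma_finiteP[F [TF ndF Foo]] := sigma_finiteT m1.
have /sigma_finiteP[G [TG ndG Goo]] := sigma_finiteT m2.
exists (fun n => F n `*` G n).
  apply/seteqP; split => // -[x y] _.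
  have [i _ Fx] : (\bigcup_n F n) x by rewrite -TF.
  have [j _ Gy] : (\bigcup_n G n) y by rewrite -TG.
  exists (maxn i j) => //; split => /=.
    by move: Fx; exact/subsetPset/ndF/leq_maxl.
  by move: Gy; exact/subsetPset/ndG/leq_maxr.
move=> n; have [? ?] := Foo n; have [? ?] := Goo n.
split; first exact: measurableX.
by rewrite /sprod product_measure1E // lte_mul_pinfty // ge0_fin_numE.
Qed.

HB.instance Definition _ :=
  Measure_isSigmaFinite.Build _ _ _ sprod sprod_sigma_finite.

End sigma_finite_product.

Section square_of_integral.
Context {R : realType} d (S : measurableType d).
Variable M : {sigma_finite_measure set S -> \bar R}.
Notation mu := (@lebesgue_measure R).
Variable h : measurableTypeR R * S -> R.
Hypothesis mh : measurable_fun setT h.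

Let f (z : (measurableTypeR R * measurableTypeR R) * S) : \bar R :=
  (h (z.1.1, z.2) * h (z.1.2, z.2))%:E.

Lemma measurable_square_kernel : measurable_fun setT f.
Proof.
apply/measurable_EFinP; apply: measurable_funM;
  apply: (measurableT_comp mh); apply: measurable_fun_pair => //=.
- by apply: measurableT_comp => //; exact: measurable_fst.
- by apply: measurableT_comp => //; exact: measurable_fst.
Qed.

Hypothesis intf : (sprod mu mu \x M)%E.-integrable setT f.
Hypothesis int_w : forall w, mu.-integrable setT (fun s => (h (s, w))%:E).

Let mf := measurable_square_kernel.

Let mh_w w : measurable_fun setT (fun s => h (s, w)).
Proof. exact: (measurable_fun_pair1 w mh). Qed.

Let sq_Rintegral w :
  ((\int[mu]_s h (s, w)) ^+ 2)%:E = (\int[sprod mu mu]_z f (z, w))%E.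
Proof.
set c := \int[mu]_s h (s, w).
have cE : c%:E = (\int[mu]_s (h (s, w))%:E)%E.
  by rewrite fineK //; exact: integrable_fin_num (int_w w).
have abs_int : (\int[mu]_s `|(h (s, w))%:E| < +oo)%E.
  by have /integrableP[] := int_w w.
have mfw : measurable_fun setT (fun z => f (z, w)).
  exact: (measurable_fun_pair1 w mf).
have mabs : measurable_fun setT (fun s => `|(h (s, w))%:E|%E).
  by do 2 apply: measurableT_comp => //.
have intfw : (mu \x mu)%E.-integrable setT (fun z => f (z, w)).
  apply/(@integrable12ltyP _ _ _ _ _ mu mu (fun z => f (z, w)) mfw).
  rewrite [ltLHS](_ : _ = (\int[mu]_s (`|(h (s, w))%:E| *
      \int[mu]_t `|(h (t, w))%:E|))%E); last first.
    apply: eq_integral => s _; rewrite -ge0_integralZl //.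
    by apply: eq_integral => t _; rewrite -abseM.
  rewrite ge0_integralZr //; last exact: integral_ge0.
  by rewrite lte_mul_pinfty // ?integral_ge0 // ge0_fin_numE ?integral_ge0.
rewrite -(integral12_prod_meas1 intfw) /fubini_F.
transitivity (\int[mu]_s ((h (s, w))%:E * c%:E))%E.
  rewrite (integralZr measurableT (int_w w)).
  by rewrite -cE -EFinM -expr2.
by apply: eq_integral => s _; rewrite cE -(integralZl measurableT (int_w w)).
Qed.

(** The square of a time integral is a double time integral, and Fubini moves the outer integral
    inside. The measure [M] is general because it will be a probability, a product of two
    probabilities, the Lebesgue measure, and the product of the Lebesgue measure with a
    probability. *)
Lemma integral_sq_RintegralE :
  (\int[M]_w ((\int[mu]_s h (s, w)) ^+ 2)%:E =
   \int[sprod mu mu]_z \int[M]_w f (z, w))%E.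
Proof.
rewrite (Fubini intf); apply: eq_integral => w _; exact: sq_Rintegral.
Qed.

End square_of_integral.

Section square_of_integral_on_interval.
Context {R : realType} d (S : measurableType d).
Variable M : {sigma_finite_measure set S -> \bar R}.
Notation mu := (@lebesgue_measure R).
Variables (h : measurableTypeR R * S -> R) (K K0 u v : R).
Hypothesis mh : measurable_fun setT h.
Hypothesis hK : forall z, `|h z| <= K.
Hypothesis h_supp : forall s w, s \notin `[u, v] -> h (s, w) = 0.
Hypothesis h_sq : forall s, (\int[M]_w (h (s, w) ^+ 2)%:E <= K0%:E)%E.

Let f (z : (measurableTypeR R * measurableTypeR R) * S) : \bar R := (h (z.1.1, z.2) * h (z.1.2, z.2))%:E.

Let mf : measurable_fun setT f := measurable_square_kernel mh.

Let mh_s s : measurable_fun setT (fun w => h (s, w)).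
Proof. exact: (measurable_fun_pair2 s mh). Qed.

Let mh_w w : measurable_fun setT (fun s => h (s, w)).
Proof. exact: (measurable_fun_pair1 w mh). Qed.

Let K0_ge0 : 0 <= K0.
Proof.
rewrite -lee_fin; apply: le_trans (h_sq u).
by apply: integral_ge0 => w _; rewrite lee_fin sqr_ge0.
Qed.

(** A product is at most half the sum of the squares. Besides integrability, this supplies the bound
    for two times in the same cell. *)
Lemma integral_abs_prod_le s t :
  (\int[M]_w `|(h (s, w) * h (t, w))%:E| <= K0%:E)%E.
Proof.
apply: (@le_trans _ _
  (\int[M]_w ((2^-1)%R%:E * (h (s, w) ^+ 2)%:E + (2^-1)%R%:E * (h (t, w) ^+ 2)%:E))%E).
  apply: ge0_le_integral => //=.
  - by do 2 apply: measurableT_comp => //; exact: measurable_funM.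
  - apply: emeasurable_funD; apply: emeasurable_funM => //;
      apply/measurable_EFinP; exact: measurable_funX.
  - move=> w _; rewrite -!EFinM -EFinD lee_fin normrM.
    have : 0 <= (`|h (s, w)| - `|h (t, w)|) ^+ 2 by exact: sqr_ge0.
    by rewrite sqrrB !real_normK ?num_real // => H; lra.
have msq t' : measurable_fun setT (fun w => (h (t', w) ^+ 2)%:E).
  by apply/measurable_EFinP; exact: measurable_funX.
rewrite ge0_integralD //=; last 4 first.
- by move=> w _; rewrite mule_ge0 // lee_fin ?sqr_ge0.
- by apply: emeasurable_funM.
- by move=> w _; rewrite mule_ge0 // lee_fin ?sqr_ge0.
- by apply: emeasurable_funM.
rewrite !ge0_integralZl //=; try by move=> w _; rewrite lee_fin sqr_ge0.
apply: (@le_trans _ _ ((2^-1)%R%:E * K0%:E + (2^-1)%R%:E * K0%:E)%E).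
  by apply: leeD; apply: lee_wpmul2l => //; exact: h_sq.
by rewrite -!EFinM -EFinD lee_fin -mulrDl; lra.
Qed.

Let intf : (sprod mu mu \x M)%E.-integrable setT f.
Proof.
apply/(@integrable12ltyP _ _ _ _ _ (sprod mu mu) M f mf).
have mI : measurable (`[u, v]%classic `*` `[u, v]%classic : set (R * R)).
  exact: measurableX.
apply: (@le_lt_trans _ _ (\int[sprod mu mu]_z
   (K0%:E * (\1_(`[u, v]%classic `*` `[u, v]%classic) z)%:E))%E).
  apply: ge0_le_integral => //=.
  - by move=> z _; exact: integral_ge0.
  - apply: (@measurable_fun_fubini_tonelli_F _ _ _ _ _ M (fun z => `|f z|)%E) => //.
    exact: measurableT_comp.
  - apply: emeasurable_funM => //; apply/measurable_EFinP.
    exact: measurable_indic.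
  - move=> [s t] _; rewrite indicE.
    have [|] := boolP ((s, t) \in _); first by rewrite mule1 => _; exact: integral_abs_prod_le.
    rewrite mule0 => /negP st; rewrite integral0_eq // => w _; rewrite /f /=.
    have [sI|sI] := boolP (s \in `[u, v]); last by rewrite h_supp ?mul0r ?normr0.
    have [tI|tI] := boolP (t \in `[u, v]); last by rewrite (h_supp w tI) mulr0 normr0.
    by exfalso; apply: st; rewrite inE.
rewrite ge0_integralZl //=; last first.
  by apply/measurable_EFinP; exact: measurable_indic.
rewrite integral_indic // setIT /= /sprod product_measure1E //=.
rewrite !lebesgue_measure_itv /=; case: ifP => _; last by rewrite !mule0 ltry.
by rewrite -EFinB -!EFinM ltry.
Qed.

Let int_w w : mu.-integrable setT (fun s => (h (s, w))%:E).
Proof.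
have : mu.-integrable `[u, v]%classic (EFin \o (fun s => h (s, w))).
  apply: measurable_bounded_integrable => //.
  - exact: lebesgue_itv_lty.
  - exact: measurable_funTS.
  - by exists K; split; rewrite ?num_real // => x Kx y _; exact: le_trans (ltW Kx).
rewrite (_ : (fun s => _) = (EFin \o (fun s => h (s, w))) \_ `[u, v]%classic).
  by move=> H; apply/integrable_restrict => //=; rewrite setTI.
apply/funext => s; rewrite /patch; case: ifPn => // sI; rewrite h_supp //.
by move: sI; rewrite notin_setE /= => /negP.
Qed.

Lemma integral_sq_Rintegral_itvE :
  (\int[M]_w ((\int[mu]_s h (s, w)) ^+ 2)%:E =
   \int[sprod mu mu]_z \int[M]_w (h (z.1, w) * h (z.2, w))%:E)%E.
Proof. exact: integral_sq_RintegralE mh intf int_w. Qed.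

(** Only pairs of times in a band of half-width [delta] around the diagonal contribute, and its part
    over [[u, v]] has area at most 2 delta (v - u). The hypothesis bounds the signed covariances
    from above only, so nonpositive ones far from the diagonal are harmless. *)
Lemma integral_sq_Rintegral_le (A delta : R) : 0 <= A -> 0 <= delta -> u <= v ->
  (forall s t, s \in `[u, v] -> t \in `[u, v] ->
    (\int[M]_w (h (s, w) * h (t, w))%:E <=
     (if (`|s - t| <= delta)%R then A else 0%R)%:E)%E) ->
  (\int[M]_w ((\int[mu]_s h (s, w)) ^+ 2)%:E <=
   (2 * A * delta * (v - u))%:E)%E.
Proof.
move=> A0 d0 uv hA; rewrite integral_sq_Rintegral_itvE.
pose I s : R := \1_(`[u, v]%classic) s.
pose k (z : measurableTypeR R * measurableTypeR R) : \bar R :=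
  ((A * I z.1) * \1_(`[z.1 - delta, z.1 + delta]%classic) z.2)%:E.
have I_ge0 s : 0 <= I s by [].
pose p1 (z : measurableTypeR R * measurableTypeR R) : R := z.1.
pose p2 (z : measurableTypeR R * measurableTypeR R) : R := z.2.
have mp1 : measurable_fun setT p1 by exact: measurable_fst.
have mp2 : measurable_fun setT p2 by exact: measurable_snd.
pose B := [set z : measurableTypeR R * measurableTypeR R |
   (p1 z - delta <= p2 z) && (p2 z <= p1 z + delta)].
have mB : measurable B.
  rewrite -[B]setTI; apply: (@measurable_fun_bool _ _ _
    (fun z : measurableTypeR R * measurableTypeR R =>
      (p1 z - delta <= p2 z) && (p2 z <= p1 z + delta)) true) => //.
  apply: measurable_and => //.
    apply: (@measurable_fun_ler _ _ _ _ (fun z => p1 z - delta) p2) => //.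
    exact: measurable_funB.
  apply: (@measurable_fun_ler _ _ _ _ p2 (fun z => p1 z + delta)) => //.
  exact: measurable_funD.
have kE : k = fun z => ((A * I z.1) * \1_B z)%:E.
  by apply/funext => -[s t]; rewrite /k !indicE; congr (_ * (nat_of_bool _)%:R)%:E;
  apply/idP/idP; rewrite !inE /B /= in_itv.
have mk : measurable_fun setT k.
  rewrite kE; apply/measurable_EFinP; apply: measurable_funM.
    apply: measurable_funM => //.
    apply: measurableT_comp; last exact: measurable_fst.
    exact: measurable_indic.
  exact: measurable_indic.
have k0 z : (0 <= k z)%E by rewrite lee_fin !mulr_ge0.
have le_k z : (\int[M]_w f (z, w) <= k z)%E.
  case: z => s t; rewrite /f /=.
  have [sI|sI] := boolP (s \in `[u, v]); last first.
    by rewrite integral0_eq ?k0 // => w _; rewrite h_supp ?mul0r.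
  have [tI|tI] := boolP (t \in `[u, v]); last first.
    by rewrite integral0_eq ?k0 // => w _; rewrite (h_supp w tI) mulr0.
  apply: (le_trans (hA _ _ sI tI)).
  rewrite lee_fin /k /I !indicE mem_set //= mulr1.
  case: ifPn => [st|_]; last by rewrite mulr_ge0.
  rewrite mem_set ?mulr1 //= in_itv /=.
  by move: st; rewrite ler_norml => /andP[? ?]; apply/andP; split; lra.
(* The inner integral is signed: its positive part is compared with [k] and its negative part is
   dropped. *)
rewrite integralE; apply: (@le_trans _ _ (\int[sprod mu mu]_z k z)%E).
  apply: (@le_trans _ _ (\int[sprod mu mu]_z
      (fun z => \int[M]_w f (z, w))^\+ z)%E).
    by rewrite -[leRHS]sube0; apply: leeB => //; exact: integral_ge0.
  apply: ge0_le_integral => //=.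
    apply: measurable_funepos; exact: (measurable_fubini_F intf).
  by move=> z _; rewrite funeposE ge_max le_k k0.
rewrite /sprod (fubini_tonelli1 k) // /fubini_F.
apply: (@le_trans _ _ (\int[mu]_s ((2 * A * delta)%:E * (I s)%:E))%E).
  apply: ge0_le_integral => //=.
  - by move=> s _; exact: integral_ge0.
  - exact: (measurable_fun_fubini_tonelli_F k).
  - by apply: emeasurable_funM => //; apply/measurable_EFinP; exact: measurable_indic.
  - move=> s _; rewrite /k /=.
    under eq_integral do rewrite EFinM.
    rewrite ge0_integralZl //=; last 2 first.
    - by apply/measurable_EFinP; exact: measurable_indic.
    - by rewrite lee_fin mulr_ge0.
    rewrite integral_indic // setIT.
    apply: (@le_trans _ _ ((A * I s)%:E * (2 * delta)%:E)%E).
      apply: lee_wpmul2l; first by rewrite lee_fin mulr_ge0.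
      by apply: lebesgue_itv_le; lra.
    by rewrite -!EFinM lee_fin; have := I_ge0 s; nra.
have mI : measurable_fun setT (EFin \o I).
  by apply/measurable_EFinP; exact: measurable_indic.
rewrite (ge0_integralZl mu measurableT mI) //=; first last.
- by rewrite lee_fin !mulr_ge0.
- by move=> s _; rewrite lee_fin.
rewrite integral_indic // setIT [leRHS]EFinM.
apply: lee_wpmul2l; first by rewrite lee_fin !mulr_ge0.
by apply: lebesgue_itv_le => //; rewrite subr_ge0.
Qed.

(** A band of half-width [v - u] contains the whole square, so the second moments alone give the
    bound, without any cancellation. *)
Lemma integral_sq_Rintegral_le_cst : u <= v ->
  (\int[M]_w ((\int[mu]_s h (s, w)) ^+ 2)%:E <= (2 * K0 * (v - u) ^+ 2)%:E)%E.
Proof.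
move=> uv; rewrite expr2 mulrA; apply: integral_sq_Rintegral_le => //.
  by rewrite subr_ge0.
move=> s t; rewrite !in_itv /= => /andP[? ?] /andP[? ?].
rewrite ifT; last by rewrite ler_norml; apply/andP; split; lra.
apply: le_trans (integral_abs_prod_le s t).
apply: le_trans (lee_abs _) _.
by apply: le_abse_integral => //; apply/measurable_EFinP; exact: measurable_funM.
Qed.

End square_of_integral_on_interval.

(** * Gaussian laws *)

(** A density specified by its integrals over measurable sets is almost everywhere equal to the
    Radon-Nikodym derivative, for which the change of variables is known. *)
Lemma ge0_integral_density d (T : measurableType d) (R : realType)
    (nu : {finite_measure set T -> \bar R})
    (m : {sigma_finite_measure set T -> \bar R}) (p f : T -> \bar R) :
  measurable_fun setT p -> (forall x, 0 <= p x)%E ->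
  (forall A, measurable A -> nu A = \int[m]_(x in A) p x)%E ->
  measurable_fun setT f -> (forall x, 0 <= f x)%E ->
  (\int[nu]_x f x = \int[m]_x (f x * p x))%E.
Proof.
move=> mp p0 nuE mf f0.
have numu : nu `<< m.
  apply/null_content_dominatesP => A mA mA0; rewrite nuE //.
  by apply: null_set_integral => //; exact: measurable_funTS.
rewrite -(Radon_Nikodym_SigmaFinite.change_of_variables numu) //.
apply: ae_eq_integral => //.
- apply: emeasurable_funM => //.
  exact: measurable_int (Radon_Nikodym_SigmaFinite.f_integrable numu).
- exact: emeasurable_funM.
- apply: ae_eqe_mul2l; apply: integral_ae_eq => //.
    exact: Radon_Nikodym_SigmaFinite.f_integrable.
  by move=> E _ mE; rewrite -nuE // -Radon_Nikodym_SigmaFinite.f_integral.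
Qed.

Lemma integral_density d (T : measurableType d) (R : realType)
    (nu : {finite_measure set T -> \bar R})
    (m : {sigma_finite_measure set T -> \bar R}) (p : T -> R) (f : T -> \bar R) :
  measurable_fun setT p -> (forall x, 0 <= p x) ->
  (forall A, measurable A -> nu A = \int[m]_(x in A) (p x)%:E)%E ->
  measurable_fun setT f ->
  (\int[nu]_x f x = \int[m]_x (f x * (p x)%:E))%E.
Proof.
move=> mp p0 nuE mf; rewrite integralE [RHS]integralE.
have mpE : measurable_fun setT (EFin \o p) by exact/measurable_EFinP.
congr (_ - _)%E.
  rewrite (@ge0_integral_density _ _ _ nu m (EFin \o p)) //; last first.
    exact: measurable_funepos.
  by apply: eq_integral => x _; rewrite !funeposE maxe_pMl ?mul0e ?lee_fin.
rewrite (@ge0_integral_density _ _ _ nu m (EFin \o p)) //; last first.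
  exact: measurable_funeneg.
by apply: eq_integral => x _; rewrite !funenegE maxe_pMl ?mul0e ?lee_fin // mulNe.
Qed.

Section real_inequalities.
Context {R : realType}.

(** The exponents met below, [2 * kappa + 1] and [2 * kappa + 2], are both at most 4, so one
    comparison with a quartic serves for all of them. *)
Lemma powR_le_quartic (v p : R) : 0 <= v -> 0 <= p <= 4 -> v `^ p <= 1 + v ^+ 4.
Proof.
move=> v0 /andP[p0 p4]; have [v1|/ltW v1] := leP v 1.
  apply: (@le_trans _ _ 1); last by rewrite lerDl exprn_ge0.
  have := ge0_ler_powR p0 v0 (ler01 : 1 \in Num.nneg) v1.
  by rewrite powR1.
apply: (@le_trans _ _ (v `^ 4%:R)); first exact: ler_powR.
by rewrite powR_mulrn // lerDr.
Qed.

Lemma expR_ge_sqr (c u : R) : 0 < c -> 0 <= u ->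
  1 + (u / c) ^+ 2 / 2 <= expR (u / c).
Proof. by move=> c0 u0; exact: (@expR_ge1Dxn _ _ 1) (divr_ge0 u0 (ltW c0)). Qed.

End real_inequalities.

Section gauss.
Context {R : realType}.
Notation mu := (@lebesgue_measure R).

(** The parameter is the variance. At 0 the law is the Dirac mass, that of a zero increment, so that
    times which are themselves nodes need no separate treatment. *)
Definition gauss (t : R) : probability (measurableTypeR R) R :=
  if t == 0 then [the probability _ _ of dirac (0 : measurableTypeR R)]
  else [the probability _ _ of normal_prob 0 (Num.sqrt t)].

Let gpdf (t z : R) := normal_pdf 0 (Num.sqrt t) z.

Lemma integral_gauss0 (f : R -> \bar R) : measurable_fun setT f ->
  (\int[gauss 0%R]_z f z = f 0%R)%E.
Proof.
move=> mf; rewrite /gauss eqxx /= integral_dirac //.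
by rewrite diracT mul1e.
Qed.

Lemma integral_gauss_pdf (t : R) (f : R -> \bar R) : 0 < t ->
  measurable_fun setT f ->
  (\int[gauss t]_z f z = \int[mu]_z (f z * (normal_pdf 0 (Num.sqrt t) z)%:E))%E.
Proof.
move=> t0 mf; rewrite /gauss gt_eqF //=.
apply: (@integral_density _ _ _ (normal_prob 0 (Num.sqrt t)) mu
  (normal_pdf 0 (Num.sqrt t))) => //.
- exact: measurable_normal_pdf.
- by move=> z; rewrite normal_pdf_ge0.
Qed.

Let integral_gaussE (t : R) (f : R -> \bar R) : 0 < t -> measurable_fun setT f ->
  (forall z, 0 <= f z)%E ->
  (\int[gauss t]_z f z = \int[mu]_z (f z * (gpdf t z)%:E))%E.
Proof. by move=> t0 mf _; exact: integral_gauss_pdf. Qed.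

Lemma normal_pdf_sqrtE (t z : R) : 0 < t ->
  normal_pdf 0 (Num.sqrt t) z = (Num.sqrt (t * pi *+ 2))^-1 * expR (- (z ^+ 2 / t / 2)).
Proof.
move=> t0; rewrite normal_pdfE ?gt_eqF ?sqrtr_gt0 //.
rewrite /normal_peak /normal_fun sqr_sqrtr ?ltW // subr0; congr (_ * expR _).
by rewrite -mulr_natr invfM mulNr mulrA.
Qed.

Let gpdfE (t z : R) : 0 < t ->
  gpdf t z = (Num.sqrt (t * pi *+ 2))^-1 * expR (- (z ^+ 2 / t / 2)).
Proof. exact: normal_pdf_sqrtE. Qed.

Let peak_le (t : R) : 0 < t -> (Num.sqrt (t * pi *+ 2))^-1 <= (Num.sqrt t)^-1.
Proof.
move=> t0; have pi2 : 2 <= pi :> R by exact: pi_ge2.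
rewrite lef_pV2 ?posrE ?sqrtr_gt0 //; last first.
  by rewrite pmulrn_lgt0 // mulr_gt0 // pi_gt0.
by rewrite ler_wsqrtr // -mulr_natr; nra.
Qed.

Lemma gauss_le_lebesgue (t : R) (f : R -> \bar R) : 0 < t -> measurable_fun setT f ->
  (forall z, 0 <= f z)%E ->
  (\int[gauss t]_z f z <= ((Num.sqrt t)^-1)%:E * \int[mu]_z f z)%E.
Proof.
move=> t0 mf f0; rewrite integral_gaussE //.
rewrite -(ge0_integralZl mu measurableT mf) ?lee_fin ?invr_ge0 ?sqrtr_ge0 //.
have mp : measurable_fun setT (fun z => (gpdf t z)%:E).
  by apply/measurable_EFinP; exact: measurable_normal_pdf.
apply: ge0_le_integral => //=.
- by move=> z _; rewrite mule_ge0 // lee_fin normal_pdf_ge0.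
- exact: emeasurable_funM.
- exact: emeasurable_funM.
move=> z _; rewrite muleC; apply: lee_wpmul2r => //; rewrite lee_fin gpdfE //.
apply: le_trans (peak_le t0); rewrite ler_piMr ?invr_ge0 ?sqrtr_ge0 //.
by rewrite expR_le1 oppr_le0 !divr_ge0 ?sqr_ge0 ?ltW.
Qed.

Lemma integral_gauss_opp (t : R) (f : R -> \bar R) : 0 <= t -> measurable_fun setT f ->
  (\int[gauss t]_z f (- z)%R = \int[gauss t]_z f z)%E.
Proof.
have ge0_case (t' : R) g : 0 < t' -> measurable_fun setT g -> (forall z, 0 <= g z)%E ->
    (\int[gauss t']_z g (- z)%R = \int[gauss t']_z g z)%E.
  move=> t0 mg g0; rewrite !integral_gaussE //; last exact: measurableT_comp.
  rewrite -[RHS]lebesgue_integral_opp; last first.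
    apply: emeasurable_funM => //.
    by apply/measurable_EFinP; exact: measurable_normal_pdf.
  by apply: eq_integral => z _; rewrite !gpdfE // sqrrN.
rewrite le_eqVlt => /predU1P[<-|t0] mf.
  by rewrite !integral_gauss0 ?oppr0 //; exact: measurableT_comp.
rewrite -[LHS]/(\int[gauss t]_z (f \o -%R) z)%E integralE [RHS]integralE.
rewrite (funepos_comp f) (funeneg_comp f).
by congr (_ - _)%E; apply: ge0_case => //;
  [exact: measurable_funepos|exact: measurable_funeneg].
Qed.

(** No moment is computed: half of the Gaussian exponent absorbs the quartic, and the other half is
    the exponent of the density of variance [2 * t], whose mass is 1. The constant 64 is 32 for the
    absorption times 2 for the ratio of the two peaks. *)
Lemma gauss_quartic_le (t : R) : 0 < t ->
  (\int[gauss t]_z (1 + (z ^+ 2 / t) ^+ 2)%:E <= 64%:E)%E.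
Proof.
move=> t0.
have mq : measurable_fun setT (fun z : R => (1 + (z ^+ 2 / t) ^+ 2)%:E).
  apply/measurable_EFinP; apply: measurable_funD => //.
  by apply: measurable_funX; apply: measurable_funM.
rewrite integral_gaussE //; last first.
  by move=> z; rewrite lee_fin addr_ge0 // sqr_ge0.
have mp (t' : R) : measurable_fun setT (fun z => (gpdf t' z)%:E).
  by apply/measurable_EFinP; exact: measurable_normal_pdf.
apply: (@le_trans _ _ (\int[mu]_z (64%:E * (gpdf (2 * t) z)%:E))%E); last first.
  rewrite (ge0_integralTZl mu (f := fun z => (gpdf (2 * t) z)%:E)) //.
  - by rewrite integral_normal_pdf mule1.
  - exact: mp.
  - by move=> z; rewrite lee_fin normal_pdf_ge0.
apply: ge0_le_integralT => [|||z].
- by apply: emeasurable_funM => //; exact: mp.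
- by apply: emeasurable_funM => //; exact: mp.
- by move=> z; rewrite lee_fin mulr_ge0 ?normal_pdf_ge0 ?addr_ge0 ?sqr_ge0.
rewrite -!EFinM lee_fin !gpdfE ?mulr_gt0 //.
set u := z ^+ 2 / t; have u0 : 0 <= u by rewrite divr_ge0 ?sqr_ge0 ?ltW.
have -> : z ^+ 2 / (2 * t) / 2 = u / 4.
  by rewrite /u invfM; field; rewrite gt_eqF.
have -> : expR (- (u / 2)) = expR (- (u / 4)) * expR (- (u / 4)).
  by rewrite -expRD; congr expR; field.
have e0 : 0 < expR (- (u / 4)) by exact: expR_gt0.
have eu : (1 + u ^+ 2) * expR (- (u / 4)) <= 32.
  rewrite expRN ler_pdivrMr ?expR_gt0 //.
  have := @expR_ge_sqr _ 4 u ltac:(lra) u0.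
  rewrite (_ : (u / 4) ^+ 2 = u ^+ 2 / 16); last by field.
  lra.
have p0 : 0 < (Num.sqrt (2 * t * pi *+ 2))^-1.
  by rewrite invr_gt0 sqrtr_gt0 pmulrn_lgt0 // !mulr_gt0 // pi_gt0.
have pp : (Num.sqrt (t * pi *+ 2))^-1 <= 2 * (Num.sqrt (2 * t * pi *+ 2))^-1.
  have s0 : 0 < Num.sqrt (t * pi *+ 2).
    by rewrite sqrtr_gt0 pmulrn_lgt0 // !mulr_gt0 // pi_gt0.
  rewrite (_ : 2 * t * pi *+ 2 = 2 * (t * pi *+ 2)); last first.
    by rewrite mulrnAr mulrA.
  rewrite sqrtrM // invfM mulrA ler_pMl ?invr_gt0 //.
  rewrite ler_pdivlMr ?sqrtr_gt0 // mul1r -[leRHS]ger0_norm // -sqrtr_sqr.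
  by apply: ler_wsqrtr; rewrite -natrX ler_nat.
set a := (Num.sqrt (t * pi *+ 2))^-1 in pp *; set c := (Num.sqrt _)^-1 in pp *.
set e := expR _ in e0 eu *.
have a0 : 0 <= a by rewrite invr_ge0 sqrtr_ge0.
apply: (@le_trans _ _ (32 * (a * e))).
  rewrite (_ : _ * (a * (e * e)) = (1 + u ^+ 2) * e * (a * e)); last by ring.
  by rewrite ler_wpM2r // mulr_ge0 // ltW.
rewrite !mulrA ler_wpM2r ?(ltW e0) //; lra.
Qed.

(** In terms of v = |z| / sqrt t, the Gaussian density times |z|^p equals t^((p-1)/2) times a
    bounded function of v. Hence a Gaussian mean is controlled by an integral with the singular
    weight of the Sobolev-Slobodeckij semi-norm; for p = 2 kappa + 1 the power of t is kappa. The
    condition [G 0 = 0] settles the origin and the case of zero variance. *)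
Lemma gauss_slobodeckij_le (p t : R) (G : R -> R) : 1 <= p <= 4 -> 0 <= t ->
  measurable_fun setT G -> (forall z, 0 <= G z) -> G 0 = 0 ->
  (\int[gauss t]_z (G z)%:E <=
   (8 * t `^ ((p - 1) / 2))%:E * \int[mu]_z (G z / `|z| `^ p)%:E)%E.
Proof.
move=> /andP[p1 p4] t0 mG G0 Gz.
have mGE : measurable_fun setT (EFin \o G) by exact/measurable_EFinP.
have Gp0 z : 0 <= G z / `|z| `^ p by rewrite divr_ge0 ?powR_ge0.
move: t0; rewrite le_eqVlt => /predU1P[<-|t0].
  rewrite integral_gauss0 // Gz mule_ge0 ?lee_fin ?mulr_ge0 ?powR_ge0 //.
  by apply: integral_ge0 => z _; rewrite lee_fin.
have mGp : measurable_fun setT (fun z => (G z / `|z| `^ p)%:E).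
  apply/measurable_EFinP; apply: measurable_funM => //.
  under eq_fun do rewrite -powRN.
  exact: (measurableT_comp (measurable_powR _)).
rewrite integral_gaussE // -ge0_integralTZl //; last first.
  by rewrite mulr_ge0 // powR_ge0.
have mp : measurable_fun setT (fun z => (gpdf t z)%:E).
  by apply/measurable_EFinP; exact: measurable_normal_pdf.
apply: ge0_le_integralT => [|||z].
- exact: emeasurable_funM.
- exact: emeasurable_funM.
- by move=> z; rewrite lee_fin mulr_ge0 ?normal_pdf_ge0.
rewrite -!EFinM lee_fin gpdfE //.
have [->|z0] := eqVneq z 0; first by rewrite Gz !mul0r mulr0.
rewrite [leRHS]mulrCA ler_wpM2l // ler_pdivlMr ?powR_gt0 ?normr_gt0 //.
set s := Num.sqrt t; have s0 : 0 < s by rewrite sqrtr_gt0.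
pose v := `|z| / s; have v0 : 0 <= v by rewrite divr_ge0 // ltW.
have -> : z ^+ 2 / t / 2 = v ^+ 2 / 2.
  by rewrite /v expr_div_n sqr_sqrtr ?ltW // -normrX ger0_norm ?sqr_ge0.
have -> : `|z| `^ p = s * t `^ ((p - 1) / 2) * v `^ p.
  have {1}-> : `|z| = s * v by rewrite /v mulrC divfK // gt_eqF.
  rewrite powRM ?(ltW s0) ?v0 //; congr (_ * _).
  rewrite /s -powR12_sqrt ?(ltW t0) // -powRrM -powRD ?(gt_eqF t0) ?implybT //.
  by congr (_ `^ _); field.
have vp : v `^ p <= 1 + v ^+ 4 by apply: powR_le_quartic => //; apply/andP; split; lra.
have ev : (1 + v ^+ 4) * expR (- (v ^+ 2 / 2)) <= 8.
  rewrite expRN ler_pdivrMr ?expR_gt0 //.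
  have := @expR_ge_sqr _ 2 (v ^+ 2) ltac:(lra) (sqr_ge0 _).
  rewrite (_ : (v ^+ 2 / 2) ^+ 2 = v ^+ 4 / 4); last by field.
  lra.
have e0 : 0 < expR (- (v ^+ 2 / 2)) by exact: expR_gt0.
have k0 : 0 <= t `^ ((p - 1) / 2) by exact: powR_ge0.
have := peak_le t0; rewrite -/s; set a := (Num.sqrt _)^-1 => pa.
have a0 : 0 <= a by rewrite invr_ge0 sqrtr_ge0.
have as1 : a * s <= 1 by rewrite -ler_pdivlMr // mul1r.
set k := t `^ _ in k0 *; set e := expR _ in e0 ev *; set w := v `^ p in vp *.
rewrite (_ : a * e * (s * k * w) = (a * s) * (k * (w * e))); last by ring.
have we : w * e <= 8 by apply: le_trans ev; rewrite ler_wpM2r // ltW.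
have w0 : 0 <= w by exact: powR_ge0.
apply: (@le_trans _ _ (1 * (k * (w * e)))).
  by rewrite ler_wpM2r // !mulr_ge0 // ltW.
by rewrite mul1r mulrC ler_wpM2r.
Qed.

End gauss.

(** * Autocorrelation *)

Section bounded_integrable.
Context {R : realType}.
Notation mu := (@lebesgue_measure R).

(** A class stable under translations and differences, so that it contains the increments of its
    members, and on which products are integrable. *)
Definition bounded_L1 (chi : R -> R) := [/\ measurable_fun setT chi,
  (exists2 M, 0 <= M & forall x, `|chi x| <= M) &
  mu.-integrable setT (EFin \o chi)].

Lemma measurable_addr (a : R) : measurable_fun setT (fun x : R => x + a).
Proof. exact: measurable_funD. Qed.

Lemma integrable_shift (a : R) (f : R -> R) :
  mu.-integrable setT (EFin \o f) ->
  mu.-integrable setT (fun x => (f (x + a))%:E).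
Proof.
move=> /integrableP[/= mf intf]; apply/integrableP; split.
  exact: (measurableT_comp (f := EFin \o f)) (measurable_addr a).
rewrite (@lebesgue_integral_shift _ a (fun x => `|(f x)%:E|%E)) //.
exact: measurableT_comp.
Qed.

Lemma bounded_L1_shift (a : R) chi : bounded_L1 chi ->
  bounded_L1 (fun x => chi (x + a)).
Proof.
move=> [mchi [M M0 chiM] ichi]; split; last exact: integrable_shift.
  exact: (measurableT_comp mchi (measurable_addr a)).
by exists M.
Qed.

Lemma bounded_L1B chi psi : bounded_L1 chi -> bounded_L1 psi ->
  bounded_L1 (fun x => chi x - psi x).
Proof.
move=> [mchi [M M0 chiM] ichi] [mpsi [N N0 psiN] ipsi]; split.
- exact: measurable_funB.
- exists (M + N); first exact: addr_ge0.
  by move=> x; rewrite (le_trans (ler_normB _ _)) // lerD.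
- by have := integrableB measurableT ichi ipsi.
Qed.

Lemma bounded_L1M chi psi : bounded_L1 chi -> bounded_L1 psi ->
  mu.-integrable setT (fun x => (chi x * psi x)%:E).
Proof.
move=> [mchi _ ichi] [mpsi [N N0 psiN] _].
apply: (@le_integrable _ _ _ mu setT measurableT _
  (fun x => N%:E * (chi x)%:E)%E).
- by apply/measurable_EFinP; exact: measurable_funM.
- move=> x _; rewrite -EFinM !abse_EFin lee_fin !normrM (ger0_norm N0) mulrC.
  by rewrite ler_wpM2r.
- exact: integrableZl.
Qed.

Definition autocorr (chi : R -> R) (y : R) : R :=
  \int[mu]_x (chi x * chi (x + y)).

Lemma autocorrE chi (a b : R) : bounded_L1 chi ->
  \int[mu]_x (chi (x + a) * chi (x + b)) = autocorr chi (b - a).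
Proof.
move=> bchi; have [mchi _ _] := bchi; rewrite /autocorr /Rintegral.
rewrite -[in RHS](@lebesgue_integral_shift _ a); last first.
  apply/measurable_EFinP; apply: measurable_funM => //.
  exact: (measurableT_comp mchi (measurable_addr _)).
by congr fine; apply: eq_integral => x _; do 3 f_equal; ring.
Qed.

Lemma autocorr_bounded chi : bounded_L1 chi ->
  exists2 M, 0 <= M & forall y, `|autocorr chi y| <= M.
Proof.
move=> bchi; have [mchi [M M0 chiM] ichi] := bchi.
exists (M * \int[mu]_x `|chi x|).
  by rewrite mulr_ge0 // Rintegral_ge0.
have iabs : mu.-integrable setT (EFin \o (fun x => `|chi x|)).
  exact: integrable_abse ichi.
have iprod y : mu.-integrable setT (EFin \o (fun x => chi x * chi (x + y))).
  exact: bounded_L1M bchi (bounded_L1_shift y bchi).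
move=> y; apply: le_trans (le_normr_Rintegral measurableT (iprod y)) _.
rewrite -RintegralZl //; apply: le_Rintegral => //.
- exact: integrable_abse (iprod y).
- exact: (integrableZl measurableT M iabs).
- by move=> x _; rewrite normrM mulrC ler_wpM2r.
Qed.

Lemma measurable_autocorr chi : bounded_L1 chi ->
  measurable_fun setT (autocorr chi).
Proof.
move=> bchi; have [mchi _ _] := bchi.
pose f (z : measurableTypeR R * measurableTypeR R) : R := chi z.2 * chi (z.2 + z.1).
apply: (@measurable_Rintegral_param _ _ _ _ _ mu f); apply: measurable_funM.
  exact: (measurableT_comp mchi measurable_snd).
apply: (measurableT_comp mchi).
exact: (measurable_funD measurable_snd measurable_fst).
Qed.

(** Up to sign, the second difference of an autocorrelation with step [z] is the autocorrelation of
    the increment of [chi] at lag [z]. This is how positivity turns into information on second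
    differences. *)
Lemma autocorrB_shift chi z y : bounded_L1 chi ->
  autocorr (fun x => chi x - chi (x + z)) y =
  2 * autocorr chi y - autocorr chi (y + z) - autocorr chi (y - z).
Proof.
move=> bchi.
have ip a b : mu.-integrable setT (EFin \o (fun x => chi (x + a) * chi (x + b))).
  by apply: bounded_L1M; exact: bounded_L1_shift.
rewrite {1}/autocorr.
under eq_Rintegral => x _.
  rewrite (_ : _ * _ = (chi (x + 0) * chi (x + y) - chi (x + 0) * chi (x + (y + z)))
    - (chi (x + z) * chi (x + y) - chi (x + z) * chi (x + (y + z)))).
    over.
  by rewrite addr0 addrA; ring.
rewrite RintegralB //; [|exact: (integrableB measurableT (ip _ _) (ip _ _))..].
rewrite !RintegralB // !autocorrE // !subr0 addrK; ring.
Qed.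

End bounded_integrable.

(** * Positivity, monotonicity and convexity of Gaussian means of autocorrelations *)

Section gauss_autocorr.
Context {R : realType}.
Notation mu := (@lebesgue_measure R).

Section positivity.
Variables (t : R) (chi : R -> R).
Hypotheses (t0 : 0 < t) (bchi : bounded_L1 chi).

(** Up to a constant, the centred Gaussian density of variance [t / 2]: the convolution square root
    of the one of variance [t]. *)
Let q (u : R) := expR (- (u ^+ 2 / t)).

Let mq : measurable_fun setT q.
Proof.
apply: (measurableT_comp (f := @expR R)) => //.
apply: (measurableT_comp (f := -%R : R -> R)) => //.
by apply: measurable_funM.
Qed.

Let q_ge0 u : 0 <= q u. Proof. exact: expR_ge0. Qed.

Let q_le1 u : q u <= 1.
Proof. by rewrite expR_le1 oppr_le0 divr_ge0 ?sqr_ge0 ?ltW. Qed.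

Let K := Num.sqrt (t / 4 * pi *+ 2).

Let K_gt0 : 0 < K.
Proof. by rewrite sqrtr_gt0 pmulrn_lgt0 // !mulr_gt0 // pi_gt0. Qed.

(** Completing the square at the midpoint of [x] and [y] leaves a Gaussian in [w] of variance
    [t / 4], with normalizing constant [K]. *)
Let integral_qq x y : (\int[mu]_w (q (x - w) * q (y - w))%:E =
  (K * expR (- ((y - x) ^+ 2 / t / 2)))%:E)%E.
Proof.
have t4 : 0 < t / 4 by rewrite divr_gt0.
set c := K * _.
have c0 : 0 <= c by rewrite mulr_ge0 ?expR_ge0 // ltW.
have mp : measurable_fun setT (fun w => (normal_pdf 0 (Num.sqrt (t / 4)) w)%:E).
  by apply/measurable_EFinP; exact: measurable_normal_pdf.
transitivity (\int[mu]_w (c%:E *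
    (normal_pdf 0 (Num.sqrt (t / 4)) (w + - ((x + y) / 2))%R)%:E))%E.
  apply: eq_integral => w _; rewrite -EFinM normal_pdf_sqrtE //; congr EFin.
  rewrite -/K /c [RHS]mulrACA divff ?gt_eqF // mul1r /q.
  rewrite -!expRD; congr expR; field; exact: lt0r_neq0.
rewrite ge0_integralTZl //; last 2 first.
- by apply: (measurableT_comp mp); exact: measurable_addr.
- by move=> w; rewrite lee_fin normal_pdf_ge0.
rewrite (@lebesgue_integral_shift _ _ (fun w => (normal_pdf 0 _ w)%:E)) //.
by rewrite integral_normal_pdf mule1.
Qed.

Let h (z : measurableTypeR R * measurableTypeR R) : R := chi z.1 * q (z.1 - z.2).

Let mh : measurable_fun setT h.
Proof.
have [mchi _ _] := bchi; apply: measurable_funM.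
  exact: (measurableT_comp mchi measurable_fst).
apply: (measurableT_comp mq).
exact: (measurable_funB measurable_fst measurable_snd).
Qed.

Let f (z : (measurableTypeR R * measurableTypeR R) * measurableTypeR R) : \bar R :=
  (h (z.1.1, z.2) * h (z.1.2, z.2))%:E.

Let prod_integrable (phi : R * R -> R) : measurable_fun setT phi ->
  (forall x y, `|phi (x, y)| <= `|chi x| * `|chi y|) ->
  (mu \x mu)%E.-integrable setT (EFin \o phi).
Proof.
move=> mphi phi_le; have [mchi _ ichi] := bchi.
have mabs : measurable_fun setT (fun x => `|(chi x)%:E|%E).
  by do 2 apply: measurableT_comp => //.
apply/(@integrable12ltyP _ _ _ _ _ mu mu (EFin \o phi)).
  exact/measurable_EFinP.
have /integrableP[_] := ichi; set C := (\int[mu]_x _)%E => Clty.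
have C0 : (0 <= C)%E by exact: integral_ge0.
apply: (@le_lt_trans _ _ (\int[mu]_x (`|(chi x)%:E| * C))%E).
  apply: ge0_le_integralT => [|||x].
  - apply: (@measurable_fun_fubini_tonelli_F _ _ _ _ _ mu (fun z => `|(phi z)%:E|%E)) => //.
    by do 2 apply: measurableT_comp => //.
  - by apply: emeasurable_funM => //; exact: mabs.
  - by move=> x; exact: integral_ge0.
  rewrite /C -ge0_integralZl //.
  apply: ge0_le_integralT => [|||y] //.
  - apply: measurableT_comp => //; apply/measurable_EFinP.
    exact: (measurable_fun_pair2 x mphi).
  - by apply: emeasurable_funM => //; exact: mabs.
  - by rewrite -abseM -EFinM !abse_EFin lee_fin normrM.
rewrite ge0_integralZr // lte_mul_pinfty ?ge0_fin_numE //.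
Qed.

Let integral_f x y : (\int[mu]_w f ((x, y), w) =
  (K * (chi x * chi y * expR (- ((y - x) ^+ 2 / t / 2))))%:E)%E.
Proof.
rewrite /f /h /=.
transitivity (\int[mu]_w ((chi x * chi y)%:E * (q (x - w) * q (y - w))%:E))%E.
  by apply: eq_integral => w _; rewrite -EFinM; congr EFin; ring.
have mqq : measurable_fun setT (fun w : R => (q (x - w) * q (y - w))%:E).
  apply/measurable_EFinP; apply: measurable_funM;
    by apply: (measurableT_comp mq); exact: measurable_funB.
have iqq : mu.-integrable setT (fun w : R => (q (x - w) * q (y - w))%:E).
  apply/integrableP; split => //.
  under eq_integral do rewrite gee0_abs ?lee_fin ?mulr_ge0 //.
  by rewrite integral_qq ltry.
rewrite (integralZl measurableT iqq) integral_qq -EFinM.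
by congr EFin; ring.
Qed.

Definition gauss_kernel (z : measurableTypeR R * measurableTypeR R) : R :=
  chi z.1 * chi z.2 * expR (- ((z.2 - z.1) ^+ 2 / t / 2)).

Lemma gauss_kernel_integrable : (mu \x mu)%E.-integrable setT (EFin \o gauss_kernel).
Proof.
have [mchi _ _] := bchi; apply: prod_integrable.
  apply: measurable_funM.
    by apply: measurable_funM; apply: (measurableT_comp mchi);
      [exact: measurable_fst|exact: measurable_snd].
  apply: (measurableT_comp (f := @expR R)) => //.
  apply: (measurableT_comp (f := -%R : R -> R)) => //.
  do 2 apply: measurable_funM => //.
  by apply: measurable_funX; exact: (measurable_funB measurable_snd measurable_fst).
move=> x y; rewrite /gauss_kernel /= !normrM ler_piMr ?mulr_ge0 //.
rewrite ger0_norm ?expR_ge0 // expR_le1 oppr_le0 !divr_ge0 ?sqr_ge0 //.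
exact: ltW.
Qed.

Let integral_abs_f x y :
  (\int[mu]_w `|f ((x, y), w)| = K%:E * `|(gauss_kernel (x, y))%:E|)%E.
Proof.
have mqq : measurable_fun setT (fun w : R => (q (x - w) * q (y - w))%:E).
  apply/measurable_EFinP; apply: measurable_funM;
    by apply: (measurableT_comp mq); exact: measurable_funB.
transitivity (\int[mu]_w (`|chi x * chi y|%:E * (q (x - w) * q (y - w))%:E))%E.
  apply: eq_integral => w _; rewrite /f /h /= -EFinM; congr EFin.
  rewrite -[X in _ = _ * X]ger0_norm ?mulr_ge0 // -normrM; congr (`|_|); ring.
rewrite ge0_integralTZl // => [|w]; last by rewrite lee_fin mulr_ge0.
rewrite integral_qq /gauss_kernel /= -!EFinM; congr EFin.
by rewrite [in RHS]normrM (ger0_norm (expR_ge0 _)); ring.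
Qed.

(** Because the kernel is a convolution square, [K] times this double integral is the integral over
    [w] of the square of the integral of [chi x * q (x - w)]. *)
Lemma integral_gauss_kernel_ge0 :
  (0 <= \int[(mu \x mu)%E]_z (gauss_kernel z)%:E)%E.
Proof.
have [mchi _ ichi] := bchi.
have /integrableP[mk intk] := gauss_kernel_integrable.
have intf : (sprod mu mu \x mu)%E.-integrable setT f.
  apply/(@integrable12ltyP _ _ _ _ _ (sprod mu mu) mu f (measurable_square_kernel mh)).
  rewrite [ltLHS](_ : _ = \int[sprod mu mu]_z (K%:E * `|(gauss_kernel z)%:E|))%E.
    rewrite ge0_integralTZl //; last 2 first.
    - exact: ltW.
    - exact: measurableT_comp.
    by rewrite lte_mul_pinfty ?lee_fin // ltW.
  by apply: eq_integral => -[x y] _; rewrite integral_abs_f.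
have int_w w : mu.-integrable setT (fun x => (h (x, w))%:E).
  apply: (@le_integrable _ _ _ mu setT measurableT _ (EFin \o chi)) => //.
    apply/measurable_EFinP; exact: (measurable_fun_pair1 w mh).
  move=> x _; rewrite !abse_EFin lee_fin /h /= normrM ler_piMr //.
  by rewrite ger0_norm.
have sqE := integral_sq_RintegralE mh intf int_w.
have sq0 : (0 <= \int[mu]_w ((\int[mu]_s h (s, w)) ^+ 2)%:E)%E.
  by apply: integral_ge0 => w _; rewrite lee_fin sqr_ge0.
have intfE : (\int[sprod mu mu]_z \int[mu]_w f (z, w) =
    K%:E * \int[sprod mu mu]_z (gauss_kernel z)%:E)%E.
  rewrite -(integralZl measurableT gauss_kernel_integrable).
  by apply: eq_integral => -[x y] _; rewrite integral_f EFinM.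
have K0 : (0 < K%:E)%E by rewrite lte_fin.
by move: sq0; rewrite sqE intfE pmule_rge0.
Qed.

End positivity.

(** After Fubini and the substitution of [y - x] for [y], the mean becomes the quadratic form of the
    Gaussian kernel at [chi]; at zero variance it is the integral of [chi] squared. *)
Lemma gauss_autocorr_ge0 (t : R) chi : 0 <= t -> bounded_L1 chi ->
  0 <= \int[gauss t]_y autocorr chi y.
Proof.
move=> t_ge0 bchi; have mG := measurable_autocorr bchi.
have mGE : measurable_fun setT (EFin \o autocorr chi) by exact/measurable_EFinP.
have [mchi _ ichi] := bchi.
rewrite /Rintegral fine_ge0 //; move: t_ge0; rewrite le_eqVlt => /predU1P[<-|t0].
  rewrite integral_gauss0 // lee_fin Rintegral_ge0 // => x _.
  by rewrite addr0 -expr2 sqr_ge0.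
rewrite integral_gauss_pdf //.
pose c := (Num.sqrt (t * pi *+ 2))^-1.
have c0 : 0 <= c by rewrite invr_ge0 sqrtr_ge0.
pose k : R * R -> R := gauss_kernel t chi.
have ik : (mu \x mu)%E.-integrable setT (EFin \o k).
  exact: gauss_kernel_integrable.
pose g (z : measurableTypeR R * measurableTypeR R) : R :=
  c * k (z.2, z.1 + z.2).
have gE x y : g (y, x) = c * k (x, y + x) by [].
have mk : measurable_fun setT (EFin \o k) by case/integrableP : ik.
have mg : measurable_fun setT (EFin \o g).
  apply/measurable_EFinP; apply: measurable_funM => //.
  apply: (measurableT_comp (f := k)); first exact/measurable_EFinP.
  apply: measurable_fun_pair; first exact: measurable_snd.
  exact: (measurable_funD measurable_fst measurable_snd).
have mk2 x : measurable_fun setT (fun y : R => (k (x, y))%:E).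
  exact: (measurable_fun_pair2 x mk).
have ick : (mu \x mu)%E.-integrable setT (fun z => c%:E * (EFin \o k) z)%E.
  exact: integrableZl.
have ig : (mu \x mu)%E.-integrable setT (EFin \o g).
  apply/(@integrable21ltyP _ _ _ _ _ mu mu (EFin \o g) mg).
  rewrite [ltLHS](_ : _ = \int[mu]_x \int[mu]_y (c%:E * `|(k (x, y))%:E|))%E.
    have /integrableP[mck] := ick.
    have kE : (\int[mu]_x \int[mu]_y (c%:E * `|(k (x, y))%:E|) =
        \int[mu]_x \int[mu]_y `|c%:E * (EFin \o k) (x, y)|)%E.
      apply: eq_integral => x _; apply: eq_integral => y _.
      by rewrite abseM (gee0_abs (x := c%:E)) ?lee_fin.
    move=> _; rewrite kE.
    exact: (@integrable12ltyP _ _ _ _ _ mu mu _ mck).1 ick.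
  apply: eq_integral => x _.
  rewrite -[RHS](@lebesgue_integral_shift _ x (fun y => c%:E * `|(k (x, y))%:E|)%E).
    by apply: eq_integral => y _; rewrite /= gE normrM (ger0_norm c0).
  by apply: emeasurable_funM => //; exact: measurableT_comp.
have -> : (\int[mu]_z ((autocorr chi z)%:E * (normal_pdf 0 (Num.sqrt t) z)%:E) =
    \int[mu]_y \int[mu]_x (EFin \o g) (y, x))%E.
  apply: eq_integral => y _.
  have iy : mu.-integrable setT (fun x => (chi x * chi (x + y))%:E).
    exact: (bounded_L1M bchi (bounded_L1_shift y bchi)).
  rewrite /autocorr fineK; last exact: integrable_fin_num iy.
  rewrite muleC -integralZl //; apply: eq_integral => x _.
  rewrite -EFinM /= gE /k /gauss_kernel /= normal_pdf_sqrtE // addrK -/c.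
  by rewrite (addrC y x); congr EFin; ring.
have FE : (\int[mu]_y \int[mu]_x (EFin \o g) (y, x) =
  \int[mu]_x \int[mu]_y (EFin \o g) (y, x))%E := Fubini ig.
rewrite FE.
rewrite [leRHS](_ : _ = \int[mu]_x \int[mu]_y (c%:E * (k (x, y))%:E))%E; last first.
  apply: eq_integral => x _.
  transitivity (\int[mu]_y (c%:E * (k (x, (y + x)%R))%:E))%E.
    by apply: eq_integral => y _; rewrite /= gE EFinM.
  apply: (@lebesgue_integral_shift _ x (fun y => c%:E * (k (x, y))%:E)%E).
  by apply: emeasurable_funM => //; exact: mk2.
have kE : (\int[mu]_x \int[mu]_y (c%:E * (k (x, y))%:E) =
    c%:E * \int[(mu \x mu)%E]_z (k z)%:E)%E.
  rewrite -(integralZl measurableT ik); exact: (integral12_prod_meas1 ick).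
rewrite kE; apply: mule_ge0; first by rewrite lee_fin.
exact: integral_gauss_kernel_ge0.
Qed.

(** The semigroup property of the Gaussian laws, kept as a predicate on a pair of variances: it is
    later read off the independent increments of Brownian motion on the time horizon, instead of
    being computed from densities. *)
Definition gauss_convolution (x a : R) := forall f : R -> R,
  measurable_fun setT f -> (exists2 M, 0 <= M & forall y, `|f y| <= M) ->
  \int[gauss (x + a)]_y f y = \int[gauss a]_z \int[gauss x]_y f (y + z).

Lemma Rintegral_probability_cst d (T : measurableType d) (P : probability T R) (c : R) :
  \int[P]_x c = c.
Proof. by rewrite Rintegral_cst //= probability_setT mulr1. Qed.

Lemma probability_bounded_integrable d (T : measurableType d)
    (P : probability T R) (f : T -> R) : measurable_fun setT f ->
  (exists2 M, 0 <= M & forall x, `|f x| <= M) -> P.-integrable setT (EFin \o f).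
Proof.
move=> mf [M M0 fM]; apply: measurable_bounded_integrable => //.
  by apply: (le_lt_trans (probability_le1 P measurableT)); exact: ltry.
by exists M; split; rewrite ?num_real // => x Mx y _; exact: le_trans (ltW Mx).
Qed.

Lemma normr_Rintegral_probability_le d (T : measurableType d)
    (P : probability T R) (f : T -> R) (M : R) : measurable_fun setT f -> 0 <= M ->
  (forall x, `|f x| <= M) -> `|\int[P]_x f x| <= M.
Proof.
move=> mf M0 fM; have intf : P.-integrable setT (EFin \o f).
  by apply: probability_bounded_integrable => //; exists M.
apply: le_trans (le_normr_Rintegral measurableT intf) _.
rewrite -[leRHS](Rintegral_probability_cst P); apply: le_Rintegral => //.
  exact: integrable_abse intf.
by apply: (@probability_bounded_integrable _ _ P (cst M)) => //; exists M => // x;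
  rewrite ger0_norm.
Qed.

Let shifted_mean (x : R) chi (z : R) := \int[gauss x]_y autocorr chi (y + z).

Let measurable_shifted_mean (x : R) chi : bounded_L1 chi ->
  measurable_fun setT (shifted_mean x chi).
Proof.
move=> bchi.
apply: (@measurable_Rintegral_param _ _ _ _ _ (gauss x)
  (fun z : measurableTypeR R * measurableTypeR R => autocorr chi (z.2 + z.1))).
apply: (measurableT_comp (measurable_autocorr bchi)).
exact: (measurable_funD measurable_snd measurable_fst).
Qed.

Let integrable_autocorr_shift (x : R) chi z : bounded_L1 chi ->
  (gauss x).-integrable setT (EFin \o (fun y => autocorr chi (y + z))).
Proof.
move=> bchi; apply: probability_bounded_integrable.
  exact: (measurableT_comp (measurable_autocorr bchi) (measurable_addr z)).
by have [M M0 GM] := autocorr_bounded bchi; exists M.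
Qed.

Let shifted_mean_bounded (x : R) chi : bounded_L1 chi ->
  exists2 M, 0 <= M & forall z, `|shifted_mean x chi z| <= M.
Proof.
move=> bchi; have [M M0 GM] := autocorr_bounded bchi; exists M => // z.
apply: normr_Rintegral_probability_le => //.
exact: (measurableT_comp (measurable_autocorr bchi) (measurable_addr z)).
Qed.

Let mean_autocorrB_shift (x : R) chi z : bounded_L1 chi ->
  \int[gauss x]_y autocorr (fun v => chi v - chi (v + z)) y =
  2 * \int[gauss x]_y autocorr chi y - shifted_mean x chi z -
  shifted_mean x chi (- z).
Proof.
move=> bchi; have ig w := @integrable_autocorr_shift x chi w bchi.
have ig0 : (gauss x).-integrable setT (EFin \o autocorr chi).
  rewrite (_ : autocorr chi = fun y => autocorr chi (y + 0)) //.
  by apply/funext => y; rewrite addr0.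
under eq_Rintegral => y _ do rewrite autocorrB_shift //.
have i2 : (gauss x).-integrable setT (EFin \o (fun y => 2 * autocorr chi y)).
  exact: (integrableZl measurableT 2 ig0).
rewrite RintegralB // ?RintegralB ?RintegralZl //.
exact: (integrableB measurableT i2 (ig z)).
Qed.

Lemma Rintegral_gauss_opp (t : R) (f : R -> R) : 0 <= t ->
  measurable_fun setT f -> \int[gauss t]_z f (- z) = \int[gauss t]_z f z.
Proof.
move=> t0 mf; congr fine; apply: (@integral_gauss_opp _ t (EFin \o f)) => //.
exact/measurable_EFinP.
Qed.

(** The common source of monotonicity and convexity. When [z] has variance [a], the means shifted by
    [z] and by [- z] both turn into the mean at variance [x + a], by symmetry and the semigroup
    property. *)
Let mean_mean_autocorrB_shift (x a : R) chi : 0 <= a -> gauss_convolution x a ->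
  bounded_L1 chi ->
  (gauss a).-integrable setT (EFin \o (fun z => \int[gauss x]_y
      autocorr (fun v => chi v - chi (v + z)) y)) /\
  \int[gauss a]_z \int[gauss x]_y autocorr (fun v => chi v - chi (v + z)) y =
  2 * (\int[gauss x]_y autocorr chi y - \int[gauss (x + a)]_y autocorr chi y).
Proof.
move=> a0 conv bchi.
have mS := measurable_shifted_mean x bchi.
have [M M0 SM] := shifted_mean_bounded x bchi.
have mN : measurable_fun setT (fun z : R => shifted_mean x chi (- z)).
  exact: (measurableT_comp mS).
have iS := probability_bounded_integrable (gauss a) mS (ex_intro2 _ _ M M0 SM).
have iN := probability_bounded_integrable (gauss a) mN
  (ex_intro2 _ _ M M0 (fun z => SM (- z))).
set Q := \int[gauss x]_y autocorr chi y.
have bQ : exists2 N : R, 0 <= N & forall z : R, `|cst (2 * Q) z| <= N.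
  by exists `|2 * Q|.
have iQ := probability_bounded_integrable (gauss a)
  (measurable_cst (2 * Q) : measurable_fun setT (cst (2 * Q))) bQ.
have iQS := integrableB measurableT iQ iS.
have -> : (fun z => \int[gauss x]_y autocorr (fun v => chi v - chi (v + z)) y) =
    fun z => 2 * Q - shifted_mean x chi z - shifted_mean x chi (- z).
  by apply/funext => z; rewrite mean_autocorrB_shift.
split; first exact: (integrableB measurableT iQS iN).
rewrite (RintegralB measurableT iQS iN) (RintegralB measurableT iQ iS).
rewrite (Rintegral_probability_cst (gauss a)).
rewrite (Rintegral_gauss_opp a0 mS).
rewrite (conv _ (measurable_autocorr bchi) (autocorr_bounded bchi)).
rewrite -/(shifted_mean x chi _) mulrBr -addrA -opprD.
by congr (_ - _); rewrite mulr2n mulrDl !mul1r.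
Qed.

Lemma gauss_autocorr_antitone (x a : R) chi : 0 <= x -> 0 <= a ->
  gauss_convolution x a -> bounded_L1 chi ->
  \int[gauss (x + a)]_y autocorr chi y <= \int[gauss x]_y autocorr chi y.
Proof.
move=> x0 a0 conv bchi; have [_ E] := mean_mean_autocorrB_shift a0 conv bchi.
have : 0 <= \int[gauss a]_z \int[gauss x]_y autocorr (fun v => chi v - chi (v + z)) y.
  apply: Rintegral_ge0 => z _; apply: gauss_autocorr_ge0 => //.
  exact: (bounded_L1B bchi (bounded_L1_shift z bchi)).
by rewrite E pmulr_rge0 // subr_ge0.
Qed.

(* The four-point form of the convexity of
   [t |-> \int[gauss t]_y autocorr chi y]. *)
Lemma gauss_autocorr_convex (x a c : R) chi : 0 <= x -> 0 <= a -> 0 <= c ->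
  gauss_convolution x a -> gauss_convolution x c -> gauss_convolution (x + c) a ->
  bounded_L1 chi ->
  \int[gauss (x + a)]_y autocorr chi y + \int[gauss (x + c)]_y autocorr chi y <=
  \int[gauss x]_y autocorr chi y + \int[gauss (x + c + a)]_y autocorr chi y.
Proof.
move=> x0 a0 c0 cxa cxc cxca bchi.
have [i1 E1] := mean_mean_autocorrB_shift a0 cxa bchi.
have [i2 E2] := mean_mean_autocorrB_shift a0 cxca bchi.
have := le_Rintegral measurableT i2 i1.
rewrite E1 E2 ler_pM2l // => convex.
(* Each decrement over [a] is an average over [z] of Gaussian mean autocorrelations of increments of
   [chi]. Monotonicity for these increments therefore makes the decrement itself nonincreasing in
   time. *)
have {}convex := convex (fun z _ => gauss_autocorr_antitone x0 c0 cxc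
  (bounded_L1B bchi (bounded_L1_shift z bchi))).
by rewrite addrC -lerBrDr -addrA (addrC _ (- _)) addrA -lerBlDr.
Qed.

End gauss_autocorr.

(** * Integrals over intervals *)

Lemma expR_taylor1_le {R : realType} (V v : R) : `|v| <= V ->
  `|expR v - 1 - v| <= (2 + 4 * expR V) * v ^+ 2.
Proof.
move=> vV; have eV : 0 < expR V by exact: expR_gt0.
have v2 : 0 <= v ^+ 2 by exact: sqr_ge0.
rewrite ger0_norm; last by rewrite subr_ge0 lerBrDr addrC expR_ge1Dx.
(* Below 1/2 the bound e^v <= 1 / (1 - v) gives the factor 2; above it, 1 <= 4 v^2 turns the crude
   bound e^V into the second constant. *)
have [v12|v12] := leP v 2^-1.
  have v1 : 0 < 1 - v by lra.
  have : expR v <= (1 - v)^-1.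
    rewrite -[expR v]invrK -expRN lef_pV2 ?posrE ?expR_gt0 //.
    exact: expR_ge1Dx.
  move=> ev; apply: (@le_trans _ _ (2 * v ^+ 2)); last by nra.
  apply: (@le_trans _ _ ((1 - v)^-1 - 1 - v)); first lra.
  rewrite (_ : _ - 1 - v = v ^+ 2 / (1 - v)); last by field; lra.
  by rewrite ler_pdivrMr //; nra.
have ev : expR v <= expR V by rewrite ler_expR (le_trans _ vV) ?ler_norm.
have : 1 / 4 <= v ^+ 2 by rewrite expr2; nra.
nra.
Qed.

Section cauchy_schwarz_interval.
Context {R : realType}.
Notation mu := (@lebesgue_measure R).

Lemma bounded_integrable_itv (u v : R) (f : R -> R) (M : R) : 0 <= M ->
  measurable_fun setT f -> (forall x, `|f x| <= M) ->
  mu.-integrable `[u, v] (EFin \o f).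
Proof.
move=> M0 mf fM; apply: measurable_bounded_integrable => //.
- exact: lebesgue_itv_lty.
- exact: measurable_funTS.
- by exists M; split; rewrite ?num_real // => x Mx y _; exact: le_trans (ltW Mx).
Qed.

Lemma Rintegral_itv_cst (u v c : R) : u <= v ->
  \int[mu]_(x in `[u, v]) c = c * (v - u).
Proof.
rewrite le_eqVlt => /predU1P[->|uv].
  by rewrite set_itv1 Rintegral_set1 subrr mulr0.
by rewrite Rintegral_cst //= lebesgue_measure_itv /= lte_fin uv.
Qed.

Lemma sqr_Rintegral_itv_le (u v : R) (f : R -> R) (M : R) : 0 <= M ->
  measurable_fun setT f -> (forall x, `|f x| <= M) -> u <= v ->
  (\int[mu]_(x in `[u, v]) f x) ^+ 2 <=
  (v - u) * \int[mu]_(x in `[u, v]) (f x ^+ 2).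
Proof.
move=> M0 mf fM uv; have If := bounded_integrable_itv u v M0 mf fM.
have If2 : mu.-integrable `[u, v] (EFin \o (fun x => f x ^+ 2)).
  apply: (@bounded_integrable_itv _ _ _ (M ^+ 2)); first exact: sqr_ge0.
    exact: measurable_funX.
  by move=> x; rewrite normrX ler_sqr ?nnegrE.
move: uv; rewrite le_eqVlt => /predU1P[<-|uv].
  by rewrite set_itv1 !Rintegral_set1 subrr expr0n mul0r.
set I1 := \int[mu]_(x in _) f x; set I2 := \int[mu]_(x in _) _.
(* With [m] the mean of [f], the inequality is the nonnegativity of the integral of (f - m)^2. *)
pose m := I1 / (v - u).
have vu : 0 < v - u by rewrite subr_gt0.
have Ilin : mu.-integrable `[u, v] (EFin \o (fun x => 2 * m * f x)).
  exact: (integrableZl _ _ If).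
have Ic : mu.-integrable `[u, v] (EFin \o (fun x : R => m ^+ 2)).
  by apply: (@bounded_integrable_itv _ _ _ (m ^+ 2)) => [||x];
    rewrite ?sqr_ge0 // ger0_norm ?sqr_ge0.
have : 0 <= \int[mu]_(x in `[u, v]) (f x ^+ 2 - 2 * m * f x + m ^+ 2).
  apply: Rintegral_ge0 => x _.
  have -> : f x ^+ 2 - 2 * m * f x + m ^+ 2 = (f x - m) ^+ 2 by ring.
  exact: sqr_ge0.
rewrite RintegralD //; last exact: (integrableB _ If2 Ilin).
rewrite RintegralB // RintegralZl // Rintegral_itv_cst ?(ltW uv) // -/I1 -/I2.
have -> : I2 - 2 * m * I1 + m ^+ 2 * (v - u) = I2 - I1 ^+ 2 / (v - u).
  by rewrite /m; field; rewrite gt_eqF.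
by rewrite subr_ge0 ler_pdivrMr // mulrC.
Qed.

End cauchy_schwarz_interval.

Lemma ge0_integral_itv_shift_le {R : realType} (u v x e : R) (f : R -> \bar R) :
  measurable_fun setT f -> (forall y, 0 <= f y)%E -> x - e <= u -> v <= x + e ->
  (\int[@lebesgue_measure R]_(y in `[u, v]) f y <=
   \int[@lebesgue_measure R]_(z in `[(- e)%R, e]) f (x + z)%R)%E.
Proof.
move=> mf f0 xu vx.
rewrite integral_mkcond [leRHS]integral_mkcond.
rewrite -[leLHS](@lebesgue_integral_shift _ x); last first.
  exact/(measurable_restrictT _ _).1/measurable_funTS.
apply: ge0_le_integralT => [|||z].
- apply: (measurableT_comp (f := f \_ `[u, v])) (measurable_addr x).
  exact/(measurable_restrictT _ _).1/measurable_funTS.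
- apply/(measurable_restrictT _ _).1/measurable_funTS => //.
  apply: (measurableT_comp mf).
  exact: (measurable_funD (measurable_cst x) (@measurable_id _ _ _)).
- by move=> z; apply: erestrict_ge0.
rewrite /patch; case: ifPn => [|_]; last by case: ifP.
rewrite inE /= in_itv /= => /andP[uz zv].
rewrite ifT ?(addrC x) // inE /= in_itv /=; apply/andP; split; lra.
Qed.

Section oriented.
Context {R : realType}.
Notation mu := (@lebesgue_measure R).
Variable b : R -> R.
Hypothesis ib : mu.-integrable setT (EFin \o b).

(** Anchoring the antiderivative at minus infinity, possible since [b] is integrable, reduces the
    additivity of oriented integrals to arithmetic without cases on the order of the endpoints. *)
Let F (x : R) := \int[mu]_(z in `]-oo, x]) b z.

Let oriented_itv (u v : R) : u <= v ->
  \int[mu]_(z in `[u, v]) b z = F v - F u.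
Proof.
move=> uv; rewrite /F Rintegral_itvB ?bnd_simp //; last first.
  exact: integrableS ib.
by rewrite Rintegral_itv_obnd_cbnd //; exact: integrableS ib.
Qed.

Let orientedE (u v : R) : oriented_integral b u v = F v - F u.
Proof.
rewrite /oriented_integral; case: leP => [|/ltW] uv; first exact: oriented_itv.
by rewrite oriented_itv // opprB.
Qed.

Lemma oriented_integralD (u v w : R) :
  oriented_integral b u w = oriented_integral b u v + oriented_integral b v w.
Proof. by rewrite !orientedE; ring. Qed.

Lemma normr_oriented_integral_le (u v : R) :
  `|oriented_integral b u v| <= \int[mu]_x `|b x|.
Proof.
have le_itv (x y : R) : `|\int[mu]_(z in `[x, y]) b z| <= \int[mu]_z `|b z|.
  have iI : mu.-integrable `[x, y] (EFin \o b) by exact: integrableS ib.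
  have iabs : mu.-integrable setT (EFin \o (fun x => `|b x|)).
    exact: integrable_abse ib.
  have /integrableP[mabs _] := iabs.
  apply: le_trans (le_normr_Rintegral _ iI) _ => //; apply: fine_le.
  - exact: integrable_fin_num (integrable_abse iI).
  - exact: integrable_fin_num iabs.
  - by apply: ge0_subset_integral => //= z _; rewrite lee_fin.
by rewrite /oriented_integral; case: ifP => _; rewrite ?normrN le_itv.
Qed.

Hypothesis mb : measurable_fun setT b.
Variable M : R.
Hypothesis M0 : 0 <= M.
Hypothesis bM : forall x, `|b x| <= M.

(** Cauchy-Schwarz on the interval between [x] and [x + d], which is then enlarged to a symmetric
    window around [x] so that the sign of [d] disappears. *)
Lemma sqr_oriented_integralB_le (x d : R) :
  (((oriented_integral b x (x + d) - b x * d) ^+ 2)%:E <= `|d|%:E *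
   \int[mu]_(z in `[(- `|d|)%R, `|d|%R]) ((b (x + z) - b x) ^+ 2)%:E)%E.
Proof.
have mf : measurable_fun setT (fun y => b y - b x) by exact: measurable_funB.
have fM y : `|b y - b x| <= M + M by rewrite (le_trans (ler_normB _ _)) ?lerD.
have MM0 : 0 <= M + M by exact: addr_ge0.
have mf2 : measurable_fun setT (fun y => ((b y - b x) ^+ 2)%:E).
  by apply/measurable_EFinP; exact: measurable_funX.
have key (u v : R) : u <= v -> x - `|d| <= u -> v <= x + `|d| -> v - u <= `|d| ->
    (((\int[mu]_(y in `[u, v]) b y - b x * (v - u)) ^+ 2)%:E <= `|d|%:E *
     \int[mu]_(z in `[(- `|d|)%R, `|d|%R]) ((b (x + z) - b x) ^+ 2)%:E)%E.
  move=> uv xu vx vud.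
  have -> : \int[mu]_(y in `[u, v]) b y - b x * (v - u) =
      \int[mu]_(y in `[u, v]) (b y - b x).
    rewrite RintegralB ?Rintegral_itv_cst //; first exact: integrableS ib.
    by apply: (@bounded_integrable_itv _ _ _ _ M).
  apply: (@le_trans _ _
    ((v - u)%:E * \int[mu]_(y in `[u, v]) ((b y - b x) ^+ 2)%:E)%E).
    rewrite -[X in (_ * X)%E]fineK; last first.
      apply: (@integrable_fin_num _ _ _ mu) => //.
      apply: (@bounded_integrable_itv _ _ _ _ ((M + M) ^+ 2)).
      - exact: sqr_ge0.
      - exact: measurable_funX.
      - by move=> y; rewrite normrX ler_sqr ?nnegrE.
    by rewrite -EFinM lee_fin; exact: sqr_Rintegral_itv_le fM _.
  apply: (@lee_pmul) => //.
  - by rewrite lee_fin subr_ge0.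
  - by apply: integral_ge0 => y _; rewrite lee_fin sqr_ge0.
  - apply: (@ge0_integral_itv_shift_le _ u v x `|d|
      (fun y => ((b y - b x) ^+ 2)%:E)) => // y.
    by rewrite lee_fin sqr_ge0.
rewrite /oriented_integral.
have [d0|/ltW d0] := leP 0 d; last have dN : `|d| = - d by rewrite ler0_norm.
  rewrite ifT ?lerDl //.
  have -> : b x * d = b x * ((x + d) - x) by rewrite addrAC subrr add0r.
  by apply: key; rewrite ?(ger0_norm d0); lra.
case: ifPn => [xd|_].
  have -> : d = 0 by apply/eqP; rewrite eq_le d0; rewrite lerDl in xd.
  rewrite addr0 set_itv1 Rintegral_set1 mulr0 subr0 expr0n /=.
  by apply: mule_ge0; rewrite ?lee_fin //; apply: integral_ge0 => y _;
    rewrite lee_fin sqr_ge0.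
rewrite (_ : - _ - b x * d = - (\int[mu]_(z in `[x + d, x]) b z - b x * (x - (x + d)))).
  by rewrite sqrrN; apply: key; rewrite ?dN //; lra.
by rewrite opprB; ring.
Qed.

Lemma normr_oriented_integral_le_lin (x d : R) :
  `|oriented_integral b x (x + d)| <= M * `|d|.
Proof.
have key (u v : R) : u <= v -> `|\int[mu]_(y in `[u, v]) b y| <= M * (v - u).
  move=> uv; have iI : mu.-integrable `[u, v] (EFin \o b) by exact: integrableS ib.
  apply: le_trans (le_normr_Rintegral _ iI) _ => //.
  rewrite -Rintegral_itv_cst //; apply: le_Rintegral => //.
    exact: (integrable_abse iI).
  by apply: (@bounded_integrable_itv _ _ _ _ M) => // y; rewrite ger0_norm.
rewrite /oriented_integral; case: (leP x (x + d)) => [|/ltW] xd.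
  have d0 : 0 <= d by rewrite lerDl in xd.
  by apply: le_trans (key _ _ xd) _; rewrite ger0_norm // addrAC subrr add0r.
have d0 : d <= 0 by rewrite gerDl in xd.
rewrite normrN; apply: le_trans (key _ _ xd) _.
by rewrite ler0_norm // opprD addNKr.
Qed.

End oriented.

(** * The drift and its squared increments *)

Section squared_increment.
Context {R : realType}.
Notation mu := (@lebesgue_measure R).

(** The squared L^2 modulus of continuity at lag [z]. Its integral against |z|^-(2 kappa + 1) is the
    square of the Sobolev-Slobodeckij semi-norm. *)
Definition sq_incr (chi : R -> R) (z : R) : R :=
  \int[mu]_x ((chi (x + z) - chi x) ^+ 2).

Lemma bounded_L1_sqr chi : bounded_L1 chi ->
  mu.-integrable setT (EFin \o (fun x => chi x ^+ 2)).
Proof. by move=> bchi; have := bounded_L1M bchi bchi. Qed.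

Let bounded_L1_incr chi (z : R) : bounded_L1 chi ->
  bounded_L1 (fun x => chi (x + z) - chi x).
Proof. by move=> bchi; apply: bounded_L1B => //; exact: bounded_L1_shift. Qed.

Lemma sq_incrE chi (z : R) : bounded_L1 chi ->
  ((sq_incr chi z)%:E = \int[mu]_x ((chi (x + z) - chi x) ^+ 2)%:E)%E.
Proof.
move=> bchi; rewrite /sq_incr fineK //.
exact: integrable_fin_num (bounded_L1_sqr (bounded_L1_incr z bchi)).
Qed.

Lemma sq_incr_ge0 chi (z : R) : 0 <= sq_incr chi z.
Proof. by apply: Rintegral_ge0 => x _; exact: sqr_ge0. Qed.

Lemma sq_incr0 chi : sq_incr chi 0 = 0.
Proof.
rewrite /sq_incr; under eq_Rintegral do rewrite addr0 subrr expr0n /=.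
by rewrite Rintegral_cst // mul0r.
Qed.

Lemma measurable_sq_incr chi : measurable_fun setT chi ->
  measurable_fun setT (sq_incr chi).
Proof.
move=> mchi.
pose f (z : measurableTypeR R * measurableTypeR R) : R :=
  (chi (z.2 + z.1) - chi z.2) ^+ 2.
apply: (@measurable_Rintegral_param _ _ _ _ _ mu f); apply: measurable_funX.
apply: measurable_funB.
  apply: (measurableT_comp mchi).
  exact: (measurable_funD measurable_snd measurable_fst).
exact: (measurableT_comp mchi measurable_snd).
Qed.

(** Tonelli and the lag z = x - y identify this integral with the double integral under the root in
    the semi-norm; were it infinite, so would be its square root. *)
Lemma slobodeckij_sq_incr (kappa : R) (chi : R -> R) : bounded_L1 chi ->
  (sobolev_slobodeckij kappa chi < +oo)%E ->
  (\int[mu]_z (sq_incr chi z / `|z| `^ (2 * kappa + 1))%:E < +oo)%E.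
Proof.
move=> bchi; have [mchi _ _] := bchi.
set p := 2 * kappa + 1.
pose F (z : measurableTypeR R * measurableTypeR R) : \bar R :=
  (`|chi (z.2 + z.1) - chi z.2| ^+ 2 / `|z.1| `^ p)%:E.
have mF : measurable_fun setT F.
  apply/measurable_EFinP; apply: measurable_funM.
    apply: measurable_funX; apply: measurableT_comp => //; apply: measurable_funB.
      apply: (measurableT_comp mchi).
      exact: (measurable_funD measurable_snd measurable_fst).
    exact: (measurableT_comp mchi measurable_snd).
  under eq_fun do rewrite -powRN.
  apply: (measurableT_comp (measurable_powR _)).
  by apply: measurableT_comp => //; exact: measurable_fst.
have F0 z : (0 <= F z)%E by rewrite lee_fin divr_ge0 ?sqr_ge0 ?powR_ge0.
have ineq : (\int[mu]_z (sq_incr chi z / `|z| `^ p)%:E =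
    \int[mu]_y \int[mu]_x
      (`|chi x - chi y| ^+ 2 / `|x - y| `^ p)%:E)%E.
  transitivity (\int[mu]_z \int[mu]_y F (z, y))%E.
    apply: eq_integral => z _; rewrite EFinM sq_incrE // muleC.
    rewrite -(@ge0_integralTZl _ _ _ mu (`|z| `^ p)^-1
      (fun y => ((chi (y + z) - chi y) ^+ 2)%:E)) //.
    - apply: eq_integral => y _; rewrite /F /= -EFinM; congr EFin.
      by rewrite real_normK ?num_real // mulrC.
    - apply/measurable_EFinP; apply: measurable_funX; apply: measurable_funB => //.
      exact: (measurableT_comp mchi (measurable_addr z)).
    - by move=> y; rewrite lee_fin sqr_ge0.
  transitivity (\int[mu]_y \int[mu]_z F (z, y))%E.
    exact: (fubini_tonelli F mF F0).
  apply: eq_integral => y _.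
  rewrite -[RHS](@lebesgue_integral_shift _ y (fun x =>
      (`|chi x - chi y| ^+ 2 / `|x - y| `^ p)%:E)).
    by apply: eq_integral => x _; rewrite /F /= addrK (addrC y x).
  apply/measurable_EFinP; apply: measurable_funM.
    apply: measurable_funX; apply: measurableT_comp => //.
    by apply: measurable_funB.
  under eq_fun do rewrite -powRN.
  apply: (measurableT_comp (measurable_powR _)).
  by apply: measurableT_comp => //; exact: measurable_funB.
rewrite ineq /sobolev_slobodeckij -/p; set I := (\int[mu]_y _)%E.
rewrite ltNge leye_eq => + ; rewrite ltey; apply: contraNN => /eqP ->.
by rewrite poweRyr // invr_eq0.
Qed.

End squared_increment.

Section drift.
Context {R : realType}.
Notation mu := (@lebesgue_measure R).
Variables (b : R -> R) (M : R).
Hypotheses (M0 : 0 <= M) (bM : forall x, `|b x| <= M).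
Hypothesis ib : mu.-integrable setT (EFin \o b).

Let mb : measurable_fun setT b.
Proof. by have /integrableP[/measurable_EFinP] := ib. Qed.

Let bb : bounded_L1 b.
Proof. by split => //; exists M. Qed.

Let L := \int[mu]_x `|b x|.

Let L0 : 0 <= L. Proof. exact: Rintegral_ge0. Qed.

Let K := expR (2 * L).

Let K0 : 0 < K. Proof. exact: expR_gt0. Qed.

Let D := 2 + 4 * K.

Let inc (x z : R) := oriented_integral b x (x + z).

Lemma phi'_gt0 x : 0 < phi' b x. Proof. exact: expR_gt0. Qed.

Lemma phi'_le x : phi' b x <= K.
Proof.
have le2L : - 2 * oriented_integral b 0 x <= 2 * L.
  rewrite mulNr -mulrN ler_pM2l // (le_trans (ler_norm _)) // normrN.
  exact: (normr_oriented_integral_le ib).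
by rewrite /phi' /K ler_expR.
Qed.

Lemma phi'D x z : phi' b (x + z) = phi' b x * expR (- 2 * inc x z).
Proof.
by rewrite /phi' -expRD -mulrDr /inc -(oriented_integralD ib).
Qed.

Lemma expR_inc x z :
  `|expR (- 2 * inc x z) - 1 + 2 * inc x z| <= D * (2 * inc x z) ^+ 2.
Proof.
have le2L : `|- 2 * inc x z| <= 2 * L.
  rewrite normrM normrN (ger0_norm (ler0n _ 2)) ler_wpM2l //.
  exact: (normr_oriented_integral_le ib).
have := expR_taylor1_le le2L.
by rewrite mulNr sqrrN opprK.
Qed.

Let inc_le x z : `|inc x z| <= M * `|z|.
Proof. by rewrite /inc; apply: (normr_oriented_integral_le_lin ib). Qed.

Let Lip := K * (2 + 4 * D * L) * M.

Lemma phi'_lipschitz x z : `|phi' b (x + z) - phi' b x| <= Lip * `|z|.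
Proof.
rewrite phi'D -[X in _ - X]mulr1 -mulrBr normrM (ger0_norm (ltW (phi'_gt0 x))).
(* The part [4 * D * L] comes from the quadratic Taylor term [D * (2 * inc x z) ^+ 2], one factor of
   which is bounded by [L]. *)
apply: (@le_trans _ _ (K * ((2 + 4 * D * L) * `|inc x z|))).
  apply: ler_pM => //; first exact: ltW (phi'_gt0 x).
    exact: phi'_le.
  have := expR_inc x z; set e := expR _ => H.
  have iL : `|inc x z| <= L by exact: (normr_oriented_integral_le ib).
  have D0 : 0 <= D by rewrite /D; have := K0; lra.
  have -> : e - 1 = (e - 1 + 2 * inc x z) - 2 * inc x z by ring.
  apply: le_trans (ler_normB _ _) _.
  rewrite normrM (ger0_norm (ler0n _ 2)).
  apply: (@le_trans _ _ (D * (2 * inc x z) ^+ 2 + 2 * `|inc x z|)).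
    by rewrite lerD2r.
  have -> : (2 * inc x z) ^+ 2 = 4 * (`|inc x z| * `|inc x z|).
    by rewrite -expr2 real_normK ?num_real //; ring.
  have i0 : 0 <= `|inc x z| by [].
  move: i0 iL; move: (`|inc x z|) => i i0 iL.
  have : 0 <= D * i * (L - i) by rewrite !mulr_ge0 // subr_ge0.
  nra.
rewrite /Lip -!mulrA ler_wpM2l ?(ltW K0) // ler_wpM2l //.
have D0 : 0 <= D by rewrite /D; have := K0; lra.
by have := L0; nra.
Qed.

Lemma measurable_phi' : measurable_fun setT (phi' b).
Proof.
apply: continuous_measurable_fun => x; apply/cvgrPdist_le => e e0.
have Lip0 : 0 <= Lip.
  rewrite /Lip !mulr_ge0 ?(ltW K0) // addr_ge0 // !mulr_ge0 //.
  by rewrite /D; have := K0; lra.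
near=> y.
rewrite distrC; have := phi'_lipschitz x (y - x); rewrite subrKC => /le_trans; apply.
(* Passing to [Lip + 1] keeps the divisor positive even when [Lip] vanishes. *)
apply: (@le_trans _ _ ((Lip + 1) * `|y - x|)); first by rewrite ler_wpM2r ?lerDl.
rewrite -ler_pdivlMl ?ltr_wpDl // distrC.
near: y; apply: cvgr_dist_le; first exact: cvg_id.
by rewrite mulr_gt0 ?invr_gt0 ?ltr_wpDl.
Unshelve. all: by end_near. Qed.

(** Formally minus half the derivative of [phi']. *)
Definition psi x := phi' b x * b x.

Lemma bounded_L1_psi : bounded_L1 psi.
Proof.
have mpsi : measurable_fun setT psi by exact: (measurable_funM measurable_phi' mb).
have psi_le x : `|psi x| <= K * `|b x|.
  by rewrite normrM ler_wpM2r // (ger0_norm (ltW (phi'_gt0 x))) phi'_le.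
split => //.
  exists (K * M); first by rewrite mulr_ge0 // ltW.
  by move=> x; apply: le_trans (psi_le x) _; rewrite ler_wpM2l // ltW.
apply: (@le_integrable _ _ _ mu setT measurableT _ (fun x => K%:E * (b x)%:E)%E).
- exact/measurable_EFinP.
- move=> x _; rewrite -EFinM !abse_EFin lee_fin normrM (ger0_norm (ltW K0)).
  exact: psi_le.
- exact: integrableZl.
Qed.

(** A discrete product rule: the increment of [b] is multiplied by the bounded [phi'], and the
    increment of [phi'], which is Lipschitz, by the square integrable [b]. *)
Lemma sq_incr_psi_le : exists2 C, 0 <= C &
  forall z, sq_incr psi z <= C * (sq_incr b z + z ^+ 2).
Proof.
pose B := \int[mu]_x (b x ^+ 2).
have B0 : 0 <= B by apply: Rintegral_ge0 => x _; exact: sqr_ge0.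
pose C := 2 * K ^+ 2 + 2 * Lip ^+ 2 * B.
have C0 : 0 <= C.
  have := sqr_ge0 K; have := sqr_ge0 Lip; rewrite /C.
  by move: (K ^+ 2) (Lip ^+ 2) => k l l0 k0; rewrite addr_ge0 // ?mulr_ge0 // mulr_ge0.
have prodB (p q c e : R) : p * c - q * e = p * (c - e) + (p - q) * e by ring.
exists C => // z.
have ipsi := bounded_L1_sqr (bounded_L1B (bounded_L1_shift z bounded_L1_psi) bounded_L1_psi).
have idb := bounded_L1_sqr (bounded_L1B (bounded_L1_shift z bb) bb).
have i1 := integrableZl measurableT (2 * K ^+ 2) idb.
have i2 := integrableZl measurableT (2 * Lip ^+ 2 * z ^+ 2) (bounded_L1_sqr bb).
have : sq_incr psi z <= \int[mu]_x
    (2 * K ^+ 2 * (b (x + z) - b x) ^+ 2 + 2 * Lip ^+ 2 * z ^+ 2 * b x ^+ 2).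
  apply: le_Rintegral => //; first exact: (integrableD measurableT i1 i2).
  move=> x _; rewrite /psi.
  rewrite prodB.
  set u := b (x + z) - b x; set v := phi' b (x + z) - phi' b x.
  have u1 : (phi' b (x + z) * u) ^+ 2 <= K ^+ 2 * u ^+ 2.
    rewrite exprMn ler_wpM2r ?sqr_ge0 // ler_sqr ?nnegrE ?(ltW K0) ?(ltW (phi'_gt0 _)) //.
    exact: phi'_le.
  have v1 : (v * b x) ^+ 2 <= Lip ^+ 2 * z ^+ 2 * b x ^+ 2.
    rewrite exprMn ler_wpM2r ?sqr_ge0 // -(real_normK (num_real v)).
    rewrite -(real_normK (num_real z)) -exprMn ler_sqr ?nnegrE //.
      exact: phi'_lipschitz.
    exact: le_trans (normr_ge0 _) (phi'_lipschitz x z).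
  move: u1 v1; move: (phi' b (x + z) * u) (v * b x) => p q p1 q1.
  have := sqr_ge0 (p - q); rewrite sqrrB sqrrD => H; lra.
rewrite (RintegralD measurableT i1 i2) (RintegralZl _ measurableT idb).
rewrite (RintegralZl _ measurableT (bounded_L1_sqr bb)).
rewrite -/(sq_incr b z) -/B => /le_trans; apply.
have := sq_incr_ge0 b z; have := sqr_ge0 z; rewrite /C.
have : 0 <= 2 * K ^+ 2 by apply: mulr_ge0 => //; exact: sqr_ge0.
have : 0 <= 2 * Lip ^+ 2 * B.
  by apply: mulr_ge0 => //; apply: mulr_ge0 => //; exact: sqr_ge0.
rewrite (_ : 2 * Lip ^+ 2 * z ^+ 2 * B = 2 * Lip ^+ 2 * B * z ^+ 2); last by ring.
by move: (2 * K ^+ 2) (2 * Lip ^+ 2 * B) (z ^+ 2) (sq_incr b z) => ? ? ? ?; nra.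
Qed.

End drift.

(** * Expansion of the local error *)

Section remainder.
Context {R : realType}.
Notation mu := (@lebesgue_measure R).

(** Truncating the Brownian increment makes the martingale term bounded, as the Fubini arguments
    require. The truncation is odd, so its Gaussian mean stays zero, and its error is at most z^2,
    small enough for the remainder. *)
Definition trunc (z : R) : R := Num.max (-1) (Num.min 1 z).

Variant trunc_spec (z : R) : R -> Prop :=
| TruncLo of z <= -1 : trunc_spec z (-1)
| TruncMid of -1 <= z & z <= 1 : trunc_spec z z
| TruncHi of 1 <= z : trunc_spec z 1.

Lemma truncP z : trunc_spec z (trunc z).
Proof.
rewrite /trunc; have [z1|/ltW z1] := leP 1 z.
  by rewrite max_r; [constructor|lra].
by have [z2|/ltW z2] := leP (-1) z; constructor.
Qed.

Lemma truncN z : trunc (- z) = - trunc z.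
Proof. by case: (truncP (- z)); case: (truncP z) => *; lra. Qed.

Lemma normr_trunc_le1 z : `|trunc z| <= 1.
Proof. by rewrite ler_norml; case: (truncP z) => *; apply/andP; split; lra. Qed.

Lemma normr_trunc_le z : `|trunc z| <= `|z|.
Proof.
rewrite ler_norml; have [z0|/ltW z0] := leP 0 z.
  by rewrite (ger0_norm z0); case: (truncP z) => *; apply/andP; split; lra.
by rewrite (ler0_norm z0); case: (truncP z) => *; apply/andP; split; lra.
Qed.

Lemma normr_truncB_le z : `|z - trunc z| <= z ^+ 2.
Proof.
have z2 : 0 <= z ^+ 2 by exact: sqr_ge0.
by rewrite ler_norml; case: (truncP z) => *; apply/andP; split; nra.
Qed.

Lemma measurable_trunc : measurable_fun setT trunc.
Proof.
by apply: measurable_maxr => //; apply: measurable_minr.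
Qed.

Variables (b : R -> R) (M : R).
Hypotheses (M0 : 0 <= M) (bM : forall x, `|b x| <= M).
Hypothesis ib : mu.-integrable setT (EFin \o b).

Let mb : measurable_fun setT b.
Proof. by have /integrableP[/measurable_EFinP] := ib. Qed.

Let bb : bounded_L1 b.
Proof. by split => //; exists M. Qed.

Let L := \int[mu]_x `|b x|.

Let L0 : 0 <= L. Proof. exact: Rintegral_ge0. Qed.

Let K := expR (2 * L).

Let K0 : 0 < K. Proof. exact: expR_gt0. Qed.

Let D := 2 + 4 * K.

Let D0 : 0 <= D. Proof. by rewrite /D; have := K0; lra. Qed.

(** A first-order Taylor coefficient: once the increment of [psi] is removed, the local error is
    minus [b x] times the increment of [phi'], whose derivative is formally
    [- 2 * b x * phi' b x]. *)
Definition mcoef (x : R) := 2 * phi' b x * b x ^+ 2.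

Definition drift_rem (x z : R) := phi' b (x + z) * (b (x + z) - b x) -
  (psi b (x + z) - psi b x) - mcoef x * trunc z.

Lemma measurable_mcoef : measurable_fun setT mcoef.
Proof.
apply: measurable_funM; last exact: measurable_funX.
by apply: measurable_funM => //; exact: (measurable_phi' M0 bM ib).
Qed.

Lemma normr_mcoef_le x : `|mcoef x| <= 2 * K * M ^+ 2.
Proof.
have p0 := phi'_gt0 b x; have pK := phi'_le ib x.
rewrite /mcoef (normrM (2 * _)) (normrM 2) normrX (ger0_norm (ler0n _ 2)).
rewrite (ger0_norm (ltW p0)).
apply: ler_pM => //; first by rewrite mulr_ge0 // ltW.
  by rewrite ler_wpM2l.
by rewrite ler_sqr ?nnegrE.
Qed.

Lemma measurable_rem : measurable_fun setT (fun z : R * R => drift_rem z.1 z.2).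
Proof.
have mD : measurable_fun setT (fun z : R * R => z.1 + z.2).
  exact: (measurable_funD measurable_fst measurable_snd).
have m1 (f : R -> R) : measurable_fun setT f -> measurable_fun setT (fun z : R * R => f z.1).
  by move=> mf; exact: (measurableT_comp mf measurable_fst).
have mp := measurable_phi' M0 bM ib.
have mpsi : measurable_fun setT (psi b) by exact: measurable_funM.
apply: measurable_funB; first apply: measurable_funB.
- apply: measurable_funM; first exact: (measurableT_comp mp mD).
  by apply: measurable_funB; [exact: (measurableT_comp mb mD)|exact: m1].
- by apply: measurable_funB; [exact: (measurableT_comp mpsi mD)|exact: m1].
- apply: measurable_funM; first exact: (m1 _ measurable_mcoef).
  exact: (measurableT_comp measurable_trunc measurable_snd).
Qed.

Let inc (x z : R) := oriented_integral b x (x + z).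

Let A := 4 * D * M ^+ 2 + 2 * M.

Let A0 : 0 <= A.
Proof. by rewrite /A addr_ge0 ?mulr_ge0 ?sqr_ge0. Qed.

(** Since [phi'] is multiplied by exp(-2 inc) along an increment, three defects remain: the Taylor
    remainder of the exponential, the replacement of [inc x z] by [b x * z], and the truncation. The
    first and the last are of order z^2 and make up [A]; the middle one carries the roughness of
    [b]. The factor [b x] is kept because it makes the bound integrable over the line. *)
Let normr_rem_le x z :
  `|drift_rem x z| <= K * `|b x| * (A * z ^+ 2 + 2 * `|inc x z - b x * z|).
Proof.
have -> : drift_rem x z = - (phi' b x * b x *
    (expR (- 2 * inc x z) - 1 + 2 * inc x z - 2 * (inc x z - b x * z)
     - 2 * b x * (z - trunc z))).
  rewrite /drift_rem /psi /mcoef (phi'D ib) -/(inc x z).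
  by move: (phi' b x) (inc x z) (expR _) (b (x + z)) (trunc z) => *; ring.
rewrite normrN !normrM (ger0_norm (ltW (phi'_gt0 b x))).
apply: ler_pM => //; first by rewrite mulr_ge0 // ltW ?phi'_gt0.
  by rewrite ler_wpM2r // (phi'_le ib).
have e1 := expR_inc ib x z; rewrite -/L -/K -/D -/(inc x z) in e1.
have e2 : (2 * inc x z) ^+ 2 <= 4 * M ^+ 2 * z ^+ 2.
  have := normr_oriented_integral_le_lin ib M0 bM x z; rewrite -/(inc x z) => iz.
  rewrite (_ : 4 * M ^+ 2 * z ^+ 2 = (2 * (M * `|z|)) ^+ 2); last first.
    by rewrite !exprMn real_normK ?num_real //; ring.
  rewrite -(real_normK (num_real (2 * _))) ler_sqr ?nnegrE ?mulr_ge0 //.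
  by rewrite normrM (ger0_norm (ler0n _ 2)) ler_wpM2l.
apply: le_trans (ler_normB _ _) _.
apply: (@le_trans _ _ (D * (2 * inc x z) ^+ 2 + 2 * `|inc x z - b x * z| +
   2 * M * z ^+ 2)).
  apply: lerD.
    apply: le_trans (ler_normB _ _) _; apply: lerD => //.
    by rewrite normrM (ger0_norm (ler0n _ 2)).
  rewrite !normrM (ger0_norm (ler0n _ 2)).
  by apply: ler_pM => //; rewrite ?mulr_ge0 ?ler_wpM2l // normr_truncB_le.
have := ler_wpM2l D0 e2; rewrite /A.
move: ((2 * inc x z) ^+ 2) (`|inc x z - b x * z|) (z ^+ 2) => X Y Z; lra.
Qed.

Let sqr_rem_le x z : drift_rem x z ^+ 2 <=
  2 * K ^+ 2 * A ^+ 2 * M * z ^+ 4 * `|b x| +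
  8 * K ^+ 2 * M ^+ 2 * (inc x z - b x * z) ^+ 2.
Proof.
have := normr_rem_le x z; set q := inc x z - b x * z => H.
rewrite -(real_normK (num_real (drift_rem x z))).
apply: (@le_trans _ _ ((K * `|b x| * (A * z ^+ 2 + 2 * `|q|)) ^+ 2)).
  by rewrite ler_sqr ?nnegrE // (le_trans _ H).
rewrite -[q ^+ 2](real_normK (num_real q)).
have := bM x; move: (`|b x|) (normr_ge0 (b x)) => B B0 BM.
have q0 : 0 <= `|q| by []; move: (`|q|) q0 => p p0.
have s1 : (A * z ^+ 2 + 2 * p) ^+ 2 <= 2 * A ^+ 2 * z ^+ 4 + 8 * p ^+ 2.
  have := sqr_ge0 (A * z ^+ 2 - 2 * p).
  rewrite (_ : z ^+ 4 = (z ^+ 2) ^+ 2); last by rewrite -exprM.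
  move: (z ^+ 2) => y; rewrite sqrrB sqrrD !exprMn; lra.
rewrite !exprMn.
apply: (@le_trans _ _ (K ^+ 2 * B ^+ 2 * (2 * A ^+ 2 * z ^+ 4 + 8 * p ^+ 2))).
  by rewrite ler_wpM2l // mulr_ge0 ?sqr_ge0.
have B1 : B ^+ 2 <= M * B by rewrite expr2 ler_wpM2r.
have B2 : B ^+ 2 <= M ^+ 2 by rewrite ler_sqr ?nnegrE.
have z4 : 0 <= z ^+ 4 by rewrite exprn_even_ge0.
move: (K ^+ 2) (A ^+ 2) (z ^+ 4) (B ^+ 2) (M ^+ 2) (p ^+ 2) (sqr_ge0 K)
  (sqr_ge0 A) z4 B1 B2 (sqr_ge0 p) => k a Z B' M' P k0 a0 Z0 B1 B2 P0.
have k1 : 0 <= 2 * k * a * Z by rewrite !mulr_ge0.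
have k2 : 0 <= 8 * k * P by rewrite !mulr_ge0.
have := lerD (ler_wpM2l k1 B1) (ler_wpM2l k2 B2); lra.
Qed.

Variables (kappa T : R).
Hypotheses (kappa0 : 0 < kappa) (kappa1 : kappa < 1) (T0 : 0 < T).
Hypothesis b_kappa : (sobolev_slobodeckij kappa b < +oo)%E.

Let S := fine (\int[mu]_w (sq_incr b w / `|w| `^ (2 * kappa + 1))%:E)%E.

Let quot_ge0 w : 0 <= sq_incr b w / `|w| `^ (2 * kappa + 1).
Proof. by rewrite divr_ge0 ?powR_ge0 ?sq_incr_ge0. Qed.

Let SE : (\int[mu]_w (sq_incr b w / `|w| `^ (2 * kappa + 1))%:E = S%:E)%E.
Proof.
rewrite /S fineK // ge0_fin_numE; first exact: slobodeckij_sq_incr.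
by apply: integral_ge0 => w _; rewrite lee_fin.
Qed.

Let S0 : 0 <= S.
Proof. by rewrite -lee_fin -SE; apply: integral_ge0 => w _; rewrite lee_fin. Qed.

Let measurable_quot :
  measurable_fun setT (fun w => (sq_incr b w / `|w| `^ (2 * kappa + 1))%:E).
Proof.
apply/measurable_EFinP; apply: measurable_funM.
  exact: measurable_sq_incr.
under eq_fun do rewrite -powRN.
by apply: (measurableT_comp (measurable_powR _)).
Qed.

(** On |w| <= e the weight satisfies 1 <= (e / |w|)^(2 kappa + 1), which brings in the
    Sobolev-Slobodeckij integral. *)
Let integral_local_incr_le (e : R) : 0 <= e ->
  (\int[mu]_x \int[mu]_(w in `[(- e)%R, e]) ((b (x + w) - b x) ^+ 2)%:E <=
   (e `^ (2 * kappa + 1) * S)%:E)%E.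
Proof.
move=> e0.
pose I : set R := `[- e, e]%classic.
pose F (z : measurableTypeR R * measurableTypeR R) : \bar R :=
  (((b (z.1 + z.2) - b z.1) ^+ 2)%:E * (\1_I z.2)%:E)%E.
have mF : measurable_fun setT F.
  apply: emeasurable_funM; apply/measurable_EFinP.
    apply: measurable_funX; apply: measurable_funB.
      apply: (measurableT_comp mb).
      exact: (measurable_funD measurable_fst measurable_snd).
    exact: (measurableT_comp mb measurable_fst).
  have mI : measurable_fun setT (\1_I : R -> R).
    by apply: measurable_indic; exact: measurable_itv.
  exact: (measurableT_comp mI measurable_snd).
have F0 z : (0 <= F z)%E by rewrite mule_ge0 // lee_fin // sqr_ge0.
have -> : (\int[mu]_x \int[mu]_(w in I) ((b (x + w) - b x) ^+ 2)%:E =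
    \int[mu]_x \int[mu]_w F (x, w))%E.
  by apply: eq_integral => x _; rewrite integral_mkcond epatch_indic.
have -> : (\int[mu]_x \int[mu]_w F (x, w) = \int[mu]_w \int[mu]_x F (x, w))%E.
  exact: (fubini_tonelli F mF F0).
rewrite EFinM -SE -(ge0_integralTZl mu (powR_ge0 e (2 * kappa + 1))
  measurable_quot) //.
apply: ge0_le_integralT => [|||w].
- exact: (measurable_fun_fubini_tonelli_G F mF F0).
- exact: emeasurable_funM.
- by move=> w; exact: integral_ge0.
have -> : (\int[mu]_x F (x, w) = (\1_I w * sq_incr b w)%:E)%E.
  rewrite EFinM sq_incrE // -(@ge0_integralTZl _ _ _ mu (\1_I w)
    (fun x => ((b (x + w) - b x) ^+ 2)%:E)) //.
  - by apply: eq_integral => x _; rewrite /F muleC.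
  - apply/measurable_EFinP; apply: measurable_funX; apply: measurable_funB => //.
    exact: (measurableT_comp mb (measurable_addr w)).
  - by move=> x; rewrite lee_fin sqr_ge0.
rewrite -EFinM lee_fin indicE.
have [wI|_] := boolP (w \in I); last first.
  by rewrite mul0r mulr_ge0 ?powR_ge0 // divr_ge0 ?powR_ge0 ?sq_incr_ge0.
rewrite mul1r; have [->|w0] := eqVneq w 0; first by rewrite sq_incr0 mul0r mulr0.
rewrite mulrCA ler_peMr ?sq_incr_ge0 // ler_pdivlMr ?powR_gt0 ?normr_gt0 // mul1r.
apply: ge0_ler_powR; rewrite ?nnegrE //; first by have := kappa0; lra.
by move: wI; rewrite inE /I /= in_itv /= ler_norml.
Qed.

(** The power 2 kappa + 2 is one factor |z| from Cauchy-Schwarz times |z|^(2 kappa + 1) from the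
    local increments of [b]; the fourth power comes from the defects of order z^2. *)
Lemma integral_sqr_rem_le : exists2 C, 0 <= C & forall z,
  (\int[mu]_x (drift_rem x z ^+ 2)%:E <= (C * (z ^+ 4 + `|z| `^ (2 * kappa + 2)))%:E)%E.
Proof.
pose c1 := 2 * K ^+ 2 * A ^+ 2 * M; pose c2 := 8 * K ^+ 2 * M ^+ 2.
have c10 : 0 <= c1.
  rewrite /c1; move: (K ^+ 2) (A ^+ 2) (sqr_ge0 K) (sqr_ge0 A) => k a k0 a0.
  by rewrite !mulr_ge0.
have c20 : 0 <= c2.
  rewrite /c2; move: (K ^+ 2) (M ^+ 2) (sqr_ge0 K) (sqr_ge0 M) => k m k0 m0.
  by rewrite !mulr_ge0.
exists (c1 * L + c2 * S) => [|z]; first by rewrite addr_ge0 // mulr_ge0.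
have z4 : 0 <= z ^+ 4 by rewrite exprn_even_ge0.
pose J x : \bar R := (\int[mu]_(w in `[(- `|z|)%R, `|z|%R])
   ((b (x + w) - b x) ^+ 2)%:E)%E.
have J0 x : (0 <= J x)%E by apply: integral_ge0 => w _; rewrite lee_fin sqr_ge0.
have mJ : measurable_fun setT J.
  pose F (y : measurableTypeR R * measurableTypeR R) : \bar R :=
    (((b (y.1 + y.2) - b y.1) ^+ 2)%:E * (\1_`[- `|z|, `|z|]%classic y.2)%:E)%E.
  rewrite (_ : J = fun x => \int[mu]_w F (x, w))%E; last first.
    by apply/funext => x; rewrite /J integral_mkcond epatch_indic.
  apply: (measurable_fun_fubini_tonelli_F F).
    apply: emeasurable_funM; apply/measurable_EFinP.
      apply: measurable_funX; apply: measurable_funB.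
        apply: (measurableT_comp mb).
        exact: (measurable_funD measurable_fst measurable_snd).
      exact: (measurableT_comp mb measurable_fst).
    have mI : measurable_fun setT (\1_`[- `|z|, `|z|]%classic : R -> R).
      exact: measurable_indic.
    exact: (measurableT_comp mI measurable_snd).
  by move=> y; rewrite mule_ge0 // lee_fin // sqr_ge0.
have mabs : measurable_fun setT (fun x => `|b x|%:E).
  by apply/measurable_EFinP; exact: measurableT_comp.
have c1z : 0 <= c1 * z ^+ 4 by rewrite mulr_ge0.
have c2z : 0 <= c2 * `|z| by rewrite mulr_ge0.
apply: (@le_trans _ _ (\int[mu]_x ((c1 * z ^+ 4)%:E * `|b x|%:E +
    (c2 * `|z|)%:E * J x))%E).
  apply: ge0_le_integralT => [|||x].
  - apply/measurable_EFinP; apply: measurable_funX.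
    exact: (measurable_fun_pair1 z measurable_rem).
  - by apply: emeasurable_funD; exact: emeasurable_funM.
  - by move=> x; rewrite lee_fin sqr_ge0.
  apply: (@le_trans _ _ ((c1 * z ^+ 4 * `|b x|)%:E +
    c2%:E * ((inc x z - b x * z) ^+ 2)%:E)%E).
    by rewrite -EFinM -EFinD lee_fin sqr_rem_le.
  rewrite EFinM leeD2l // (EFinM c2) -muleA; apply: lee_wpmul2l => //.
  exact: (sqr_oriented_integralB_le ib mb M0 bM).
rewrite ge0_integralTD; last 4 first.
- exact: emeasurable_funM.
- exact: emeasurable_funM.
- by move=> x; rewrite -EFinM lee_fin mulr_ge0.
- by move=> x; rewrite mule_ge0.
rewrite (ge0_integralTZl mu c1z mabs) // (ge0_integralTZl mu c2z mJ) //.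
have -> : (\int[mu]_x `|b x|%:E = L%:E)%E.
  rewrite /L fineK //; have iab := integrable_abse ib.
  exact: (integrable_fin_num measurableT iab).
apply: (@le_trans _ _ ((c1 * z ^+ 4)%:E * L%:E + (c2 * `|z|)%:E *
    (`|z| `^ (2 * kappa + 1) * S)%:E)%E).
  by rewrite leeD2l //; apply: lee_wpmul2l => //; exact: integral_local_incr_le.
rewrite -!EFinM -EFinD lee_fin.
have -> : `|z| `^ (2 * kappa + 2) = `|z| * `|z| `^ (2 * kappa + 1).
  rewrite -{2}(powRr1 (normr_ge0 z)) -powRD.
    by congr (_ `^ _); ring.
  by apply/implyP => /eqP; have := kappa0; lra.
have p0 : 0 <= `|z| * `|z| `^ (2 * kappa + 1) by rewrite mulr_ge0 ?powR_ge0.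
rewrite (_ : c2 * `|z| * (`|z| `^ (2 * kappa + 1) * S) =
  c2 * S * (`|z| * `|z| `^ (2 * kappa + 1))); last by ring.
move: (`|z| * _) p0 => p p0; have s0 := S0; have l0 := L0.
clearbody c1 c2 L S.
have : 0 <= c1 * L * p by rewrite !mulr_ge0.
have : 0 <= c2 * S * z ^+ 4 by rewrite mulr_ge0 // mulr_ge0.
move: (z ^+ 4) => q; lra.
Qed.

(** By Gaussian scaling the two powers of [z] have means of order t^2 and t^(1+kappa), and t^2 <=
    T^(1-kappa) t^(1+kappa) on the horizon. *)
Lemma gauss_sqr_rem_le : exists2 C, 0 <= C & forall t, 0 <= t <= T ->
  (\int[gauss t]_z \int[mu]_x (drift_rem x z ^+ 2)%:E <= (C * t `^ (1 + kappa))%:E)%E.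
Proof.
have [C C0 remC] := integral_sqr_rem_le.
have T1 : 0 <= T `^ (1 - kappa) by exact: powR_ge0.
exists (64 * (C * (T `^ (1 - kappa) + 1))) => [|t /andP[t0 tT]].
  by rewrite !mulr_ge0 // addr_ge0.
have mI : measurable_fun setT (fun z => \int[mu]_x (drift_rem x z ^+ 2)%:E)%E.
  pose F (y : measurableTypeR R * measurableTypeR R) : \bar R :=
    (drift_rem y.1 y.2 ^+ 2)%:E.
  apply: (measurable_fun_fubini_tonelli_G F).
    by apply/measurable_EFinP; apply: measurable_funX; exact: measurable_rem.
  by move=> y; rewrite lee_fin sqr_ge0.
have I0 z : (0 <= \int[mu]_x (drift_rem x z ^+ 2)%:E)%E.
  by apply: integral_ge0 => x _; rewrite lee_fin sqr_ge0.
move: t0; rewrite le_eqVlt => /predU1P[<-|t0].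
  rewrite integral_gauss0 // (le_trans (remC 0)) // lee_fin normr0.
  rewrite !powR0 ?expr0n ?addr0 ?mulr0 //; rewrite gt_eqF //; have := kappa0; lra.
have tk0 : 0 <= t `^ (1 + kappa) by exact: powR_ge0.
pose q (z : R) := 1 + (z ^+ 2 / t) ^+ 2.
have q0 z : 0 <= q z by rewrite addr_ge0 // sqr_ge0.
have mq : measurable_fun setT (fun z => (q z)%:E).
  apply/measurable_EFinP; apply: measurable_funD => //.
  by apply: measurable_funX; apply: measurable_funM.
pose c := C * (T `^ (1 - kappa) + 1) * t `^ (1 + kappa).
have c0 : 0 <= c by rewrite !mulr_ge0 // addr_ge0.
apply: (@le_trans _ _ (\int[gauss t]_z (c%:E * (q z)%:E))%E); last first.
  rewrite (ge0_integralTZl (gauss t) c0 mq) //.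
  apply: (@le_trans _ _ (c%:E * 64%:E)%E).
    by apply: lee_wpmul2l => //; exact: gauss_quartic_le.
  by rewrite -EFinM lee_fin /c mulrC !mulrA.
apply: ge0_le_integralT => // [|z].
  exact: emeasurable_funM.
apply: (le_trans (remC z)); rewrite -EFinM lee_fin /c -!mulrA ler_wpM2l //.
set u := z ^+ 2 / t.
have u0 : 0 <= u by rewrite /u divr_ge0 ?sqr_ge0 // ltW.
have zE : z ^+ 2 = t * u by rewrite /u mulrC divfK // gt_eqF.
have t2 : t ^+ 2 <= T `^ (1 - kappa) * t `^ (1 + kappa).
  rewrite -powR_mulrn ?(ltW t0) // (_ : 2%:R = (1 - kappa) + (1 + kappa)); last by ring.
  rewrite powRD ?(gt_eqF t0) ?implybT // ler_wpM2r //.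
  by rewrite ge0_ler_powR ?nnegrE ?(ltW t0) ?(ltW T0) // subr_ge0 ltW.
have z4E : z ^+ 4 = t ^+ 2 * u ^+ 2 by rewrite -exprMn -zE -exprM.
have zk : `|z| `^ (2 * kappa + 2) <= t `^ (1 + kappa) * q z.
  have -> : `|z| `^ (2 * kappa + 2) = (z ^+ 2) `^ (1 + kappa).
    rewrite -(real_normK (num_real z)) -(powR_mulrn 2 (normr_ge0 z)) -powRrM.
    by congr (_ `^ _); ring.
  rewrite zE powRM ?(ltW t0) // ler_wpM2l // /q -/u.
  have s0 : 0 <= Num.sqrt u by exact: sqrtr_ge0.
  rewrite -{1}(sqr_sqrtr u0) -(powR_mulrn 2 s0) -powRrM.
  apply: le_trans (powR_le_quartic s0 _) _.
    by apply/andP; split; have := kappa0; have := kappa1; lra.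
  by rewrite (_ : Num.sqrt u ^+ 4 = u ^+ 2) // -[in RHS](sqr_sqrtr u0) -exprM.
have qE : q z = 1 + u ^+ 2 by [].
have u20 : 0 <= u ^+ 2 by exact: sqr_ge0.
apply: (@le_trans _ _ (T `^ (1 - kappa) * (t `^ (1 + kappa) * q z) +
   t `^ (1 + kappa) * q z)); last by rewrite mulrDl mul1r.
apply: lerD => //; rewrite z4E.
apply: (@le_trans _ _ ((T `^ (1 - kappa) * t `^ (1 + kappa)) * u ^+ 2)).
  by rewrite ler_wpM2r.
by rewrite mulrA ler_wpM2l ?mulr_ge0 // qE lerDr.
Qed.

(** The increments of [b] give t^kappa through the comparison of the Gaussian density with the
    singular weight; the term z^2 has a mean of order t <= T^(1-kappa) t^kappa. *)
Lemma gauss_sq_incr_psi_le : exists2 C, 0 <= C & forall t, 0 <= t <= T ->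
  (\int[gauss t]_z (sq_incr (psi b) z)%:E <= (C * t `^ kappa)%:E)%E.
Proof.
have [C C0 psiC] := sq_incr_psi_le M0 bM ib.
have T1 : 0 <= T `^ (1 - kappa) by exact: powR_ge0.
have bpsi := bounded_L1_psi M0 bM ib; have [mpsi _ _] := bpsi.
exists (C * (8 * S + 64 * T `^ (1 - kappa))) => [|t /andP[t0 tT]].
  by rewrite mulr_ge0 // addr_ge0 // mulr_ge0.
have mG := measurable_sq_incr mpsi; have mGb := measurable_sq_incr mb.
move: t0; rewrite le_eqVlt => /predU1P[<-|t0].
  rewrite integral_gauss0; last exact/measurable_EFinP.
  by rewrite sq_incr0 powR0 ?mulr0 // gt_eqF.
have mGbE : measurable_fun setT (fun z => (sq_incr b z)%:E) by exact/measurable_EFinP.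
have m2 : measurable_fun setT (fun z : R => (z ^+ 2)%:E).
  by apply/measurable_EFinP.
apply: (@le_trans _ _ (\int[gauss t]_z (C%:E * ((sq_incr b z)%:E + (z ^+ 2)%:E)))%E).
  apply: ge0_le_integralT => [|||z].
  - exact/measurable_EFinP.
  - by apply: emeasurable_funM => //; exact: emeasurable_funD.
  - by move=> z; rewrite lee_fin sq_incr_ge0.
  - by rewrite -EFinD -EFinM lee_fin.
rewrite ge0_integralTZl //; last 2 first.
- exact: emeasurable_funD.
- by move=> z; rewrite -EFinD lee_fin addr_ge0 ?sq_incr_ge0 ?sqr_ge0.
rewrite -mulrA EFinM; apply: lee_wpmul2l => //.
rewrite ge0_integralTD //; last 2 first.
- by move=> z; rewrite lee_fin sq_incr_ge0.
- by move=> z; rewrite lee_fin sqr_ge0.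
rewrite mulrDl EFinD; apply: leeD.
  have p14 : 1 <= 2 * kappa + 1 <= 4.
    by apply/andP; split; have := kappa0; have := kappa1; lra.
  apply: le_trans (gauss_slobodeckij_le p14 (ltW t0) mGb (sq_incr_ge0 b) (sq_incr0 b)) _.
  rewrite SE -EFinM lee_fin (_ : (2 * kappa + 1 - 1) / 2 = kappa); last by field.
  by rewrite mulrAC.
pose q (z : R) := 1 + (z ^+ 2 / t) ^+ 2.
have mq : measurable_fun setT (fun z => (q z)%:E).
  apply/measurable_EFinP; apply: measurable_funD => //.
  by apply: measurable_funX; apply: measurable_funM.
have q0 z : 0 <= q z by rewrite addr_ge0 // sqr_ge0.
apply: (@le_trans _ _ (\int[gauss t]_z (t%:E * (q z)%:E))%E).
  apply: ge0_le_integralT => // [||z].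
  - exact: emeasurable_funM.
  - by move=> z; rewrite lee_fin sqr_ge0.
  - rewrite -EFinM lee_fin /q.
    have {1}-> : z ^+ 2 = t * (z ^+ 2 / t) by rewrite mulrC divfK // gt_eqF.
    rewrite ler_wpM2l ?(ltW t0) //; move: (z ^+ 2 / t) => u.
    by rewrite expr2; nra.
rewrite (ge0_integralTZl (gauss t) (ltW t0) mq) //.
apply: (@le_trans _ _ (t%:E * 64%:E)%E).
  by apply: lee_wpmul2l; [rewrite lee_fin ltW|exact: gauss_quartic_le].
rewrite -EFinM lee_fin mulrC -mulrA ler_wpM2l //.
rewrite -[leLHS](powRr1 (ltW t0)) -{1}(subrK kappa 1).
rewrite powRD ?(gt_eqF t0) ?implybT // ler_wpM2r ?powR_ge0 //.
by rewrite ge0_ler_powR ?nnegrE ?(ltW t0) ?(ltW T0) // subr_ge0 ltW.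
Qed.

End remainder.

(** * Brownian motion on a filtered space *)

Section joint_law.
Context d1 d2 (S1 : measurableType d1) (S2 : measurableType d2) (R : realType).
Local Open Scope ereal_scope.

Lemma finite_measure_rectangle_unique
    (m m' : {measure set (S1 * S2) -> \bar R}) : m setT < +oo ->
  (forall A B, measurable A -> measurable B -> m (A `*` B) = m' (A `*` B)) ->
  forall X, measurable X -> m X = m' X.
Proof.
move=> mT mm' X mX.
pose C : set (set (S1 * S2)) :=
  [set C | exists A B, [/\ measurable A, measurable B & C = A `*` B]].
apply: (measure_unique C (fun=> setT)) => //.
- rewrite measurable_prod_measurableType //; congr (<<s _ >>).
  rewrite predeqE; split => [[A mA [B mB <-]]|[A [B [mA mB ->]]]].
    by exists A, B.
  by exists A => //; exists B.
- move=> _ _ [A [B [mA mB ->]]] [A' [B' [mA' mB' ->]]]; rewrite -setXI.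
  by exists (A `&` A'), (B `&` B'); split => //; exact: measurableI.
- by move=> _; exists setT, setT; split => //; rewrite setXTT.
- by rewrite bigcup_const //; exists 0%N.
- by move=> _ [A [B [mA mB ->]]]; exact: mm'.
Qed.

Context d (Omega : measurableType d) (P : probability Omega R)
  (Q : probability S2 R) (Y : Omega -> S1) (V : Omega -> S2).
Hypotheses (mY : measurable_fun setT Y) (mV : measurable_fun setT V).
Hypothesis YV : forall A B, measurable A -> measurable B ->
  P (Y @^-1` A `&` V @^-1` B) = P (Y @^-1` A) * Q B.

Let YQ (z : Omega * S2) : S1 * S2 := (Y z.1, z.2).

Let mYQ : measurable_fun setT YQ.
Proof.
apply: measurable_fun_pair; last exact: measurable_snd.
exact: (measurableT_comp mY measurable_fst).
Qed.

Let mYV : measurable_fun setT (fun w => (Y w, V w)).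
Proof. exact: measurable_fun_pair. Qed.

Let joint_lawE X : measurable X ->
  pushforward P (fun w => (Y w, V w)) X = pushforward (P \x Q) YQ X.
Proof.
pose m : {measure set (S1 * S2) -> \bar R} :=
  [the measure _ _ of pushforward P (fun w => (Y w, V w))].
pose m' : {measure set (S1 * S2) -> \bar R} :=
  [the measure _ _ of pushforward (P \x Q) YQ].
apply: (@finite_measure_rectangle_unique (m mYV) (m' mYQ)).
  by rewrite /= /pushforward preimage_setT probability_setT ltry.
move=> A B mA mB; rewrite /= /pushforward.
have -> : YQ @^-1` (A `*` B) = (Y @^-1` A) `*` B by [].
rewrite product_measure1E //; last by rewrite -[X in measurable X]setTI; exact: mY.
by rewrite -YV.
Qed.

(** The freezing lemma: independence makes the joint law a product, so the second variable is
    integrated out under its law [Q] while the first stays fixed. *)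
Lemma ge0_integral_joint (f : S1 * S2 -> \bar R) : measurable_fun setT f ->
  (forall z, 0 <= f z) ->
  \int[P]_w f (Y w, V w) = \int[P]_w \int[Q]_z f (Y w, z).
Proof.
move=> mf f0.
transitivity (\int[pushforward P (fun w => (Y w, V w))]_z f z).
  by rewrite ge0_integral_pushforward.
transitivity (\int[pushforward (P \x Q) YQ]_z f z).
  by apply: eq_measure_integral => X mX _; exact: joint_lawE.
rewrite ge0_integral_pushforward // preimage_setT.
apply: (fubini_tonelli1 (f \o YQ)) => [|z]; last exact: f0.
exact: measurableT_comp.
Qed.

Lemma integral_joint (f : S1 * S2 -> R) (M : R) : measurable_fun setT f ->
  (forall z, `|f z| <= M)%R ->
  \int[P]_w (f (Y w, V w))%:E = \int[P]_w \int[Q]_z (f (Y w, z))%:E.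
Proof.
move=> mf fM.
have M0 : (0 <= M)%R by exact: le_trans (fM (Y point, point)).
have mfE : measurable_fun setT (EFin \o f) by exact/measurable_EFinP.
have i1 : P.-integrable setT ((EFin \o f) \o (fun w => (Y w, V w))).
  apply: (probability_bounded_integrable P (f := f \o (fun w => (Y w, V w)))).
    exact: measurableT_comp.
  by exists M => // z; exact: fM.
have i2 : (P \x Q).-integrable setT ((EFin \o f) \o YQ).
  apply: (probability_bounded_integrable [the probability _ _ of P \x Q] (f := f \o YQ)).
    exact: measurableT_comp.
  by exists M => // z; exact: fM.
transitivity (\int[pushforward P (fun w => (Y w, V w))]_z (f z)%:E).
  by rewrite (integral_pushforward mYV mfE i1).
transitivity (\int[pushforward (P \x Q) YQ]_z (f z)%:E).
  by apply: eq_measure_integral => X mX _; exact: joint_lawE.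
rewrite (integral_pushforward mYQ mfE i2) //.
exact/esym/(integral12_prod_meas1 i2).
Qed.

End joint_law.

Section filtered_space.
Context {R : realType} d (Omega : measurableType d) (P : probability Omega R).
Variables (T : R) (F : R -> set (set Omega)).
Hypothesis (filtF : filtration T F).

(** Measurability with respect to [F t], encoded on the type whose sigma-algebra is generated by
    [F t], so that the closure properties of measurable functions apply as they stand. *)
Definition Fmeas (t : R) d' (S : measurableType d') (V : Omega -> S) :=
  measurable_fun setT (V : g_sigma_algebraType (F t) -> S).

Lemma FmeasP t d' (S : measurableType d') (V : Omega -> S) : t \in `[0, T] ->
  Fmeas t V <-> forall B, measurable B -> F t (V @^-1` B).
Proof.
move=> tT; have sF := sigma_algebra_id (filtration_sigma_algebra filtF tT).
split=> [mV B mB|mV _ B mB].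
  by rewrite -sF -[X in <<s _ >> X]setTI; exact: mV.
by rewrite setTI; apply: sub_sigma_algebra; exact: mV.
Qed.

Lemma F_measurable t A : t \in `[0, T] -> F t A -> measurable A.
Proof. by move=> tT; exact: filtration_measurable filtF _ tT _. Qed.

Lemma Fmeas_measurable t d' (S : measurableType d') (V : Omega -> S) :
  t \in `[0, T] -> Fmeas t V -> measurable_fun setT V.
Proof.
move=> tT /(FmeasP _ tT) mV _ B mB; rewrite setTI.
by apply: (F_measurable tT); exact: mV.
Qed.

Lemma Fmeas_le s t d' (S : measurableType d') (V : Omega -> S) :
  0 <= s -> s <= t -> t <= T -> Fmeas s V -> Fmeas t V.
Proof.
move=> s0 st tT.
have sI : s \in `[0, T] by rewrite in_itv /= s0 (le_trans st tT).
have tI : t \in `[0, T] by rewrite in_itv /= (le_trans s0 st).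
move=> /(FmeasP _ sI) mV; apply/(FmeasP _ tI) => B mB.
exact: (filtration_monotone filtF s0 st tT (mV _ mB)).
Qed.

End filtered_space.

(** * A modification with everywhere continuous paths *)

Section nice_brownian_motion.
Context {R : realType} d (Omega : measurableType d) (P : probability Omega R).
Variables (T : R) (F : R -> set (set Omega)).

(** Continuity and measurability hold without exceptional paths or times, which yields joint
    measurability. Independence of the past and the Gaussian law are merged into one product
    formula, which covers [s = t] through the Dirac mass. *)
Record regular_bm (W : R -> Omega -> R) : Prop := RegularBM {
  rbm_continuous : forall w, continuous (fun t => W t w);
  rbm_measurable : forall t, measurable_fun setT (W t);
  rbm_adapted : forall t, t \in `[0, T] -> Fmeas F t (W t);
  rbm_increments : forall s t, 0 <= s -> s <= t -> t <= T ->
    forall A B, F s A -> measurable B ->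
    P (A `&` (W t \- W s) @^-1` B) = (P A * gauss (t - s) B)%E }.

Lemma measure_eq_off_null (A B N : set Omega) :
  measurable A -> measurable B -> measurable N -> P N = 0%E ->
  A `\` N = B `\` N -> P A = P B.
Proof.
move=> mA mB mN PN AB.
have PD C : measurable C -> P C = P (C `\` N).
  move=> mC; have PCN : P (C `&` N) = 0%E.
    by apply: (subset_measure0 _ mN _ PN); [exact: measurableI|exact: subIsetr].
  rewrite -[RHS]adde0 -PCN; exact: (measureDI P mC mN).
by rewrite PD // AB -PD.
Qed.

(** Paths are set to 0 on the null set [N] where continuity fails, and frozen outside the horizon by
    [clamp]. Completeness puts [N] into [F 0], hence into every [F t], so the modified process is
    still adapted. *)
Lemma regular_modification (W : R -> Omega -> R) : 0 < T ->
  filtration T F -> usual_conditions P T F -> brownian_motion P T F W ->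
  exists (W' : R -> Omega -> R) (N : set Omega),
  [/\ regular_bm W', measurable N, P N = 0%E, F 0 N &
      forall w t, ~ N w -> t \in `[0, T] -> W' t w = W t w].
Proof.
move=> T0 filtF usual [adaptW startW contW indepW incrW].
pose N := [set w | ~ {within `[0, T], continuous (fun t => W t w)}].
have negN : P.-negligible N.
  by apply: negligibleS contW => w.
have F0N : F 0 N by exact: (usual_complete usual).
have I0 : (0 : R) \in `[0, T] by rewrite in_itv /= lexx ltW.
have mN : measurable N by exact: (F_measurable filtF I0).
have PN : P N = 0%E by exact/(negligibleP P mN).1.
pose clamp (t : R) : R := Num.max 0 (Num.min t T).
have clampI t : clamp t \in `[0, T].
  by rewrite in_itv /= /clamp le_max lexx /= ge_max ltW //= ge_min lexx orbT.
have clampK t : t \in `[0, T] -> clamp t = t.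
  by rewrite in_itv /= /clamp => /andP[t0 tT]; rewrite min_l // max_r.
have clamp_cont : continuous clamp.
  move=> t; apply: (@continuous_max _ _ (cst 0) (fun t => Num.min t T) t).
    exact: cvg_cst.
  by apply: (@continuous_min _ _ id (cst T) t); [exact: cvg_id|exact: cvg_cst].
have [W' W'E] : exists W' : R -> Omega -> R,
    forall t w, W' t w = if w \in N then 0 else W (clamp t) w.
  by exists (fun t w => if w \in N then 0 else W (clamp t) w).
have W'W w t : ~ N w -> t \in `[0, T] -> W' t w = W t w.
  by move=> Nw tT; rewrite W'E memNset // clampK.
have FN t : t \in `[0, T] -> F t N.
  rewrite in_itv /= => /andP[t0 tT].
  exact: (filtration_monotone filtF (lexx 0) t0 tT F0N).
have adapt t : t \in `[0, T] -> Fmeas F t (W t).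
  move=> tT; apply/(FmeasP filtF _ tT) => B mB; apply: adaptW => //.
  by exists B => //; rewrite setTI.
have adapt' t : t \in `[0, T] -> Fmeas F t (W' t).
  move=> tT; rewrite /Fmeas (_ : W' t = fun w => if w \in N then 0 else W t w); last first.
    by apply/funext => w; rewrite W'E clampK.
  apply: measurable_fun_ifT => //.
    apply: (@measurable_fun_bool _ _ _ _ true) => //.
    rewrite setTI (_ : _ @^-1` _ = N); last first.
      by apply/seteqP; split => w /=; [exact: set_mem|exact: mem_set].
    by apply: sub_sigma_algebra; exact: FN.
  exact: adapt.
have mW'T t : measurable_fun setT (W' t).
  rewrite (_ : W' t = W' (clamp t)).
    exact: (Fmeas_measurable filtF (clampI t) (adapt' _ (clampI t))).
  by apply/funext => w; rewrite !W'E (clampK (clamp t)).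
exists W', N; split => //.
split=> [w|//|//|s t s0 st tT A B FA mB].
  have [wN|wN] := pselect (N w).
    rewrite (_ : (fun t => W' t w) = cst 0); last first.
      by apply/funext => t; rewrite W'E mem_set.
    by move=> t; exact: cvg_cst.
  rewrite (_ : (fun t => W' t w) = (fun t => W t w) \o clamp); last first.
    by apply/funext => t; rewrite W'E memNset.
  have /subspace_continuousP contw : {within `[0, T], continuous (fun t => W t w)}.
    exact: contrapT.
  move=> t; have := contw (clamp t) (clampI t); apply: cvg_trans.
  move=> U HU.
  have near_t : \forall u \near t, clamp u \in `[0, T] -> U (W (clamp u) w).
    exact: (clamp_cont t _ HU).
  by apply: filterS near_t => u; apply; exact: clampI.
have sI : s \in `[0, T] by rewrite in_itv /= s0 (le_trans st tT).
have tI : t \in `[0, T] by rewrite in_itv /= (le_trans s0 st).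
have mA := F_measurable filtF sI FA.
move: st; rewrite le_eqVlt => /predU1P[<-|st].
  rewrite subrr /gauss eqxx /= (_ : W' s \- W' s = cst 0); last first.
    by apply/funext => w /=; rewrite subrr.
  rewrite preimage_cst diracE; case: ifPn => B0; first by rewrite setIT mule1.
  by rewrite setI0 measure0 mule0.
have mD (U : R -> Omega -> R) : measurable_fun setT (U s) ->
    measurable_fun setT (U t) -> measurable ((U t \- U s) @^-1` B).
  by move=> ms mt; rewrite -[X in measurable X]setTI; exact: measurable_funB.
have mW r : r \in `[0, T] -> measurable_fun setT (W r).
  by move=> rT; exact: (Fmeas_measurable filtF rT (adapt _ rT)).
have mW' r : r \in `[0, T] -> measurable_fun setT (W' r).
  by move=> rT; exact: (Fmeas_measurable filtF rT (adapt' _ rT)).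
have -> : P (A `&` (W' t \- W' s) @^-1` B) = P (A `&` (W t \- W s) @^-1` B).
  apply: (@measure_eq_off_null _ _ N) => //.
  - by apply: measurableI => //; apply: mD; exact: mW'.
  - by apply: measurableI => //; apply: mD; exact: mW.
  - by apply/seteqP; split => w /= [[Aw Bw] Nw]; split => //; split => //;
      move: Bw; rewrite /= !W'W.
rewrite (indepW s t s0 st tT) //; last by exists B => //; rewrite setTI.
congr (_ * _)%E; rewrite incrW // /gauss gt_eqF //; lra.
Qed.

End nice_brownian_motion.

Section regular_bm_theory.
Context {R : realType} d (Omega : measurableType d) (P : probability Omega R).
Variables (T : R) (F : R -> set (set Omega)) (W : R -> Omega -> R).
Hypotheses (T0 : 0 < T) (filtF : filtration T F) (rW : regular_bm P T F W).
Notation mu := (@lebesgue_measure R).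

Let inI (s t : R) : 0 <= s -> s <= t -> t <= T -> s \in `[0, T] /\ t \in `[0, T].
Proof. by move=> s0 st tT; rewrite !in_itv /= s0 tT (le_trans s0 st) (le_trans st tT). Qed.

Lemma measurable_bm_incr s t : 0 <= s -> s <= t -> t <= T ->
  measurable_fun setT (W t \- W s)%R.
Proof.
move=> s0 st tT; have [sI tI] := inI s0 st tT.
by apply: measurable_funB; exact: (rbm_measurable rW).
Qed.

Lemma Fmeas_bm_incr s t r : 0 <= s -> s <= t -> t <= r -> r <= T ->
  Fmeas F r (W t \- W s)%R.
Proof.
move=> s0 st tr rT; have [sI tI] := inI s0 st (le_trans tr rT).
have mt := Fmeas_le filtF (le_trans s0 st) tr rT (rbm_adapted rW tI).
have ms := Fmeas_le filtF s0 (le_trans st tr) rT (rbm_adapted rW sI).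
exact: measurable_funB.
Qed.

Section past_and_increment.
Variables (s t : R) (s0 : 0 <= s) (st : s <= t) (tT : t <= T).
Variables (dS : measure_display) (S : measurableType dS) (Y : Omega -> S).
Hypothesis mY : Fmeas F s Y.

Let mYO : measurable_fun setT Y.
Proof. by have [sI _] := inI s0 st tT; exact: (Fmeas_measurable filtF sI mY). Qed.

Let rect A B : measurable A -> measurable B ->
  (P (Y @^-1` A `&` (W t \- W s)%R @^-1` B) = P (Y @^-1` A) * gauss (t - s) B)%E.
Proof.
move=> mA mB; have [sI _] := inI s0 st tT.
by apply: (rbm_increments rW) => //; exact: ((FmeasP filtF Y sI).1 mY).
Qed.

Lemma ge0_integral_past_incr (f : S * R -> \bar R) : measurable_fun setT f ->
  (forall z, 0 <= f z)%E ->
  (\int[P]_w f (Y w, (W t \- W s)%R w) =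
   \int[P]_w \int[gauss (t - s)]_z f (Y w, z))%E.
Proof.
exact: (@ge0_integral_joint _ _ S (measurableTypeR R) _ _ _ P (gauss (t - s))
  Y (W t \- W s)%R mYO (measurable_bm_incr s0 st tT) rect f).
Qed.

Lemma integral_past_incr (f : S * R -> R) (M : R) : measurable_fun setT f ->
  (forall z, `|f z| <= M) ->
  (\int[P]_w (f (Y w, (W t \- W s)%R w))%:E =
   \int[P]_w \int[gauss (t - s)]_z (f (Y w, z))%:E)%E.
Proof.
exact: (@integral_joint _ _ S (measurableTypeR R) _ _ _ P (gauss (t - s))
  Y (W t \- W s)%R mYO (measurable_bm_incr s0 st tT) rect f M).
Qed.

End past_and_increment.

Lemma ge0_integral_incr s t (f : R -> \bar R) : 0 <= s -> s <= t -> t <= T ->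
  measurable_fun setT f -> (forall z, 0 <= f z)%E ->
  (\int[P]_w f ((W t \- W s)%R w) = \int[gauss (t - s)]_z f z)%E.
Proof.
move=> s0 st tT mf f0.
have mY : Fmeas F s (cst (0 : R) : Omega -> R) by exact: measurable_cst.
have mg : measurable_fun setT (fun z : R * R => f z.2).
  exact: (measurableT_comp mf measurable_snd).
have E := ge0_integral_past_incr s0 st tT mY mg (fun z => f0 z.2).
rewrite E; transitivity (\int[P]__ (\int[gauss (t - s)]_z f z))%E => //.
by rewrite integral_cst //= probability_setT mule1.
Qed.

Lemma integral_incr s t (f : R -> R) (M : R) : 0 <= s -> s <= t -> t <= T ->
  measurable_fun setT f -> (forall z, `|f z| <= M) ->
  (\int[P]_w (f ((W t \- W s)%R w))%:E = \int[gauss (t - s)]_z (f z)%:E)%E.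
Proof.
move=> s0 st tT mf fM.
have mY : Fmeas F s (cst (0 : R) : Omega -> R) by exact: measurable_cst.
have mg : measurable_fun setT (fun z : R * R => f z.2).
  exact: (measurableT_comp mf measurable_snd).
have E := integral_past_incr s0 st tT mY mg (fun z => fM z.2).
rewrite E; transitivity (\int[P]__ (\int[gauss (t - s)]_z (f z)%:E))%E => //.
by rewrite integral_cst //= probability_setT mule1.
Qed.

(** An increment of length [x + a] is the sum of independent increments of lengths [a] and [x], so
    no convolution of densities has to be computed. *)
Lemma bm_gauss_convolution (x a : R) : 0 <= x -> 0 <= a -> x + a <= T ->
  gauss_convolution x a.
Proof.
move=> x0 a0 xaT f mf [M M0 fM].
have xa0 : 0 <= x + a by rewrite addr_ge0.
have axa : a <= x + a by rewrite lerDr.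
have aT : a <= T by exact: le_trans xaT.
have mfD : measurable_fun setT (fun z : R * R => f (z.2 + z.1)).
  by apply: (measurableT_comp mf); exact: (measurable_funD measurable_snd measurable_fst).
have mI : measurable_fun setT (fun z : R => \int[gauss x]_y f (y + z)).
  exact: (@measurable_Rintegral_param _ _ _ _ _ (gauss x) (fun z => f (z.2 + z.1)) mfD).
have mfz (z : R) : measurable_fun setT (fun y : R => f (y + z)).
  exact: (measurable_fun_pair2 z mfD).
have IM (z : R) : `|\int[gauss x]_y f (y + z)| <= M.
  exact: (normr_Rintegral_probability_le (gauss x) (mfz z) M0 (fun y => fM (y + z))).
congr fine.
have := integral_incr (lexx 0) xa0 xaT mf fM; rewrite subr0 => <-.
have := integral_incr (lexx 0) a0 aT mI IM; rewrite subr0 => <-.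
have mY : Fmeas F a (W a \- W 0)%R by exact: Fmeas_bm_incr.
transitivity (\int[P]_w (f ((W (x + a) \- W a)%R w + (W a \- W 0)%R w))%:E)%E.
  by apply: eq_integral => w _; congr (_%:E); congr f => /=; ring.
have E := integral_past_incr a0 axa xaT mY mfD (fun z => fM (z.2 + z.1)).
rewrite E.
apply: eq_integral => w _; rewrite addrK fineK //.
apply: (integrable_fin_num measurableT).
by apply: (probability_bounded_integrable (gauss x) (mfz _)); exists M.
Qed.

(** Given the position at time 0, the position at [a] has a density of at most a^(-1/2). The bound
    is uniform in that position, so the law of [X0] does not enter the constants. *)
Lemma bm_density_le (X0 : Omega -> R) (a : R) (f : R -> \bar R) :
  Fmeas F 0 X0 -> 0 < a -> a <= T -> measurable_fun setT f ->
  (forall z, 0 <= f z)%E ->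
  (\int[P]_w f (W a w + X0 w)%R <= ((Num.sqrt a)^-1)%:E * \int[mu]_z f z)%E.
Proof.
move=> mX0 a0 aT mf f0.
have I0 : (0 : R) \in `[0, T] by rewrite in_itv /= lexx ltW.
have mY : Fmeas F 0 (fun w => W 0 w + X0 w).
  exact: (measurable_funD (rbm_adapted rW I0) mX0).
have mg : measurable_fun setT (fun z : R * R => f (z.2 + z.1)).
  by apply: (measurableT_comp mf); exact: (measurable_funD measurable_snd measurable_fst).
have g0 (z : R * R) : (0 <= f (z.2 + z.1)%R)%E by exact: f0.
have := ge0_integral_past_incr (lexx 0) (ltW a0) aT mY mg g0; rewrite subr0 => E.
rewrite [leLHS](_ : _ = \int[P]_w f ((W a \- W 0)%R w + (W 0 w + X0 w))%R)%E; last first.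
  by apply: eq_integral => w _; congr f => /=; ring.
rewrite E.
apply: (@le_trans _ _ (\int[P]_w (((Num.sqrt a)^-1)%:E * \int[mu]_z f z))%E).
  apply: ge0_le_integralT => [|||w].
  - apply: (measurableT_comp (f := fun y => \int[gauss a]_z f (z + y)%R)%E).
      exact: (@measurable_fun_fubini_tonelli_F _ _ _ _ _ (gauss a) (fun z => f (z.2 + z.1)%R)).
    exact: (Fmeas_measurable filtF I0 mY).
  - exact: measurable_cst.
  - by move=> w; exact: integral_ge0.
  apply: le_trans (gauss_le_lebesgue a0 _ _) _ => //.
    exact: (measurableT_comp mf (measurable_addr _)).
  by rewrite lebesgue_integral_shift.
by rewrite integral_cst //= probability_setT mule1.
Qed.

End regular_bm_theory.

(** Time is rounded down to multiples of 1/(n+1). The rounded process is jointly measurable, its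
    preimages being countable unions of rectangles, and it converges to [W] by continuity of the
    paths. *)
Lemma measurable_continuous_process (R : realType) d (Omega : measurableType d)
    (W : R -> Omega -> R) :
  (forall w, continuous (fun t => W t w)) -> (forall t, measurable_fun setT (W t)) ->
  measurable_fun setT (fun z : measurableTypeR R * Omega => W z.1 z.2).
Proof.
move=> contW mW.
pose tn (n : nat) (t : R) : R := (Num.floor (t * n.+1%:R))%:~R / n.+1%:R.
have n0 n : (0 : R) < n.+1%:R by rewrite ltr0n.
have tn_cvg t : tn n t @[n --> \oo] --> t.
  apply: (@squeeze_cvgr _ _ _ _ (fun n => t - harmonic n) (fun _ => t)).
  - apply: nearW => n; rewrite /tn /harmonic ler_pdivrMr // ler_pdivlMr // mulrBl mulVf ?gt_eqF //.
    have /andP[f1 f2] := floor_itv (t * n.+1%:R).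
    by rewrite f1 andbT lerBlDr -(intrD _ _ 1) ltW.
  - rewrite -[X in _ --> X]subr0; apply: cvgB; first exact: cvg_cst.
    exact: cvg_harmonic.
  - exact: cvg_cst.
apply: (@measurable_fun_cvg _ _ _ _ (fun n z => W (tn n z.1) z.2)) => [n|z _]; last first.
  exact: (cvg_comp (tn^~ z.1) (fun t => W t z.2) (tn_cvg z.1) (contW z.2 z.1)).
move=> _ B mB; rewrite setTI.
pose A (k : int) := [set t : measurableTypeR R | (Num.floor (t * n.+1%:R))%:~R = k%:~R :> R].
rewrite (_ : _ @^-1` _ = \bigcup_k (A k `*` (W (k%:~R / n.+1%:R) @^-1` B))); last first.
  apply/seteqP; split => [[t w]/= Bt|[t w] [k _ [/= Ak]]].
    by exists (Num.floor (t * n.+1%:R)).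
  by rewrite /tn Ak.
apply: countable_bigcupT_measurable => // k; apply: measurableX; last first.
  by rewrite -[X in measurable X]setTI; exact: mW.
rewrite -[A k]setTI.
have mfl : measurable_fun setT (fun t : R => (Num.floor (t * n.+1%:R))%:~R : R).
  apply: nondecreasing_measurable => // s t st.
  by rewrite ler_int; apply: le_floor; rewrite ler_wpM2r // ltW.
exact: (mfl measurableT [set k%:~R] (measurable_set1 _)).
Qed.

Lemma Rintegral_lincomb4 (R : realType) d (S : measurableType d)
    (m : {measure set S -> \bar R}) (f1 f2 f3 f4 : S -> R) :
  m.-integrable setT (EFin \o f1) -> m.-integrable setT (EFin \o f2) ->
  m.-integrable setT (EFin \o f3) -> m.-integrable setT (EFin \o f4) ->
  \int[m]_x (f1 x - f2 x - f3 x + f4 x) =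
  \int[m]_x f1 x - \int[m]_x f2 x - \int[m]_x f3 x + \int[m]_x f4 x.
Proof.
move=> i1 i2 i3 i4.
have i12 : m.-integrable setT (EFin \o (fun x => f1 x - f2 x)).
  by have := integrableB measurableT i1 i2.
have i123 : m.-integrable setT (EFin \o (fun x => f1 x - f2 x - f3 x)).
  by have := integrableB measurableT i12 i3.
by rewrite (RintegralD measurableT i123 i4) (RintegralB measurableT i12 i3) (RintegralB measurableT i1 i2).
Qed.

(** * The Markov property at two times *)

Section markov_property.
Context {R : realType} d (Omega : measurableType d) (P : probability Omega R).
Variables (T : R) (F : R -> set (set Omega)) (W : R -> Omega -> R) (X0 : Omega -> R).
Hypotheses (T0 : 0 < T) (filtF : filtration T F) (rW : regular_bm P T F W).
Hypothesis mX0 : Fmeas F 0 X0.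
Notation mu := (@lebesgue_measure R).
Notation X t w := (W t w + X0 w)%R.

Variables (f : R -> R) (M : R).
Hypotheses (mf : measurable_fun setT f) (M0 : 0 <= M) (fM : forall x, `|f x| <= M).

Lemma Fmeas_bmD t : 0 <= t -> t <= T -> Fmeas F t (fun w => X t w).
Proof.
move=> t0 tT; have tI : t \in `[0, T] by rewrite in_itv /= t0.
exact: (measurable_funD (rbm_adapted rW tI) (Fmeas_le filtF (lexx 0) t0 tT mX0)).
Qed.

(** On both sides the increment from [r] to [r'] is integrated out first, leaving a function [G] of
    the position at [r], and then the increment from [a] to [r]. *)
Let markov_ordered (a r r' : R) : 0 <= a -> a <= r -> r <= r' -> r' <= T ->
  \int[P]_w (f (X r w) * f (X r' w)) =
  \int[P]_w' \int[P]_w (f (X a w' + (W r \- W a)%R w) * f (X a w' + (W r' \- W a)%R w)).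
Proof.
move=> a0 ar rr' r'T; have r0 := le_trans a0 ar; have rT := le_trans rr' r'T.
pose g (z : R * R) : R := f z.1 * f (z.1 + z.2).
have mg : measurable_fun setT g.
  apply: measurable_funM; first exact: (measurableT_comp mf measurable_fst).
  by apply: (measurableT_comp mf); exact: (measurable_funD measurable_fst measurable_snd).
have gM z : `|g z| <= M * M by rewrite normrM ler_pM.
have MM : 0 <= M * M by rewrite mulr_ge0.
pose G (y : R) : R := \int[gauss (r' - r)]_z g (y, z).
have mG : measurable_fun setT G.
  exact: (@measurable_Rintegral_param _ _ _ _ _ (gauss (r' - r)) g mg).
have GM y : `|G y| <= M * M.
  exact: (normr_Rintegral_probability_le (gauss (r' - r)) (measurable_fun_pair2 y mg) MM (fun z => gM (y, z))).
have GE y : ((G y)%:E = \int[gauss (r' - r)]_z (g (y, z))%:E)%E.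
  rewrite fineK //; apply: (integrable_fin_num measurableT).
  by apply: (probability_bounded_integrable (gauss (r' - r)) (measurable_fun_pair2 y mg)); exists (M * M).
have mGD : measurable_fun setT (fun z : R * R => G (z.1 + z.2)).
  by apply: (measurableT_comp mG); exact: (measurable_funD measurable_fst measurable_snd).
have step x : \int[P]_w (f (x + (W r \- W a)%R w) * f (x + (W r' \- W a)%R w)) =
    \int[gauss (r - a)]_z G (x + z).
  congr fine.
  have mY : Fmeas F r (fun w => x + (W r \- W a)%R w).
    by apply: (measurable_funD (measurable_cst x)); exact: (Fmeas_bm_incr filtF rW).
  have E := integral_past_incr filtF rW r0 rr' r'T mY mg gM.
  transitivity (\int[P]_w (g (x + (W r \- W a)%R w, (W r' \- W r)%R w))%:E)%E.
    by apply: eq_integral => w _; congr (_%:E); congr (_ * f _) => /=; ring.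
  rewrite E; transitivity (\int[P]_w (G (x + (W r \- W a)%R w))%:E)%E.
    by apply: eq_integral => w _; rewrite GE.
  have mGx : measurable_fun setT (fun z => G (x + z)) by exact: (measurable_fun_pair2 x mGD).
  exact: (integral_incr filtF rW a0 ar rT mGx (fun z => GM (x + z))).
congr fine.
transitivity (\int[P]_w (g (X r w, (W r' \- W r)%R w))%:E)%E.
  by apply: eq_integral => w _; congr (_%:E); congr (_ * f _) => /=; ring.
have E1 := integral_past_incr filtF rW r0 rr' r'T (Fmeas_bmD r0 rT) mg gM.
rewrite E1; transitivity (\int[P]_w (G (X r w))%:E)%E.
  by apply: eq_integral => w _; rewrite GE.
transitivity (\int[P]_w (G (X a w + (W r \- W a)%R w))%:E)%E.
  by apply: eq_integral => w _; congr (_%:E); congr G => /=; ring.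
have E2 := integral_past_incr filtF rW a0 ar rT
  (Fmeas_bmD a0 (le_trans ar rT)) mGD (fun z => GM (z.1 + z.2)).
rewrite E2; apply: eq_integral => w _; rewrite step fineK //.
apply: (integrable_fin_num measurableT).
by apply: (probability_bounded_integrable (gauss (r - a)) (measurable_fun_pair2 (X a w) mGD)); exists (M * M).
Qed.

(** The path after [a] is replaced by an independent copy restarted from the position at [a]. Pairs
    of times are enough, because the square of a time integral involves only two-time products. *)
Lemma markov_two_points (a r r' : R) : 0 <= a -> a <= r -> a <= r' ->
  r <= T -> r' <= T ->
  \int[P]_w (f (X r w) * f (X r' w)) =
  \int[P]_w' \int[P]_w (f (X a w' + (W r \- W a)%R w) * f (X a w' + (W r' \- W a)%R w)).
Proof.
move=> a0 ar ar' rT r'T; have [rr'|/ltW r'r] := leP r r'.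
  exact: markov_ordered.
transitivity (\int[P]_w (f (X r' w) * f (X r w))).
  by apply: eq_Rintegral => w _; rewrite mulrC.
rewrite (markov_ordered a0 ar' r'r rT); apply: eq_Rintegral => w' _.
by apply: eq_Rintegral => w _; rewrite mulrC.
Qed.

End markov_property.

(** * Covariances on a time block *)

Lemma gauss_sqr_le (R : realType) (t : R) : 0 <= t ->
  (\int[gauss t]_z (z ^+ 2)%:E <= (64 * t)%:E)%E.
Proof.
rewrite le_eqVlt => /predU1P[<-|t0].
  rewrite integral_gauss0; first by rewrite expr0n mulr0.
  by apply/measurable_EFinP; exact: measurable_funX.
have m2 : measurable_fun setT (fun z : R => z ^+ 2) by exact: measurable_funX.
have mq : measurable_fun setT (fun z : R => (1 + (z ^+ 2 / t) ^+ 2)%:E).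
  apply/measurable_EFinP; apply: measurable_funD => //; apply: measurable_funX.
  exact: measurable_funM.
have q0 (z : R) : (0 <= (1 + (z ^+ 2 / t) ^+ 2)%:E)%E.
  by rewrite lee_fin addr_ge0 // sqr_ge0.
apply: (@le_trans _ _ (\int[gauss t]_z (t%:E * (1 + (z ^+ 2 / t) ^+ 2)%:E))%E).
  apply: ge0_le_integralT => [|||z].
  - exact/measurable_EFinP.
  - by apply: emeasurable_funM => //; exact: measurable_cst.
  - by move=> z; rewrite lee_fin sqr_ge0.
  - rewrite -EFinM lee_fin; set v := z ^+ 2 / t.
    have -> : z ^+ 2 = t * v by rewrite mulrC /v divfK // gt_eqF.
    rewrite ler_wpM2l ?(ltW t0) //; have := sqr_ge0 (v - 1); nra.
rewrite (ge0_integralTZl (gauss t) (ltW t0) mq q0) mulrC EFinM.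
by apply: lee_wpmul2l; [rewrite lee_fin ltW|exact: gauss_quartic_le].
Qed.

Section probability_bound.
Context {R : realType} d (S : measurableType d) (P : probability S R).

Lemma probability_integral_le (f : S -> R) c : measurable_fun setT f ->
  (forall x, 0 <= f x <= c) -> (\int[P]_x (f x)%:E <= c%:E)%E.
Proof.
move=> mf fc; apply: (@le_trans _ _ (\int[P]_x (cst c%:E x))%E).
  apply: ge0_le_integralT => [|||x].
  - exact/measurable_EFinP.
  - exact: measurable_cst.
  - by move=> x; rewrite lee_fin; have /andP[] := fc x.
  - by rewrite lee_fin; have /andP[] := fc x.
by rewrite integral_cst //= probability_setT mule1.
Qed.

End probability_bound.

Section block.
Context {R : realType} d (Omega : measurableType d) (P : probability Omega R).
Variables (T : R) (F : R -> set (set Omega)) (W : R -> Omega -> R) (X0 : Omega -> R).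
Hypotheses (T0 : 0 < T) (filtF : filtration T F) (rW : regular_bm P T F W).
Hypothesis mX0 : Fmeas F 0 X0.
Notation mu := (@lebesgue_measure R).
Notation X t w := (W t w + X0 w)%R.

Variables (eta : R -> R) (h : R).
Hypotheses (meta : measurable_fun setT eta).
Hypothesis eta_ge0 : forall s, 0 <= s -> s <= T -> 0 <= eta s.
Hypothesis eta_le : forall s, 0 <= s -> s <= T -> eta s <= s.
Hypothesis eta_mesh : forall s, 0 <= s -> s <= T -> s - eta s <= h.
Hypothesis eta_cell : forall u s, 0 <= u -> u <= s -> s <= T ->
  eta u = eta s \/ u <= eta s.

Variables (u v : R).
Hypotheses (u0 : 0 <= u) (uv : u <= v) (vT : v <= T).

Let I (s : R) : R := \1_(`[u, v]%classic) s.

Let Iout s : s \notin `[u, v] -> I s = 0.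
Proof. by move=> sI; rewrite /I indicE memNset //= => /negP; rewrite (negbTE sI). Qed.

Let Iin s : s \in `[u, v] -> I s = 1.
Proof. by move=> sI; rewrite /I indicE mem_set. Qed.

Let inb s : s \in `[u, v] -> [/\ 0 <= s, s <= T, 0 <= eta s & eta s <= s].
Proof.
rewrite in_itv /= => /andP[us sv]; have s0 := le_trans u0 us; have sT := le_trans sv vT.
by split => //; [exact: eta_ge0|exact: eta_le].
Qed.

Let h0 : 0 <= h.
Proof.
have uT := le_trans uv vT; apply: le_trans (eta_mesh u0 uT).
by rewrite subr_ge0; exact: eta_le.
Qed.

Let mI d' (S : measurableType d') : measurable_fun setT (fun z : measurableTypeR R * S => I z.1).
Proof.
apply: (measurableT_comp _ measurable_fst); exact: measurable_indic.
Qed.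

Let mW : measurable_fun setT (fun z : measurableTypeR R * Omega => W z.1 z.2).
Proof.
exact: (measurable_continuous_process (rbm_continuous rW) (rbm_measurable rW)).
Qed.

Let mWe : measurable_fun setT (fun z : measurableTypeR R * Omega => W (eta z.1) z.2).
Proof.
apply: (measurableT_comp mW (f := fun z : measurableTypeR R * Omega => W z.1 z.2)
  (g := fun z : measurableTypeR R * Omega => (eta z.1 : measurableTypeR R, z.2))).
apply: measurable_fun_pair => //.
exact: (measurableT_comp meta measurable_fst).
Qed.

Let mX02 : measurable_fun setT (fun z : measurableTypeR R * Omega => X0 z.2).
Proof.
apply: (measurableT_comp _ measurable_snd).
have T_ge0 := ltW T0.
by apply: (Fmeas_measurable filtF (t := 0) _ mX0); rewrite in_itv /= lexx.
Qed.

Lemma measurable_bmD : measurable_fun setT (fun z : measurableTypeR R * Omega => X z.1 z.2).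
Proof. exact: measurable_funD. Qed.

Lemma measurable_sampled_bmD : measurable_fun setT (fun z : measurableTypeR R * Omega => X (eta z.1) z.2).
Proof. exact: measurable_funD. Qed.

Lemma measurable_sampled_incr : measurable_fun setT
  (fun z : measurableTypeR R * Omega => W z.1 z.2 - W (eta z.1) z.2).
Proof. exact: measurable_funB. Qed.

(** Products across cells have mean zero, since the later increment is independent of the past and
    [trunc] is odd. Inside a cell the second moment is of order [h], and so is the width of the band
    of such pairs, whence h^2. *)
Lemma block_martingale_le (f : R -> R) (K : R) : measurable_fun setT f ->
  0 <= K -> (forall x, `|f x| <= K) ->
  (\int[P]_w ((\int[mu]_s (\1_(`[u, v]%classic) s *
      (f (X (eta s) w) * trunc (W s w - W (eta s) w)))) ^+ 2)%:E <=
   (2 * (K ^+ 2 * (64 * h)) * h * (v - u))%:E)%E.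
Proof.
move=> mf K0 fK.
pose H (z : measurableTypeR R * Omega) : R :=
  I z.1 * (f (X (eta z.1) z.2) * trunc (W z.1 z.2 - W (eta z.1) z.2)).
have mH : measurable_fun setT H.
  apply: measurable_funM; first exact: mI.
  apply: measurable_funM; first exact: (measurableT_comp mf measurable_sampled_bmD).
  exact: (measurableT_comp (@measurable_trunc R) measurable_sampled_incr).
have I1 s : `|I s| <= 1.
  have [sI|sI] := boolP (s \in `[u, v]); first by rewrite Iin // normr1.
  by rewrite Iout // normr0.
have HK z : `|H z| <= K.
  rewrite !normrM -[leRHS]mul1r; apply: ler_pM (I1 _) _ => //.
  by rewrite -[leRHS]mulr1; apply: ler_pM (fK _) (normr_trunc_le1 _).
have Hout s w : s \notin `[u, v] -> H (s, w) = 0.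
  by move=> sI; rewrite /H Iout // mul0r.
have A0 : 0 <= K ^+ 2 * (64 * h) by rewrite mulr_ge0 ?sqr_ge0 // mulr_ge0.
have Hsq s : (\int[P]_w (H (s, w) ^+ 2)%:E <= (K ^+ 2 * (64 * h))%:E)%E.
  have [sI|sI] := boolP (s \in `[u, v]); last first.
    rewrite integral0_eq ?lee_fin // => w _.
    by rewrite Hout // expr0n.
  have [s0 sT e0 es] := inb sI.
  have mi : measurable_fun setT (W s \- W (eta s))%R.
    exact: (measurable_bm_incr rW e0 es sT).
  have m2 : measurable_fun setT (fun z : R => (z ^+ 2)%:E).
    by apply/measurable_EFinP; exact: measurable_funX.
  have p2 (z : R) : (0 <= (z ^+ 2)%:E)%E by rewrite lee_fin sqr_ge0.
  apply: (@le_trans _ _ (\int[P]_w ((K ^+ 2)%:E * (((W s \- W (eta s))%R w) ^+ 2)%:E))%E).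
    apply: ge0_le_integralT => [|||w].
    - apply/measurable_EFinP; apply: measurable_funX.
      exact: (measurable_fun_pair2 s mH).
    - apply: emeasurable_funM; first exact: measurable_cst.
      by apply/measurable_EFinP; exact: measurable_funX.
    - by move=> w; rewrite lee_fin sqr_ge0.
    - rewrite -EFinM lee_fin -exprMn -real_normK ?num_real // -[leRHS]real_normK ?num_real //.
      rewrite ler_pXn2r ?nnegrE // /H Iin // mul1r !normrM (ger0_norm K0).
      by rewrite ler_pM //; exact: normr_trunc_le.
  have mi2 : measurable_fun setT (fun w => (((W s \- W (eta s))%R w) ^+ 2)%:E).
    by apply/measurable_EFinP; exact: measurable_funX.
  rewrite (ge0_integralTZl P (sqr_ge0 K) mi2 (fun w => p2 _)) [leRHS]EFinM.
  apply: lee_wpmul2l; first by rewrite lee_fin sqr_ge0.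
  rewrite (ge0_integral_incr filtF rW e0 es sT m2 p2).
  have d0 : 0 <= s - eta s by rewrite subr_ge0.
  apply: (le_trans (gauss_sqr_le d0)).
  by rewrite lee_fin ler_wpM2l // eta_mesh.
have orth r s : r \in `[u, v] -> s \in `[u, v] -> r <= eta s ->
    (\int[P]_w (H (r, w) * H (s, w))%:E = 0)%E.
  move=> rI sI res; have [s0 sT e0 es] := inb sI; have [r0 rT er0 er] := inb rI.
  (* All but the last increment is known at time [eta s]: the position there and, because
     [r <= eta s], the whole factor at [r]. *)
  pose Y w : R * (R * R) := (X (eta s) w, (X (eta r) w, (W r \- W (eta r))%R w)).
  pose g (z : R * (R * R) * R) : R := f z.1.1 * (f z.1.2.1 * trunc z.1.2.2) * trunc z.2.
  have eT : eta s <= T by exact: le_trans sT.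
  have mY : Fmeas F (eta s) Y.
    apply: measurable_fun_pair; first exact: (Fmeas_bmD filtF rW mX0 e0 eT).
    apply: measurable_fun_pair; last exact: (Fmeas_bm_incr filtF rW er0 er res eT).
    apply: (Fmeas_le filtF er0 (le_trans er res) eT).
    exact: (Fmeas_bmD filtF rW mX0 er0 (le_trans er rT)).
  have mtr := @measurable_trunc R.
  have m1 : measurable_fun setT (fun z : R * (R * R) * R => z.1.1).
    exact: (measurableT_comp measurable_fst measurable_fst).
  have m2 : measurable_fun setT (fun z : R * (R * R) * R => z.1.2).
    exact: (measurableT_comp measurable_snd measurable_fst).
  have mg : measurable_fun setT g.
    apply: measurable_funM; last exact: (measurableT_comp mtr measurable_snd).
    apply: measurable_funM; first exact: (measurableT_comp mf m1).
    apply: measurable_funM.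
      exact: (measurableT_comp mf (measurableT_comp measurable_fst m2)).
    exact: (measurableT_comp mtr (measurableT_comp measurable_snd m2)).
  have gK z : `|g z| <= K * K.
    rewrite !normrM -[leRHS]mulr1; apply: ler_pM (normr_trunc_le1 _) => //.
    apply: ler_pM (fK _) _ => //.
    by rewrite -[leRHS]mulr1; apply: ler_pM (fK _) (normr_trunc_le1 _).
  have E := integral_past_incr filtF rW e0 es sT mY mg gK.
  rewrite (_ : \int[P]_w _ = \int[P]_w (g (Y w, (W s \- W (eta s))%R w))%:E)%E; last first.
    by apply: eq_integral => w _; congr (_%:E); rewrite /H !Iin // /g /Y /=; ring.
  rewrite E integral0_eq // => w _.
  have d0 : 0 <= s - eta s by rewrite subr_ge0.
  have mgw : measurable_fun setT (fun z => g (Y w, z)) by exact: (measurable_fun_pair2 (Y w) mg).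
  have mgwE : measurable_fun setT (fun z => (g (Y w, z))%:E) by exact/measurable_EFinP.
  have ig : (gauss (s - eta s)).-integrable setT (fun z => (g (Y w, z))%:E).
    apply: (probability_bounded_integrable (gauss (s - eta s)) mgw).
    by exists (K * K) => //; rewrite mulr_ge0.
  (* By oddness of [trunc] the Gaussian integral equals its own opposite, and being finite it
     vanishes. *)
  have := integral_gauss_opp d0 mgwE.
  rewrite (_ : \int[_]_z _ = - \int[gauss (s - eta s)]_z (g (Y w, z))%:E)%E; last first.
    rewrite -integralN //=.
      by apply: eq_integral => z _; rewrite /g /= truncN mulrN EFinN.
    exact: integrable_add_def.
  have := integrable_fin_num measurableT ig.
  case: (\int[_]_z _)%E => // x _ [] xx; congr (_%:E); lra.
apply: (integral_sq_Rintegral_le mH HK Hout Hsq A0 h0 uv) => r s rI sI.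
have case_le r' s' : r' \in `[u, v] -> s' \in `[u, v] -> r' <= s' ->
    (\int[P]_w (H (r', w) * H (s', w))%:E <=
     (if `|r' - s'| <= h then K ^+ 2 * (64 * h) else 0)%:E)%E.
  move=> r'I s'I rs'.
  have [s0 sT e0 es] := inb s'I; have [r0 rT er0 er] := inb r'I.
  have [eE|res] := eta_cell r0 rs' sT; last first.
    by rewrite orth //; case: ifP; rewrite lee_fin.
  rewrite ifT; last first.
    rewrite distrC ger0_norm ?subr_ge0 //; have := eta_mesh s0 sT; lra.
  apply: le_trans (integral_abs_prod_le mH Hsq r' s').
  apply: le_trans (lee_abs _) _.
  apply: le_abse_integral => //; apply/measurable_EFinP.
  by apply: measurable_funM; exact: (measurable_fun_pair2 _ mH).
have [rs|/ltW sr] := leP r s; first exact: case_le.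
rewrite distrC; apply: le_trans (case_le _ _ sI rI sr).
by under eq_integral do rewrite mulrC.
Qed.

Variable a : R.
Hypotheses (a0 : 0 < a) (eta_ge : forall s, s \in `[u, v] -> a <= eta s).

(** No cancellation is involved: at a single time the increment is independent of the sampled
    position, whose density is at most a^(-1/2), and Tonelli puts the Lebesgue integral in the
    position inside the Gaussian one. *)
Lemma block_remainder_le (rm : R * R -> R) (K C : R) : measurable_fun setT rm ->
  (forall z, `|rm z| <= K) -> 0 <= C ->
  (forall t, 0 <= t -> t <= T -> t <= h ->
    (\int[gauss t]_z \int[mu]_x (rm (x, z) ^+ 2)%:E <= C%:E)%E) ->
  (\int[P]_w ((\int[mu]_s (\1_(`[u, v]%classic) s *
      rm (X (eta s) w, W s w - W (eta s) w))) ^+ 2)%:E <=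
   (2 * ((Num.sqrt a)^-1 * C) * (v - u) ^+ 2)%:E)%E.
Proof.
move=> mrm rmK C0 rmC.
pose H (z : measurableTypeR R * Omega) : R :=
  I z.1 * rm (X (eta z.1) z.2, W z.1 z.2 - W (eta z.1) z.2).
have mH : measurable_fun setT H.
  apply: measurable_funM; first exact: mI.
  apply: (measurableT_comp mrm).
  exact: measurable_fun_pair measurable_sampled_bmD measurable_sampled_incr.
have K0 : 0 <= K by exact: le_trans (rmK (0, 0)).
have I1 s : `|I s| <= 1.
  have [sI|sI] := boolP (s \in `[u, v]); first by rewrite Iin // normr1.
  by rewrite Iout // normr0.
have HK z : `|H z| <= K.
  by rewrite !normrM -[leRHS]mul1r; apply: ler_pM (I1 _) (rmK _).
have Hout s w : s \notin `[u, v] -> H (s, w) = 0.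
  by move=> sI; rewrite /H Iout // mul0r.
have sa0 : 0 <= (Num.sqrt a)^-1 by rewrite invr_ge0 sqrtr_ge0.
apply: (integral_sq_Rintegral_le_cst mH HK Hout _ uv) => s.
have [sI|sI] := boolP (s \in `[u, v]); last first.
  rewrite integral0_eq ?lee_fin ?mulr_ge0 // => w _.
  by rewrite Hout // expr0n.
have [s0 sT e0 es] := inb sI.
have [eT d0 dT] : [/\ eta s <= T, 0 <= s - eta s & s - eta s <= T].
  by split; lra.
have mrm2 : measurable_fun setT (fun z => (rm z ^+ 2)%:E).
  by apply/measurable_EFinP; exact: measurable_funX.
have rm20 z : (0 <= (rm z ^+ 2)%:E)%E by rewrite lee_fin sqr_ge0.
have mY := Fmeas_bmD filtF rW mX0 e0 eT.
have E := ge0_integral_past_incr filtF rW e0 es sT mY mrm2 rm20.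
rewrite (_ : \int[P]_w _ =
    \int[P]_w (rm (X (eta s) w, (W s \- W (eta s))%R w) ^+ 2)%:E)%E; last first.
  by apply: eq_integral => w _; rewrite /H Iin // mul1r.
rewrite E.
pose Phi (x : R) := (\int[gauss (s - eta s)]_z (rm (x, z) ^+ 2)%:E)%E.
have mPhi : measurable_fun setT Phi.
  exact: (@measurable_fun_fubini_tonelli_F _ _ _ _ _ (gauss (s - eta s)) (fun z => (rm z ^+ 2)%:E)).
have Phi0 x : (0 <= Phi x)%E by exact: integral_ge0.
have ea : 0 < eta s by exact: lt_le_trans (eta_ge sI).
rewrite (_ : \int[P]_w _ = \int[P]_w Phi (X (eta s) w))%E //.
apply: le_trans (bm_density_le T0 filtF rW mX0 ea eT mPhi Phi0) _.
have -> : (\int[mu]_x Phi x = \int[gauss (s - eta s)]_z \int[mu]_x (rm (x, z) ^+ 2)%:E)%E.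
  exact: (@fubini_tonelli _ _ (measurableTypeR R) (measurableTypeR R) R mu (gauss (s - eta s)) (fun z => (rm z ^+ 2)%:E) mrm2 rm20).
rewrite EFinM; apply: lee_pmul.
- by rewrite lee_fin invr_ge0 sqrtr_ge0.
- by apply: integral_ge0 => z _; exact: integral_ge0.
- rewrite lee_fin lef_pV2 ?posrE ?sqrtr_gt0 // ler_sqrt // ?(ltW ea) //.
  exact: eta_ge.
- by apply: rmC => //; exact: eta_mesh.
Qed.

(** * The stationary differences *)

Section autocorrelation.
Variables (f : R -> R) (A : R).
Hypotheses (bf : bounded_L1 f) (A0 : 0 <= A).
Hypothesis fA : forall t, 0 <= t -> t <= T -> t <= h ->
  (\int[gauss t]_z (sq_incr f z)%:E <= A%:E)%E.

Let alpha r w : R := W r w - W a w.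

(** The increment of [f] along the path restarted at time [a] from a free position [z.2.1], which
    will be distributed according to the Lebesgue measure. *)
Let H3 (z : measurableTypeR R * (measurableTypeR R * Omega)) : R :=
  I z.1 * (f (z.2.1 + alpha z.1 z.2.2) - f (z.2.1 + alpha (eta z.1) z.2.2)).

Let mf : measurable_fun setT f.
Proof. by case: bf. Qed.

Let mH3 : measurable_fun setT H3.
Proof.
pose q (z : measurableTypeR R * (measurableTypeR R * Omega)) := (z.1, z.2.2).
have mq : measurable_fun setT q.
  apply: measurable_fun_pair; first exact: measurable_fst.
  exact: (measurableT_comp measurable_snd measurable_snd).
have mx : measurable_fun setT
    (fun z : measurableTypeR R * (measurableTypeR R * Omega) => z.2.1 : R).
  exact: (measurableT_comp measurable_fst measurable_snd).
have mWa : measurable_fun setT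
    (fun z : measurableTypeR R * (measurableTypeR R * Omega) => W a z.2.2).
  apply: (measurableT_comp (rbm_measurable rW a)).
  exact: (measurableT_comp measurable_snd measurable_snd).
apply: measurable_funM; first exact: mI.
apply: measurable_funB; apply: (measurableT_comp mf); apply: measurable_funD => //;
  apply: measurable_funB => //.
  exact: (measurableT_comp mW mq).
exact: (measurableT_comp mWe mq).
Qed.

Let H3out s z : s \notin `[u, v] -> H3 (s, z) = 0.
Proof. by move=> sI; rewrite /H3 Iout // mul0r. Qed.

Let incr_sqE (x y : R) :
  (\int[mu]_z ((f (z + x) - f (z + y)) ^+ 2)%:E = (sq_incr f (x - y))%:E)%E.
Proof.
rewrite (sq_incrE _ bf) -[RHS](lebesgue_integral_shift y).
  by apply: eq_integral => z _; congr ((f _ - _) ^+ 2)%:E; ring.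
apply/measurable_EFinP; apply: measurable_funX; apply: measurable_funB => //.
exact: (measurableT_comp mf (measurable_addr _)).
Qed.

(** Translation invariance in the free position erases the path up to [eta s], so that only the
    increment over the cell matters. *)
Let H3_sq s : (\int[sprod mu P]_z (H3 (s, z) ^+ 2)%:E <= A%:E)%E.
Proof.
have [sI|sI] := boolP (s \in `[u, v]); last first.
  by rewrite integral0_eq ?lee_fin // => w _; rewrite H3out // expr0n.
have [s0 sT e0 es] := inb sI.
have m2 : measurable_fun setT (fun z => (H3 (s, z) ^+ 2)%:E).
  apply/measurable_EFinP; apply: measurable_funX.
  exact: (measurable_fun_pair2 s mH3).
have p2 z : (0 <= (H3 (s, z) ^+ 2)%:E)%E by rewrite lee_fin sqr_ge0.
rewrite (fubini_tonelli2 _ m2 p2).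
have msq : measurable_fun setT (fun z => (sq_incr f z)%:E).
  by apply/measurable_EFinP; exact: measurable_sq_incr.
have sq0 (z : R) : (0 <= (sq_incr f z)%:E)%E by rewrite lee_fin sq_incr_ge0.
rewrite (_ : (\int[P]_y _)%E = (\int[P]_w (sq_incr f ((W s \- W (eta s))%R w))%:E)%E); last first.
  apply: eq_integral => w _; rewrite /fubini_G /H3 /= Iin //.
  under eq_integral do rewrite mul1r.
  by rewrite incr_sqE; congr (_%:E); congr (sq_incr f); rewrite /alpha; ring.
rewrite (ge0_integral_incr filtF rW e0 es sT msq sq0).
have d0 : 0 <= s - eta s by rewrite subr_ge0.
have dT : s - eta s <= T by lra.
exact: fA (eta_mesh s0 sT).
Qed.

Let Q t : R := \int[gauss t]_y autocorr f y.

Let mean_autocorr r s : 0 <= r -> r <= s -> s <= T ->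
  \int[P]_w autocorr f (alpha s w - alpha r w) = Q (s - r).
Proof.
move=> r0 rs sT; have [N N0 fN] := autocorr_bounded bf.
rewrite /Q /Rintegral -(integral_incr filtF rW r0 rs sT (measurable_autocorr bf) fN).
congr fine; apply: eq_integral => w _; congr (_%:E); congr (autocorr f).
by rewrite /alpha /=; ring.
Qed.

(* Once the starting point is averaged over the Lebesgue measure, the covariance
   over two distinct cells is a second difference of [Q], which is nonpositive
   because [Q] is convex. *)
Let H3_orth r s : r \in `[u, v] -> s \in `[u, v] -> r <= eta s ->
  (\int[sprod mu P]_z (H3 (r, z) * H3 (s, z))%:E <= 0)%E.
Proof.
move=> rI sI res; have [s0 sT e0 es] := inb sI; have [r0 rT er0 er] := inb rI.
have mrs : measurable_fun setT (fun z => (H3 (r, z) * H3 (s, z))%:E).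
  by apply/measurable_EFinP; apply: measurable_funM; exact: (measurable_fun_pair2 _ mH3).
have irs : (mu \x P)%E.-integrable setT (fun z => (H3 (r, z) * H3 (s, z))%:E).
  apply/integrableP; split => //.
  by apply: le_lt_trans (integral_abs_prod_le mH3 H3_sq r s) _; exact: ltry.
rewrite -(integral21_prod_meas1 irs) /fubini_G.
have mal q : measurable_fun setT (alpha q).
  by apply: measurable_funB; exact: (rbm_measurable rW).
have iac q q' : P.-integrable setT (EFin \o (fun w => autocorr f (alpha q w - alpha q' w))).
  apply: (probability_bounded_integrable P).
    exact: (measurableT_comp (measurable_autocorr bf) (measurable_funB (mal q) (mal q'))).
  by have [N N0 fN] := autocorr_bounded bf; exists N.
pose AC w := autocorr f (alpha s w - alpha r w) - autocorr f (alpha (eta s) w - alpha r w)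
  - autocorr f (alpha s w - alpha (eta r) w) + autocorr f (alpha (eta s) w - alpha (eta r) w).
have ifxy x y : mu.-integrable setT (EFin \o (fun z => f (z + x) * f (z + y))).
  by have := bounded_L1M (bounded_L1_shift x bf) (bounded_L1_shift y bf).
have inner w : (\int[mu]_x (H3 (r, (x, w)) * H3 (s, (x, w)))%:E = (AC w)%:E)%E.
  rewrite /AC -!(autocorrE _ _ bf) -Rintegral_lincomb4 // fineK; last first.
    apply: (integrable_fin_num measurableT).
    have := integrableD measurableT (integrableB measurableT (integrableB measurableT
      (ifxy (alpha r w) (alpha s w)) (ifxy (alpha r w) (alpha (eta s) w)))
      (ifxy (alpha (eta r) w) (alpha s w))) (ifxy (alpha (eta r) w) (alpha (eta s) w)).
    by [].
  apply: eq_integral => x _; congr (_%:E); rewrite /H3 !Iin //=; ring.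
under eq_integral do rewrite inner.
have iAC : P.-integrable setT (EFin \o AC).
  have := integrableD measurableT (integrableB measurableT (integrableB measurableT
      (iac s r) (iac (eta s) r)) (iac s (eta r))) (iac (eta s) (eta r)).
  by [].
have finAC := integrable_fin_num measurableT iAC.
rewrite -(fineK finAC) lee_fin -/(Rintegral P setT AC) Rintegral_lincomb4 //.
have eT : eta s <= T by exact: le_trans sT.
have rs : r <= s by exact: le_trans es.
rewrite !mean_autocorr //; try exact: (le_trans er).
(* The four lags are those of the convexity inequality with base [eta s - r] and steps [s - eta s]
   and [r - eta r]. The base is nonnegative precisely because a node separates [r] from [s]. *)
have [x0 c0 d0] : [/\ 0 <= eta s - r, 0 <= r - eta r & 0 <= s - eta s] by split; lra.
have bc (x y : R) : 0 <= x -> 0 <= y -> x + y <= T -> gauss_convolution x y.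
  exact: (bm_gauss_convolution filtF rW).
have := gauss_autocorr_convex x0 d0 c0 (bc _ _ x0 d0 _) (bc _ _ x0 c0 _)
  (bc _ _ (addr_ge0 x0 c0) d0 _) bf.
rewrite -/(Q _) -/(Q _) -/(Q _) -/(Q _).
rewrite (_ : eta s - r + (s - eta s) = s - r); last by ring.
rewrite (_ : eta s - r + (r - eta r) + (s - eta s) = s - eta r); last by ring.
rewrite (_ : eta s - r + (r - eta r) = eta s - eta r); last by ring.
have [T1 T2 T3] : [/\ s - r <= T, eta s - eta r <= T & s - eta r <= T] by split; lra.
move=> /(_ T1 T2 T3).
move: (Q (s - r)) (Q (eta s - r)) (Q (s - eta r)) (Q (eta s - eta r)) => q1 q2 q3 q4; lra.
Qed.

Let J_le : (\int[sprod mu P]_z ((\int[mu]_s H3 (s, z)) ^+ 2)%:E <=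
  (2 * A * h * (v - u))%:E)%E.
Proof.
have [M M0 fM] : exists2 M, 0 <= M & forall x, `|f x| <= M by case: bf.
have H3K z : `|H3 z| <= 2 * M.
  have [sI|sI] := boolP (z.1 \in `[u, v]); last by rewrite (surjective_pairing z) H3out // normr0 mulr_ge0.
  rewrite /H3 Iin // mul1r; apply: le_trans (ler_normB _ _) _.
  by rewrite mulr_natl mulr2n lerD.
apply: (integral_sq_Rintegral_le mH3 H3K H3out H3_sq A0 h0 uv) => r s rI sI.
have case_le r' s' : r' \in `[u, v] -> s' \in `[u, v] -> r' <= s' ->
    (\int[sprod mu P]_z (H3 (r', z) * H3 (s', z))%:E <=
     (if `|r' - s'| <= h then A else 0)%:E)%E.
  move=> r'I s'I rs'.
  have [s0 sT e0 es] := inb s'I; have [r0 rT er0 er] := inb r'I.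
  have [eE|res] := eta_cell r0 rs' sT; last first.
    by apply: le_trans (H3_orth r'I s'I res) _; case: ifP; rewrite lee_fin.
  rewrite ifT; last first.
    by rewrite distrC ger0_norm ?subr_ge0 //; have := eta_mesh s0 sT; lra.
  apply: le_trans (integral_abs_prod_le mH3 H3_sq r' s').
  apply: le_trans (lee_abs _) _.
  apply: le_abse_integral => //; apply/measurable_EFinP.
  by apply: measurable_funM; exact: (measurable_fun_pair2 _ mH3).
have [rs|/ltW sr] := leP r s; first exact: case_le.
rewrite distrC; apply: le_trans (case_le _ _ sI rI sr).
by under eq_integral do rewrite mulrC.
Qed.

Let mJ : measurable_fun setT (fun z => ((\int[mu]_s H3 (s, z)) ^+ 2)%:E).
Proof.
apply/measurable_EFinP; apply: measurable_funX.
apply: (@measurable_Rintegral_param _ _ _ _ _ mu (fun z => H3 (z.2, z.1))).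
apply: (measurableT_comp mH3).
by apply: measurable_fun_pair; [exact: measurable_snd|exact: measurable_fst].
Qed.

(** Signed covariances cannot be averaged one by one against a density bound. The Markov property
    instead writes the whole mean square as the mean of [J (X a)], with [J x] the mean square for
    the start [x]; as [J] is nonnegative, the law of the start may be replaced by a^(-1/2) times the
    Lebesgue measure. *)
Lemma block_autocorr_le :
  (\int[P]_w ((\int[mu]_s (\1_(`[u, v]%classic) s *
      (f (X s w) - f (X (eta s) w)))) ^+ 2)%:E <=
   ((Num.sqrt a)^-1 * (2 * A * h * (v - u)))%:E)%E.
Proof.
have [M M0 fM] : exists2 M, 0 <= M & forall x, `|f x| <= M by case: bf.
have M20 : 0 <= 2 * M by rewrite mulr_ge0.
have fM2 x y : `|f x - f y| <= 2 * M.
  by apply: le_trans (ler_normB _ _) _; rewrite mulr_natl mulr2n lerD.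
pose H1 (z : measurableTypeR R * Omega) : R :=
  I z.1 * (f (X z.1 z.2) - f (X (eta z.1) z.2)).
(* The position at [a] is read on one copy of the probability space and the later increments on an
   independent one. *)
pose H2 (z : measurableTypeR R * (Omega * Omega)) : R :=
  H3 (z.1, (X a z.2.1, z.2.2)).
have mH1 : measurable_fun setT H1.
  apply: measurable_funM; first exact: mI.
  apply: measurable_funB; first exact: (measurableT_comp mf measurable_bmD).
  exact: (measurableT_comp mf measurable_sampled_bmD).
have aT : a <= T.
  have uI : u \in `[u, v] by rewrite in_itv /= lexx.
  by have [_ uT _ eu] := inb uI; apply: le_trans uT; apply: le_trans eu; exact: eta_ge.
have mXa : measurable_fun setT (fun w => X a w).
  have aI : a \in `[0, T] by rewrite in_itv /= ltW.
  exact: (Fmeas_measurable filtF aI (Fmeas_bmD filtF rW mX0 (ltW a0) aT)).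
have mq : measurable_fun setT (fun z : Omega * Omega => (X a z.1 : measurableTypeR R, z.2)).
  apply: measurable_fun_pair; last exact: measurable_snd.
  exact: (measurableT_comp mXa measurable_fst).
have mH2 : measurable_fun setT H2.
  apply: (measurableT_comp mH3); apply: measurable_fun_pair.
    exact: measurable_fst.
  exact: (measurableT_comp mq measurable_snd).
have H1out s w : s \notin `[u, v] -> H1 (s, w) = 0.
  by move=> sI; rewrite /H1 Iout // mul0r.
have H2out s w : s \notin `[u, v] -> H2 (s, w) = 0 by exact: H3out.
have H1K z : `|H1 z| <= 2 * M.
  have [sI|sI] := boolP (z.1 \in `[u, v]).
    by rewrite /H1 Iin // mul1r.
  by rewrite (surjective_pairing z) H1out // normr0.
have H2K z : `|H2 z| <= 2 * M.
  have [sI|sI] := boolP (z.1 \in `[u, v]).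
    by rewrite /H2 /H3 Iin // mul1r.
  by rewrite (surjective_pairing z) H2out // normr0.
have sq_le (x : R) : `|x| <= 2 * M -> 0 <= x ^+ 2 <= (2 * M) ^+ 2.
  by move=> xM; rewrite sqr_ge0 /= -real_normK ?num_real // ler_pXn2r ?nnegrE.
have H1sq s : (\int[P]_w (H1 (s, w) ^+ 2)%:E <= ((2 * M) ^+ 2)%:E)%E.
  apply: probability_integral_le => [|w]; last by apply: sq_le; exact: H1K.
  by apply: measurable_funX; exact: (measurable_fun_pair2 s mH1).
have H2sq s : (\int[P \x P]_w (H2 (s, w) ^+ 2)%:E <= ((2 * M) ^+ 2)%:E)%E.
  apply: (@probability_integral_le _ _ _ [the probability _ _ of (P \x P)%E] (fun w => H2 (s, w) ^+ 2)) => [|w]; last by apply: sq_le; exact: H2K.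
  by apply: measurable_funX; exact: (measurable_fun_pair2 s mH2).
rewrite (integral_sq_Rintegral_itvE mH1 H1K H1out H1sq).
have two_points r s : (\int[P]_w (H1 (r, w) * H1 (s, w))%:E =
    \int[P \x P]_z (H2 (r, z) * H2 (s, z))%:E)%E.
  have [rI|rI] := boolP (r \in `[u, v]); last first.
    rewrite [LHS]integral0_eq => [|w _]; last by rewrite H1out // mul0r.
    by rewrite integral0_eq // => w _; rewrite H2out // mul0r.
  have [sI|sI] := boolP (s \in `[u, v]); last first.
    rewrite [LHS]integral0_eq => [|w _]; last by rewrite (H1out s) // mulr0.
    by rewrite integral0_eq // => w _; rewrite (H2out s) // mulr0.
  have [s0 sT e0 es] := inb sI; have [r0 rT er0 er] := inb rI.
  have ae := eta_ge sI; have aer := eta_ge rI.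
  have [as_ ar] : a <= s /\ a <= r by split; [exact: le_trans es|exact: le_trans er].
  have [eT erT] : eta s <= T /\ eta r <= T by split; [exact: le_trans sT|exact: le_trans rT].
  pose g w' w q q' := f (X a w' + (W q \- W a)%R w) * f (X a w' + (W q' \- W a)%R w).
  have mg q q' : measurable_fun setT (fun z : Omega * Omega => g z.1 z.2 q q').
    have mi q1 : measurable_fun setT (fun z : Omega * Omega => X a z.1 + (W q1 \- W a)%R z.2).
      apply: measurable_funD; first exact: (measurableT_comp mXa measurable_fst).
      apply: (measurableT_comp _ measurable_snd).
      by apply: measurable_funB; exact: (rbm_measurable rW).
    by apply: measurable_funM; exact: (measurableT_comp mf).
  have gM w' w q q' : `|g w' w q q'| <= M * M by rewrite normrM ler_pM.
  have MM : 0 <= M * M by rewrite mulr_ge0.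
  have ig w' q q' : P.-integrable setT (EFin \o (fun w => g w' w q q')).
    apply: (probability_bounded_integrable P (measurable_fun_pair2 w' (mg q q'))).
    by exists (M * M).
  have ig' q q' : P.-integrable setT (EFin \o (fun w' => \int[P]_w g w' w q q')).
    apply: probability_bounded_integrable.
      exact: (@measurable_Rintegral_param _ _ _ _ _ P (fun z => g z.1 z.2 q q')).
    exists (M * M) => // w'.
    exact: (normr_Rintegral_probability_le P (measurable_fun_pair2 w' (mg q q')) MM (fun w => gM w' w q q')).
  have iX q q' : P.-integrable setT (EFin \o (fun w => f (X q w) * f (X q' w))).
    have mXq q1 : measurable_fun setT (fun w => f (X q1 w)).
      apply: (measurableT_comp mf); exact: (measurable_fun_pair2 q1 measurable_bmD).
    apply: (probability_bounded_integrable P (measurable_funM (mXq q) (mXq q'))).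
    by exists (M * M) => // w; rewrite normrM ler_pM.
  pose G w' w := g w' w r s - g w' w r (eta s) - g w' w (eta r) s + g w' w (eta r) (eta s).
  have mG : measurable_fun setT (fun z : Omega * Omega => G z.1 z.2).
    by apply: measurable_funD => //; apply: measurable_funB => //; exact: measurable_funB.
  have GE w' w : H2 (r, (w', w)) * H2 (s, (w', w)) = G w' w.
    by rewrite /H2 /H3 /G /g /= !Iin //= /alpha; ring.
  have iH2 : (P \x P)%E.-integrable setT (fun z => (H2 (r, z) * H2 (s, z))%:E).
    apply: (@probability_bounded_integrable _ _ _ [the probability _ _ of (P \x P)%E] (fun z => H2 (r, z) * H2 (s, z))).
      by apply: measurable_funM; exact: (measurable_fun_pair2 _ mH2).
    by exists ((2 * M) * (2 * M)) => [|z]; rewrite ?mulr_ge0 // normrM ler_pM.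
  rewrite -(integral12_prod_meas1 iH2) /fubini_F.
  have innerE w' : (\int[P]_w (H2 (r, (w', w)) * H2 (s, (w', w)))%:E =
      (\int[P]_w G w' w)%:E)%E.
    rewrite fineK; first by apply: eq_integral => w _; rewrite GE.
    have := integrableD measurableT (integrableB measurableT (integrableB measurableT
      (ig w' r s) (ig w' r (eta s))) (ig w' (eta r) s)) (ig w' (eta r) (eta s)).
    exact: integrable_fin_num.
  under [RHS]eq_integral do rewrite innerE (Rintegral_lincomb4 (ig _ _ _) (ig _ _ _) (ig _ _ _) (ig _ _ _)).
  pose L w := f (X r w) * f (X s w) - f (X r w) * f (X (eta s) w)
    - f (X (eta r) w) * f (X s w) + f (X (eta r) w) * f (X (eta s) w).
  have LE w : H1 (r, w) * H1 (s, w) = L w by rewrite /H1 /L /= !Iin //; ring.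
  rewrite [LHS](_ : _ = \int[P]_w (L w)%:E)%E; last first.
    by apply: eq_integral => w _; rewrite LE.
  have finL := integrable_fin_num measurableT (integrableD measurableT (integrableB measurableT
    (integrableB measurableT (iX r s) (iX r (eta s))) (iX (eta r) s)) (iX (eta r) (eta s))).
  have finR := integrable_fin_num measurableT (integrableD measurableT (integrableB measurableT
    (integrableB measurableT (ig' r s) (ig' r (eta s))) (ig' (eta r) s)) (ig' (eta r) (eta s))).
  rewrite -(fineK finL) -(fineK finR); congr (_%:E).
  have mk q q' : a <= q -> a <= q' -> q <= T -> q' <= T ->
      \int[P]_w (f (X q w) * f (X q' w)) = \int[P]_w' \int[P]_w g w' w q q'.
    exact: (markov_two_points filtF rW mX0 mf M0 fM (ltW a0)).
  transitivity (\int[P]_w L w) => //; rewrite Rintegral_lincomb4 //.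
  by rewrite !mk // -Rintegral_lincomb4.
(* The mean square depends on the two-time products only, so it passes from [Omega] to
   [Omega * Omega], where it is folded back into a square. *)
rewrite (eq_integral (fun z => \int[P \x P]_w (H2 (z.1, w) * H2 (z.2, w))%:E)%E); last first.
  by move=> z _; exact: two_points.
rewrite -(integral_sq_Rintegral_itvE (M := [the probability _ _ of (P \x P)%E]) mH2 H2K H2out H2sq).
pose S (z : measurableTypeR R * Omega) := ((\int[mu]_s H3 (s, z)) ^+ 2)%:E.
have S0 z : (0 <= S z)%E by rewrite lee_fin sqr_ge0.
have mS : measurable_fun setT S by exact: mJ.
rewrite [leLHS](_ : _ = \int[P]_w' \int[P]_w S (X a w', w))%E; last first.
  apply: (fubini_tonelli1 (fun z : Omega * Omega => S (X a z.1, z.2))) => [|z]; last exact: S0.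
  exact: (measurableT_comp mS mq).
pose J (x : R) := (\int[P]_w S (x, w))%E.
have mJJ : measurable_fun setT J.
  exact: (@measurable_fun_fubini_tonelli_F _ _ _ _ _ P S).
have J0 x : (0 <= J x)%E by exact: integral_ge0.
rewrite (_ : \int[P]_w' _ = \int[P]_w' J (X a w'))%E //.
apply: le_trans (bm_density_le T0 filtF rW mX0 a0 aT mJJ J0) _.
rewrite EFinM; apply: lee_wpmul2l; first by rewrite lee_fin invr_ge0 sqrtr_ge0.
apply: le_trans J_le.
by rewrite [leRHS](fubini_tonelli1 S).
Qed.

End autocorrelation.

End block.

(** * Summation over dyadic blocks *)

Section interval_integrals.
Context {R : realType}.
Notation mu := (@lebesgue_measure R).

Lemma Rintegral_indicE (D : set R) (f : R -> R) :
  \int[mu]_(s in D) f s = \int[mu]_s (\1_D s * f s).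
Proof.
rewrite Rintegral_mkcond; apply: eq_Rintegral => s _; rewrite /patch indicE.
by case: ifP => _; rewrite ?mul1r ?mul0r.
Qed.

Lemma Rintegral_itv_split (x y z : R) (f : R -> R) : x <= y -> y <= z ->
  mu.-integrable `[x, z] (EFin \o f) ->
  \int[mu]_(s in `[x, z]) f s =
  \int[mu]_(s in `[x, y]) f s + \int[mu]_(s in `[y, z]) f s.
Proof.
move=> xy yz fi; apply/eqP; rewrite addrC -subr_eq; apply/eqP.
rewrite Rintegral_itvB ?bnd_simp //.
apply: Rintegral_itv_obnd_cbnd; apply: integrableS fi => //.
by apply: subset_itv; rewrite bnd_simp.
Qed.

Lemma normr_Rintegral_itv_le (x y M : R) (f : R -> R) : x <= y -> 0 <= M ->
  measurable_fun setT f -> (forall s, `|f s| <= M) ->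
  `|\int[mu]_(s in `[x, y]) f s| <= M * (y - x).
Proof.
move=> xy M0 mf fM; have fi := bounded_integrable_itv x y M0 mf fM.
apply: le_trans (le_normr_Rintegral _ fi) _ => //.
rewrite -Rintegral_itv_cst //; apply: le_Rintegral => //.
- apply: (bounded_integrable_itv x y M0 (f := fun s => `|f s|)) => [|s].
    exact: measurableT_comp.
  by rewrite normr_id.
- apply: (bounded_integrable_itv x y M0 (f := fun=> M)) => // s.
  by rewrite ger0_norm.
Qed.

Lemma measurable_Rintegral_itv d (S : measurableType d) (x y : R)
    (g : measurableTypeR R * S -> R) : measurable_fun setT g ->
  measurable_fun setT (fun w => \int[mu]_(s in `[x, y]) g (s, w)).
Proof.
move=> mg.
rewrite (_ : (fun w => _) = fun w => \int[mu]_s (\1_(`[x, y]%classic) s * g (s, w))).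
  apply: (@measurable_Rintegral_param _ _ _ _ _ mu
    (fun z => \1_(`[x, y]%classic) z.2 * g (z.2, z.1))).
  apply: measurable_funM.
    apply: (measurableT_comp _ measurable_snd); exact: measurable_indic.
  apply: (measurableT_comp mg).
  by apply: measurable_fun_pair; [exact: measurable_snd|exact: measurable_fst].
by apply/funext => w; exact: Rintegral_indicE.
Qed.

End interval_integrals.

Section dyadic_recursion.
Context {R : realType}.
Notation mu := (@lebesgue_measure R).

(* Halving the horizon contracts [t `^ delta] by the factor [q], which leaves
   room for the cross term of the square of a sum. *)
Lemma dyadic_recursion (T kappa G C : R) : 0 < T -> 0 < kappa -> kappa < 1 ->
  0 <= G -> 0 <= C -> exists2 K, 0 <= K &
  forall d (Omega : measurableType d) (P : probability Omega R)
    (g : measurableTypeR R * Omega -> R) (h : R),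
  measurable_fun setT g -> (forall z, `|g z| <= G) -> 0 < h -> h <= 2 * T ->
  (forall t, 4 * h <= t -> t <= T ->
    (\int[P]_w ((\int[mu]_(s in `[t / 2, t]) g (s, w)) ^+ 2)%:E <=
     (C * Num.sqrt t * h `^ (1 + kappa))%:E)%E) ->
  forall t, 0 <= t -> t <= T ->
    (\int[P]_w ((\int[mu]_(s in `[0%R, t]) g (s, w)) ^+ 2)%:E <=
     (K * h `^ (1 + kappa))%:E)%E.
Proof.
move=> T0 kappa0 kappa1 G0 C0.
(* At most 1/2, so that sqrt t is dominated by a multiple of t^delta, and at most 1 - kappa, so that
   t^2 is of order h^(1+kappa) t^delta as long as t <= 4 h. *)
pose delta := (1 - kappa) / 2; have delta0 : 0 < delta by rewrite /delta; lra.
pose q : R := 2^-1 `^ delta.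
have q0 : 0 < q by exact: powR_gt0.
have q1 : q < 1.
  rewrite -[X in _ < X](_ : 1 `^ delta = 1); last by rewrite powR1.
  by apply: (gt0_ltr_powR delta0); rewrite ?nnegrE ?invr_ge0 //; lra.
(* Young's weight, chosen so that [(1 + e) * q] is the midpoint of [q] and 1, still below 1. *)
pose e := (1 - q) / (2 * q).
have e0 : 0 < e by rewrite divr_gt0 ?mulr_gt0 ?subr_gt0.
have eq1 : (1 + e) * q = (1 + q) / 2 by rewrite /e; field; rewrite gt_eqF.
pose D := (1 + e^-1) * C * T `^ (kappa / 2).
have D0 : 0 <= D.
  by rewrite /D !mulr_ge0 ?powR_ge0 ?addr_ge0 // invr_ge0 ltW.
(* The constant of the base case, where the integral is at most [G * t]: 16 bounds 4^(2 - delta),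
   and (2 T)^delta bounds h^delta in h^(2 - delta) = h^delta h^(1 + kappa). *)
pose B := G ^+ 2 * (16 * (2 * T) `^ delta).
have B0 : 0 <= B by rewrite /B !mulr_ge0 ?sqr_ge0 ?powR_ge0.
(* Large enough for the base case, and stable under a step of the recursion, which requires 2 D <= K
   (1 - q). *)
pose K := B + 2 * D / (1 - q).
have BK : B <= K.
  by rewrite lerDl; apply: divr_ge0; [exact: mulr_ge0|rewrite subr_ge0 ltW].
have DK : (1 + q) / 2 * K + D <= K.
  have : 2 * D <= K * (1 - q) by rewrite -ler_pdivrMr ?subr_gt0 // lerDr.
  move: (K) (D) => K' D'; nra.
have K0 : 0 <= K by exact: le_trans BK.
exists (K * T `^ delta); first by rewrite mulr_ge0 ?powR_ge0.
move=> d Omega P g h mg gG h0 hT block.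
pose S x y w := \int[mu]_(s in `[x, y]) g (s, w).
have mS x y : measurable_fun setT (S x y) by exact: measurable_Rintegral_itv.
have mS2 x y : measurable_fun setT (fun w => (S x y w ^+ 2)%:E).
  by apply/measurable_EFinP; exact: measurable_funX.
pose H := h `^ (1 + kappa); have H0 : 0 <= H by exact: powR_ge0.
have base t : 0 <= t -> t <= T -> t <= 4 * h ->
    (\int[P]_w (S 0 t w ^+ 2)%:E <= (K * t `^ delta * H)%:E)%E.
  move=> t0 tT th; apply: probability_integral_le => [|w].
    exact: measurable_funX.
  rewrite sqr_ge0 /=.
  have St : `|S 0 t w| <= G * t.
    rewrite -[X in G * X]subr0; apply: normr_Rintegral_itv_le => //.
    exact: (measurable_fun_pair1 w mg).
  apply: (@le_trans _ _ (G ^+ 2 * t ^+ 2)).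
    by rewrite -exprMn -real_normK ?num_real // ler_pXn2r ?nnegrE // mulr_ge0.
  apply: (@le_trans _ _ (B * t `^ delta * H)); last first.
    by rewrite ler_wpM2r // ler_wpM2r ?powR_ge0.
  rewrite [leRHS](_ : _ = G ^+ 2 * (t `^ delta * (16 * ((2 * T) `^ delta * H)))); last first.
    by rewrite /B; ring.
  rewrite ler_wpM2l ?sqr_ge0 //.
  have -> : t ^+ 2 = t `^ delta * t `^ (2 - delta).
    rewrite -powRD; last by apply/implyP => /eqP; lra.
    by rewrite (_ : delta + (2 - delta) = 2%:R); [rewrite powR_mulrn|ring].
  rewrite ler_wpM2l ?powR_ge0 //.
  have d2 : 0 <= 2 - delta by rewrite /delta; lra.
  apply: (@le_trans _ _ ((4 * h) `^ (2 - delta))).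
    by apply: ge0_ler_powR; rewrite ?nnegrE // mulr_ge0 // ltW.
  rewrite powRM ?(ltW h0) //; apply: ler_pM; rewrite ?powR_ge0 //.
    rewrite (_ : 16 = 4 `^ 2%:R); last by rewrite powR_mulrn //; lra.
    by apply: ler_powR; lra.
  rewrite (_ : 2 - delta = delta + (1 + kappa)); last by rewrite /delta; field.
  rewrite powRD; last by rewrite (gt_eqF h0) implybT.
  rewrite ler_wpM2r //; apply: ge0_ler_powR; rewrite ?nnegrE ?(ltW h0) ?(ltW delta0) //.
  by rewrite mulr_ge0 // ltW.
have [j Tj] : exists j : nat, T <= 4 * h * 2 ^+ j.
  exists (Num.truncn (T / (4 * h))).+1.
  rewrite mulrC -ler_pdivrMr ?mulr_gt0 //.
  apply: ltW; apply: lt_trans (truncnS_gt _) _.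
  by rewrite -natrX ltr_nat ltn_expl.
(* Induction on the number of halvings that bring [t] below [4 * h]; the block bound applies only
   above this threshold. *)
have rec : forall j t, 0 <= t -> t <= T -> t <= 4 * h * 2 ^+ j ->
    (\int[P]_w (S 0 t w ^+ 2)%:E <= (K * t `^ delta * H)%:E)%E.
  elim=> [|i IH] t t0 tT tj; first by apply: base => //; rewrite expr0 mulr1 in tj.
  have [/base|/ltW th] := leP t (4 * h); first exact.
  have t20 : 0 <= t / 2 by rewrite divr_ge0.
  have t2t : t / 2 <= t by lra.
  have t2T : t / 2 <= T by exact: le_trans tT.
  have IHt : (\int[P]_w (S 0 (t / 2) w ^+ 2)%:E <= (K * (q * t `^ delta) * H)%:E)%E.
    rewrite (_ : q * t `^ delta = (t / 2) `^ delta); last first.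
      by rewrite [t / 2]mulrC powRM ?invr_ge0.
    apply: IH => //; rewrite ler_pdivrMr //.
    by rewrite -(mulrA (4 * h)) -exprSr.
  have e10 : 0 <= 1 + e by rewrite addr_ge0 // ltW.
  have ei0 : 0 <= 1 + e^-1 by rewrite addr_ge0 // invr_ge0 ltW.
  apply: (@le_trans _ _ (\int[P]_w ((1 + e)%:E * (S 0 (t / 2) w ^+ 2)%:E
      + (1 + e^-1)%:E * (S (t / 2) t w ^+ 2)%:E))%E).
    apply: ge0_le_integralT => [|||w].
    - exact: mS2.
    - by apply: emeasurable_funD; apply: emeasurable_funM => //; exact: measurable_cst.
    - by move=> w; rewrite lee_fin sqr_ge0.
    - rewrite -!EFinM -EFinD lee_fin.
      have -> : S 0 t w = S 0 (t / 2) w + S (t / 2) t w.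
        apply: Rintegral_itv_split => //.
        apply: (bounded_integrable_itv 0 t G0 (f := fun s => g (s, w))) => //.
        exact: (measurable_fun_pair1 w mg).
      move: (S 0 (t / 2) w) (S (t / 2) t w) => x y.
      (* Young's inequality (x + y)^2 <= (1 + e) x^2 + (1 + 1/e) y^2. *)
      have : 0 <= (e * x - y) ^+ 2 / e by rewrite divr_ge0 ?sqr_ge0 // ltW.
      rewrite [X in 0 <= X](_ : _ = e * x ^+ 2 - 2 * x * y + e^-1 * y ^+ 2).
        by rewrite sqrrD !mulrDl !mul1r -mulr_natl => ?; lra.
      by field; rewrite gt_eqF.
  rewrite ge0_integralTD; last 4 first.
  - by apply: emeasurable_funM => //; exact: measurable_cst.
  - by apply: emeasurable_funM => //; exact: measurable_cst.
  - by move=> w; rewrite -EFinM lee_fin mulr_ge0 ?sqr_ge0.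
  - by move=> w; rewrite -EFinM lee_fin mulr_ge0 ?sqr_ge0.
  have S20 x y w : (0 <= (S x y w ^+ 2)%:E)%E by rewrite lee_fin sqr_ge0.
  rewrite (ge0_integralTZl P e10 (mS2 _ _) (S20 _ _)) (ge0_integralTZl P ei0 (mS2 _ _) (S20 _ _)).
  apply: (@le_trans _ _ ((1 + e)%:E * (K * (q * t `^ delta) * H)%:E
     + (1 + e^-1)%:E * (C * Num.sqrt t * H)%:E)%E).
    by apply: leeD; apply: lee_wpmul2l; rewrite ?lee_fin //; exact: block.
  rewrite -!EFinM -EFinD lee_fin.
  have sqt : Num.sqrt t <= t `^ delta * T `^ (kappa / 2).
    rewrite -powR12_sqrt // [X in t `^ X](_ : _ = delta + kappa / 2); last first.
      by rewrite /delta; field.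
    rewrite powRD; last by apply/implyP => /eqP; rewrite /delta; lra.
    rewrite ler_wpM2l ?powR_ge0 //; apply: ge0_ler_powR; rewrite ?nnegrE ?(ltW T0) //.
    by rewrite divr_ge0 // ltW.
  apply: (@le_trans _ _ (((1 + q) / 2 * K + D) * t `^ delta * H)); last first.
    by rewrite ler_wpM2r // ler_wpM2r ?powR_ge0.
  rewrite -eq1 /D.
  have : (1 + e^-1) * C * H * Num.sqrt t <= (1 + e^-1) * C * H * (t `^ delta * T `^ (kappa / 2)).
    by rewrite ler_wpM2l // !mulr_ge0.
  move: (e^-1) (Num.sqrt t) (t `^ delta) (T `^ (kappa / 2)) => e' a1 a2 a3; nra.
move=> t t0 tT; apply: le_trans (rec j t t0 tT (le_trans tT Tj)) _.
rewrite lee_fin ler_wpM2r // ler_wpM2l //.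
by apply: ge0_ler_powR; rewrite ?nnegrE ?(ltW delta0) // ltW.
Qed.

End dyadic_recursion.

(** What the estimates use of a discretization. The last field says that two times lie in the same
    cell or are separated by a node. *)
Record sampling_map (R : realType) (T h : R) (eta : R -> R) : Prop := SamplingMap {
  sampling_measurable : measurable_fun setT eta;
  sampling_ge0 : forall s, 0 <= s -> s <= T -> 0 <= eta s;
  sampling_le : forall s, 0 <= s -> s <= T -> eta s <= s;
  sampling_mesh : forall s, 0 <= s -> s <= T -> s - eta s <= h;
  sampling_cell : forall u s, 0 <= u -> u <= s -> s <= T ->
    eta u = eta s \/ u <= eta s }.

Definition local_error (R : realType) (Omega : Type) (b : R -> R)
    (W : R -> Omega -> R) (X0 : Omega -> R) (eta : R -> R)
    (z : measurableTypeR R * Omega) : R :=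
  phi' b (W z.1 z.2 + X0 z.2) *
  (b (W z.1 z.2 + X0 z.2) - b (W (eta z.1) z.2 + X0 z.2)).

(** * The local error on a time block *)

Section drift.
Context {R : realType}.
Notation mu := (@lebesgue_measure R).
Variables (b : R -> R) (M : R).
Hypotheses (M0 : 0 <= M) (bM : forall x, `|b x| <= M).
Hypothesis ib : mu.-integrable setT (EFin \o b).

Let mb : measurable_fun setT b.
Proof. by have /integrableP[/measurable_EFinP] := ib. Qed.

Let K := expR (2 * \int[mu]_x `|b x|).

Let K0 : 0 <= K. Proof. by rewrite expR_ge0. Qed.

Let phiBK x y : `|phi' b x * (b x - b y)| <= K * (2 * M).
Proof.
rewrite normrM; apply: ler_pM => //.
  by rewrite ger0_norm ?(ltW (phi'_gt0 b x)) // phi'_le.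
by apply: le_trans (ler_normB _ _) _; rewrite mulr_natl mulr2n lerD.
Qed.

Let psiK x : `|psi b x| <= K * M.
Proof.
rewrite normrM; apply: ler_pM => //.
by rewrite ger0_norm ?(ltW (phi'_gt0 b x)) // phi'_le.
Qed.

Let Km := 2 * K * M ^+ 2.

Let mcoefK x : `|mcoef b x| <= Km. Proof. exact: normr_mcoef_le. Qed.

Let Km0 : 0 <= Km. Proof. by rewrite /Km !mulr_ge0 ?sqr_ge0. Qed.

Let mtrK x z : `|mcoef b x * trunc z| <= Km.
Proof.
rewrite normrM -[leRHS]mulr1.
by apply: ler_pM (mcoefK _) (normr_trunc_le1 _).
Qed.

Let Kr := K * (2 * M) + (K * M + K * M) + Km.

Let remK (z : R * R) : `|drift_rem b z.1 z.2| <= Kr.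
Proof.
rewrite /drift_rem /Kr; apply: le_trans (ler_normB _ _) _; apply: lerD (mtrK _ _).
apply: le_trans (ler_normB _ _) _; apply: lerD; first exact: phiBK.
by apply: le_trans (ler_normB _ _) _; apply: lerD.
Qed.

Lemma normr_local_error_le (Omega : Type) (W : R -> Omega -> R) (X0 : Omega -> R)
    (eta : R -> R) z : `|local_error b W X0 eta z| <= K * (2 * M).
Proof. exact: phiBK. Qed.

Lemma measurable_local_error d (Omega : measurableType d) (P : probability Omega R)
    (T : R) (F : R -> set (set Omega)) (W : R -> Omega -> R) (X0 : Omega -> R)
    (eta : R -> R) : 0 < T -> filtration T F -> regular_bm P T F W ->
  Fmeas F 0 X0 -> measurable_fun setT eta ->
  measurable_fun setT (local_error b W X0 eta).
Proof.
move=> T0 filtF rW mX0 meta.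
have mX := measurable_bmD T0 filtF rW mX0.
have mXe := measurable_sampled_bmD T0 filtF rW mX0 meta.
apply: measurable_funM.
  exact: (measurableT_comp (measurable_phi' M0 bM ib) mX).
by apply: measurable_funB; apply: (measurableT_comp mb).
Qed.

Variables (kappa T : R).
Hypotheses (kappa0 : 0 < kappa) (kappa1 : kappa < 1) (T0 : 0 < T).
Hypothesis b_kappa : (sobolev_slobodeckij kappa b < +oo)%E.

(* With [x] the sampled position and [d] the increment since the last node, the
   local error is [psi (x + d) - psi x + mcoef x * trunc d + drift_rem x d]: a
   stationary difference, a martingale difference and a higher-order term. *)
Lemma block_sq_le : exists2 C, 0 <= C &
  forall d (Omega : measurableType d) (P : probability Omega R)
    (F : R -> set (set Omega)) (W : R -> Omega -> R) (X0 : Omega -> R)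
    (eta : R -> R) (h : R),
  filtration T F -> regular_bm P T F W -> Fmeas F 0 X0 ->
  sampling_map T h eta -> 0 < h ->
  forall t, 4 * h <= t -> t <= T ->
    (\int[P]_w ((\int[mu]_(s in `[t / 2, t])
        local_error b W X0 eta (s, w)) ^+ 2)%:E <=
     (C * Num.sqrt t * h `^ (1 + kappa))%:E)%E.
Proof.
have [Cr Cr0 remC] := gauss_sqr_rem_le M0 bM ib kappa0 kappa1 T0 b_kappa.
have [Cp Cp0 psiC] := gauss_sq_incr_psi_le M0 bM ib kappa0 kappa1 T0 b_kappa.
(* The martingale part contributes 64 Km^2 h^2 t, brought to the common form by h^2 <= T^(1-kappa)
   h^(1+kappa) and t <= sqrt T sqrt t. *)
pose Cm := 64 * Km ^+ 2 * (T `^ (1 - kappa) * Num.sqrt T).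
have Cm0 : 0 <= Cm by rewrite /Cm !mulr_ge0 ?sqr_ge0 ?powR_ge0 ?sqrtr_ge0.
exists (3 * (2 * Cp + Cm + Cr * T)).
  by rewrite mulr_ge0 // !addr_ge0 // mulr_ge0 // ltW.
move=> d Omega P F W X0 eta h filtF rW mX0 [meta eta_ge0 eta_le eta_mesh eta_cell] h0 t th tT.
have t0 : 0 < t by apply: lt_le_trans th; rewrite mulr_gt0.
have [u0 uv a0] : [/\ 0 <= t / 2, t / 2 <= t & 0 < t / 4] by split; lra.
(* Since [h <= t / 4], even the last node before the block comes after [t / 4], where the density is
   at most of order t^(-1/2). *)
have eta_ge s : s \in `[t / 2, t] -> t / 4 <= eta s.
  rewrite in_itv /= => /andP[ts st].
  have := eta_mesh s (le_trans u0 ts) (le_trans st tT); lra.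
pose X r w := W r w + X0 w.
pose p (z : measurableTypeR R * Omega) := psi b (X z.1 z.2) - psi b (X (eta z.1) z.2).
pose m (z : measurableTypeR R * Omega) :=
  mcoef b (X (eta z.1) z.2) * trunc (W z.1 z.2 - W (eta z.1) z.2).
pose r (z : measurableTypeR R * Omega) :=
  drift_rem b (X (eta z.1) z.2) (W z.1 z.2 - W (eta z.1) z.2).
have pmrE z : local_error b W X0 eta z = p z + m z + r z.
  rewrite /p /m /r /drift_rem /local_error -/(X z.1 z.2) -/(X (eta z.1) z.2).
  have -> : X (eta z.1) z.2 + (W z.1 z.2 - W (eta z.1) z.2) = X z.1 z.2.
    by rewrite /X; ring.
  ring.
have mX := measurable_bmD T0 filtF rW mX0.
have mXe := measurable_sampled_bmD T0 filtF rW mX0 meta.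
have minc := measurable_sampled_incr rW meta.
have [mpsi _ _] := bounded_L1_psi M0 bM ib.
have mp : measurable_fun setT p.
  by apply: measurable_funB; apply: (measurableT_comp mpsi).
have mm : measurable_fun setT m.
  apply: measurable_funM; first exact: (measurableT_comp (measurable_mcoef M0 bM ib) mXe).
  exact: (measurableT_comp (@measurable_trunc R) minc).
have mrem := measurable_rem M0 bM ib.
have mr : measurable_fun setT r.
  exact: (measurableT_comp mrem (measurable_fun_pair mXe minc)).
have pK z : `|p z| <= K * M + K * M.
  by apply: le_trans (ler_normB _ _) _; apply: lerD; exact: psiK.
have mK z : `|m z| <= Km by exact: mtrK.
have rK z : `|r z| <= Kr by exact: (remK (_, _)).
have KM0 : 0 <= K * M + K * M by rewrite addr_ge0 ?mulr_ge0.
have Kr0 : 0 <= Kr by rewrite /Kr !addr_ge0 ?mulr_ge0.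
pose J (f : measurableTypeR R * Omega -> R) w := \int[mu]_(s in `[t / 2, t]) f (s, w).
have mJ2 f : measurable_fun setT f -> measurable_fun setT (fun w => (J f w ^+ 2)%:E).
  move=> mf; apply/measurable_EFinP; apply: measurable_funX.
  exact: measurable_Rintegral_itv.
have J20 f w : (0 <= (J f w ^+ 2)%:E)%E by rewrite lee_fin sqr_ge0.
have iJ (f : measurableTypeR R * Omega -> R) k w : 0 <= k -> measurable_fun setT f -> (forall z, `|f z| <= k) ->
    mu.-integrable `[t / 2, t] (EFin \o (fun s => f (s, w))).
  move=> k0 mf fk; apply: (bounded_integrable_itv _ _ k0 (f := fun s => f (s, w))) => //.
  exact: (measurable_fun_pair1 w mf).
have JE w : J (local_error b W X0 eta) w = J p w + J m w + J r w.
  rewrite /J; under eq_Rintegral do rewrite pmrE.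
  have ipm : mu.-integrable `[t / 2, t] (EFin \o (fun s => p (s, w) + m (s, w))).
    apply: (iJ (fun z => p z + m z) (K * M + K * M + Km)) => [||z].
    - by rewrite addr_ge0.
    - exact: measurable_funD.
    - by apply: le_trans (ler_normD _ _) _; exact: lerD.
  rewrite (RintegralD _ ipm (iJ _ _ w Kr0 mr rK)) //.
  by rewrite (RintegralD _ (iJ _ _ w KM0 mp pK) (iJ _ _ w Km0 mm mK)).
have Hk : h `^ (1 + kappa) = h * h `^ kappa.
  by rewrite powRD ?powRr1 ?(ltW h0) // (gt_eqF h0) implybT.
have hk0 : 0 <= h `^ kappa by exact: powR_ge0.
have Jp : (\int[P]_w (J p w ^+ 2)%:E <= ((Num.sqrt (t / 4))^-1 *
    (2 * (Cp * h `^ kappa) * h * (t - t / 2)))%:E)%E.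
  rewrite /J; under eq_integral do rewrite Rintegral_indicE.
  apply: (block_autocorr_le T0 filtF rW mX0 meta eta_ge0 eta_le eta_mesh eta_cell
    u0 uv tT a0 eta_ge (bounded_L1_psi M0 bM ib)); first exact: mulr_ge0.
  move=> t' t'0 t'T t'h; have t'I : 0 <= t' <= T by rewrite t'0.
  apply: le_trans (psiC _ t'I) _; rewrite lee_fin ler_wpM2l //.
  by apply: ge0_ler_powR; rewrite ?nnegrE ?(ltW kappa0) // ltW.
have Jm : (\int[P]_w (J m w ^+ 2)%:E <=
    (2 * (Km ^+ 2 * (64 * h)) * h * (t - t / 2))%:E)%E.
  rewrite /J; under eq_integral do rewrite Rintegral_indicE.
  exact: (block_martingale_le T0 filtF rW mX0 meta eta_ge0 eta_le eta_mesh eta_cell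
    u0 uv tT (measurable_mcoef M0 bM ib) Km0 mcoefK).
have Jr : (\int[P]_w (J r w ^+ 2)%:E <= (2 * ((Num.sqrt (t / 4))^-1 *
    (Cr * h `^ (1 + kappa))) * (t - t / 2) ^+ 2)%:E)%E.
  rewrite /J; under eq_integral do rewrite Rintegral_indicE.
  apply: (block_remainder_le T0 filtF rW mX0 meta eta_ge0 eta_le eta_mesh
    u0 uv tT a0 eta_ge mrem remK); first by rewrite mulr_ge0 // powR_ge0.
  move=> t' t'0 t'T t'h; have t'I : 0 <= t' <= T by rewrite t'0.
  apply: le_trans (remC _ t'I) _; rewrite lee_fin ler_wpM2l //.
  by apply: ge0_ler_powR; rewrite ?nnegrE ?addr_ge0 ?(ltW kappa0) // ltW.
(* The factor 3 is from (x + y + z)^2 <= 3 (x^2 + y^2 + z^2). *)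
apply: (@le_trans _ _ (\int[P]_w (3%:E * ((J p w ^+ 2)%:E + (J m w ^+ 2)%:E
    + (J r w ^+ 2)%:E)))%E).
  apply: ge0_le_integralT => [|||w].
  - by apply: mJ2; exact: (measurable_local_error T0 filtF rW mX0 meta).
  - apply: emeasurable_funM; first exact: measurable_cst.
    by apply: emeasurable_funD; [apply: emeasurable_funD|]; exact: mJ2.
  - by move=> w; exact: J20.
  - rewrite -/(J _ w) JE -!EFinD -EFinM lee_fin.
    move: (J p w) (J m w) (J r w) => x y z.
    have := sqr_ge0 (x - y); have := sqr_ge0 (y - z); have := sqr_ge0 (x - z).
    nra.
have mpm : measurable_fun setT (fun w => (J p w ^+ 2)%:E + (J m w ^+ 2)%:E)%E.
  by apply: emeasurable_funD; exact: mJ2.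
have pm0 w : (0 <= (J p w ^+ 2)%:E + (J m w ^+ 2)%:E)%E by rewrite adde_ge0.
rewrite ge0_integralTZl //; last 2 first.
- by apply: emeasurable_funD => //; exact: mJ2.
- by move=> w; rewrite adde_ge0.
rewrite (ge0_integralTD P mpm (mJ2 _ mr) pm0 (J20 r)).
rewrite (ge0_integralTD P (mJ2 _ mp) (mJ2 _ mm) (J20 p) (J20 m)).
apply: (le_trans (lee_wpmul2l _ (leeD (leeD Jp Jm) Jr))); first by rewrite lee_fin.
rewrite -!EFinD -EFinM lee_fin.
have st0 : 0 < Num.sqrt t by rewrite sqrtr_gt0.
have t4 : Num.sqrt (t / 4) = Num.sqrt t / 2.
  rewrite sqrtrM ?(ltW t0) //; congr (_ * _).
  have -> : (4^-1 : R) = 2^-1 ^+ 2 by field.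
  by rewrite sqrtr_sqr ger0_norm // invr_ge0.
have tE : t = Num.sqrt t ^+ 2 by rewrite sqr_sqrtr // ltW.
have hT : h <= T by lra.
have h2 : h ^+ 2 <= h `^ (1 + kappa) * T `^ (1 - kappa).
  have -> : h ^+ 2 = h `^ (1 + kappa) * h `^ (1 - kappa).
    rewrite -powRD; last by rewrite (gt_eqF h0) implybT.
    by rewrite (_ : 1 + kappa + (1 - kappa) = 2%:R) ?powR_mulrn ?(ltW h0) //; ring.
  rewrite ler_wpM2l ?powR_ge0 //; apply: ge0_ler_powR => //.
  - by rewrite subr_ge0 ltW.
  - by rewrite nnegrE ltW.
  - by rewrite nnegrE ltW.
have sT : Num.sqrt t <= Num.sqrt T by rewrite ler_wsqrtr.
rewrite t4 -[leRHS]mulrA -[leRHS]mulrA ler_wpM2l //.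
have -> : t - t / 2 = Num.sqrt t ^+ 2 / 2 by rewrite -tE; field.
have H0 : 0 <= h `^ (1 + kappa) by exact: powR_ge0.
rewrite (mulrDl (2 * Cp + Cm)) (mulrDl (2 * Cp) Cm); apply: lerD; first apply: lerD.
- rewrite Hk [leLHS](_ : _ = 2 * Cp * (Num.sqrt t * (h * h `^ kappa))) //.
  move: (Num.sqrt t) st0 (h `^ kappa) => s' s'0 hk; field; rewrite gt_eqF //.
- rewrite [leLHS](_ : _ = 64 * Km ^+ 2 * ((h ^+ 2) * (Num.sqrt t * Num.sqrt t))); last by field.
  rewrite /Cm -[leRHS]mulrA ler_wpM2l ?mulr_ge0 ?sqr_ge0 //.
  apply: (@le_trans _ _ ((h `^ (1 + kappa) * T `^ (1 - kappa)) * (Num.sqrt T * Num.sqrt t))).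
    by apply: ler_pM => //; rewrite ?sqr_ge0 ?mulr_ge0 ?ler_wpM2r // ltW.
  by rewrite le_eqVlt; apply/orP; left; apply/eqP; ring.
- rewrite [leLHS](_ : _ = Cr * (Num.sqrt t ^+ 2) * (Num.sqrt t * h `^ (1 + kappa))); last first.
    move: (Num.sqrt t) st0 (h `^ (1 + kappa)) => s' s'0 hk; field; rewrite gt_eqF //.
  rewrite -tE ler_wpM2r ?ler_wpM2l // mulr_ge0 // ltW.
Qed.

End drift.

(** * Discretizations *)

Section last_node.
Context {R : realType}.
Variables (n : nat) (grid : nat -> R).
Local Notation eta := (last_node n grid).

Let node_le_last k s : (k <= n)%N -> grid k <= s -> grid k <= eta s.
Proof.
by move=> kn ks; apply: (@le_bigmax_cond _ _ _ _ (Ordinal (kn : (k < n.+1)%N))).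
Qed.

Let last_node_le s : grid 0%N <= s -> eta s <= s.
Proof. by move=> s0; apply: bigmax_le. Qed.

Let last_node_nd : {homo eta : s t / s <= t}.
Proof.
move=> s t st; apply: bigmax_le => [|[k kn] /= ks]; first exact: bigmax_ge_id.
by apply: node_le_last; rewrite // (le_trans ks).
Qed.

Let last_node_node s : grid 0%N <= s ->
  exists k, [/\ (k <= n)%N, grid k <= s & eta s = grid k].
Proof.
move=> s0; rewrite /last_node.
apply: (big_ind (fun x => exists k, [/\ (k <= n)%N, grid k <= s & x = grid k])).
- by exists 0%N.
- by move=> x y Hx Hy; rewrite /Num.max; case: ifP.
- by move=> [k kn] /= ks; exists k.
Qed.

Lemma sampling_last_node (T h : R) : grid 0%N = 0 -> grid n = T -> 0 <= h ->
  (forall k, (k < n)%N -> grid k.+1 - grid k <= h) -> sampling_map T h eta.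
Proof.
move=> g0 gT h0 mesh; split=> [|s s0 sT|s s0 sT|s s0 sT|u s u0 us sT].
- exact: nondecreasing_measurable.
- by rewrite -g0; exact: bigmax_ge_id.
- by apply: last_node_le; rewrite g0.
(* Walking along the nodes: either node [k] is still before [s], or [s] has been passed within one
   mesh of its last node. If all nodes precede [s], then so does [grid n = T], and the gap is not
   positive. *)
- have step k : (k <= n)%N -> grid k <= s \/ s - eta s <= h.
    elim: k => [_|k IH kn]; first by left; rewrite g0.
    have [ks|] := IH (ltnW kn); last by right.
    have [?|sk] := leP (grid k.+1) s; [by left|right].
    have := node_le_last (ltnW kn) ks; have := mesh k kn; lra.
  have [ns|//] := step n (leqnn n).
  by have := node_le_last (leqnn n) ns; rewrite gT; lra.
- have s0 : grid 0%N <= s by rewrite g0 (le_trans u0).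
  (* If [eta s] lies before [u], it is a node that [eta u] has to dominate, and monotonicity gives
     equality. *)
  have [ue|eu] := leP u (eta s); [by right|left].
  apply/eqP; rewrite eq_le last_node_nd //=.
  have [k [kn ks ek]] := last_node_node s0.
  by rewrite ek; apply: node_le_last => //; rewrite -ek ltW.
Qed.

End last_node.

Section grids.
Context {R : realType}.
Variables (T : R) (n : nat).
Hypotheses (T0 : 0 < T) (n0 : (0 < n)%N).

Let nR0 : 0 < n%:R :> R. Proof. by rewrite ltr0n. Qed.

Lemma sampling_equi_grid : sampling_map T (T / n%:R) (last_node n (equi_grid T n)).
Proof.
apply: sampling_last_node; rewrite /equi_grid.
- by rewrite mul0r mulr0.
- by rewrite divff ?mulr1 // gt_eqF.
- by rewrite divr_ge0 // ltW.
- move=> k kn; rewrite -mulrBr -mulrBl -natrB // subSnn mul1r //.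
Qed.

(** The cell after node k has length T (2k + 1) / n^2, and 2k + 1 <= 2n because k + 1 <= n. *)
Lemma sampling_star_grid : sampling_map T (2 * T / n%:R) (last_node n (star_grid T n)).
Proof.
apply: sampling_last_node; rewrite /star_grid.
- by rewrite mul0r expr0n mulr0.
- by rewrite divff ?expr1n ?mulr1 // gt_eqF.
- by rewrite divr_ge0 // mulr_ge0 // ltW.
- move=> k kn; have kn1 : k.+1%:R <= n%:R :> R by rewrite ler_nat.
  rewrite -mulrBr [2 * T]mulrC -mulrA ler_wpM2l ?(ltW T0) //.
  rewrite !expr_div_n -mulrBl ler_pdivrMr ?exprn_gt0 // expr2 mulrA divfK ?gt_eqF //.
  move: kn1; rewrite -natr1 !expr2 => kn1; have k0 : 0 <= k%:R :> R by [].
  nra.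
Qed.

End grids.

(** Measurability of [f] is not given: it may be arbitrary on [N]. It follows because every subset
    of [N] is measurable, as completeness will guarantee. *)
Lemma integral_eq_off_null (R : realType) d (Omega : measurableType d)
    (P : probability Omega R) (N : set Omega) (f f' : Omega -> R) :
  (forall A, A `<=` N -> measurable A) -> P N = 0%E ->
  measurable_fun setT f' -> (forall w, ~ N w -> f w = f' w) ->
  (\int[P]_w (f w)%:E = \int[P]_w (f' w)%:E)%E.
Proof.
move=> subN PN mf' ff'; have mN : measurable N by exact: subN.
apply: ae_eq_integral => //; last 1 first.
- by exists N; split => // w /= H; apply: contrapT => Nw; apply: H => _; rewrite ff'.
- apply/measurable_EFinP => _ B mB; rewrite setTI.
  rewrite (_ : f @^-1` B = ((f' @^-1` B) `\` N) `|` ((f @^-1` B) `&` N)).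
    apply: measurableU; last exact: subN.
    by apply: measurableD => //; rewrite -[X in measurable X]setTI; exact: mf'.
  apply/seteqP; split => w /=.
    by have [Nw|Nw] := pselect (N w); [right|left; rewrite -ff'].
  by move=> [[]|[]//] + Nw; rewrite ff'.
- exact/measurable_EFinP.
Qed.

Lemma powR_div_nat (R : realType) (x p : R) (n : nat) : 0 <= x -> (0 < n)%N ->
  (x / n%:R) `^ p = x `^ p * (1 / n%:R `^ p).
Proof.
move=> x0 n0; have nR0 : 0 < n%:R :> R by rewrite ltr0n.
have nz : n%:R != 0 :> R by rewrite gt_eqF.
rewrite -[X in X `^ p * _](divfK nz x) [X in _ = X * _]powRM ?divr_ge0 ?(ltW nR0) //.
by rewrite div1r mulfK // gt_eqF // powR_gt0.
Qed.

(** * The quadrature error in terms of the mesh *)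

Section quadrature.
Context {R : realType}.
Notation mu := (@lebesgue_measure R).
Variables (T : R) (b : R -> R) (kappa : R).
Hypotheses (T0 : 0 < T) (b_bounded : bounded_fun b).
Hypothesis ib : mu.-integrable setT (EFin \o b).
Hypotheses (kappa0 : 0 < kappa) (kappa1 : kappa < 1).
Hypothesis b_kappa : (sobolev_slobodeckij kappa b < +oo)%E.

(** The constant is fixed before the probability space, the Brownian motion and the grid, so it can
    depend on [b], [T] and [kappa] only. The range [h <= 2 * T] accommodates the mesh bound
    [2 * T / n] of the quadratic grid at n = 1. *)
Lemma sup_quad_error_le : exists2 K, 0 <= K &
  forall d (Omega : measurableType d) (P : probability Omega R)
    (F : R -> set (set Omega)) (W : R -> Omega -> R) (xi : Omega -> R)
    (n : nat) (grid : nat -> R) (h : R),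
  filtration T F -> usual_conditions P T F -> brownian_motion P T F W ->
  sigma_rv xi `<=` F 0 ->
  sampling_map T h (last_node n grid) -> 0 < h -> h <= 2 * T ->
  (sup_quad_error P T W xi b n grid <= (K * h `^ (1 + kappa))%:E)%E.
Proof.
have [M M0 bM] : exists2 M, 0 <= M & forall x, `|b x| <= M.
  (* [bounded_fun] bounds [b] by every number above its threshold, hence [M + 1]; the maximum with 0
     makes the bound nonnegative. *)
  have [M [_ bM]] := b_bounded; exists (Num.max 0 (M + 1)).
    by rewrite le_max lexx.
  by move=> x; apply: bM => //; rewrite lt_max ltrDl ltr01 orbT.
have [C C0 blockC] := block_sq_le M0 bM ib kappa0 kappa1 T0 b_kappa.
have G0 : 0 <= expR (2 * \int[mu]_x `|b x|) * (2 * M).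
  by rewrite mulr_ge0 ?expR_ge0 // mulr_ge0.
have [K K0 recK] := dyadic_recursion T0 kappa0 kappa1 G0 C0.
exists K => // d Omega P F W xi n grid h filtF usual bm xiF samp h0 hT.
have [W' [N [rW mN PN FN W'W]]] := regular_modification T0 filtF usual bm.
have I0 : (0 : R) \in `[0, T] by rewrite in_itv /= lexx ltW.
have mxi : Fmeas F 0 xi.
  apply/(FmeasP filtF _ I0) => B mB; apply: xiF.
  by exists B => //; rewrite setTI.
have subN A : A `<=` N -> measurable A.
  move=> AN; apply: (F_measurable filtF I0); apply: (usual_complete usual).
  by exists N.
pose eta := last_node n grid.
pose g := local_error b W' xi eta.
have mg : measurable_fun setT g.
  exact: (measurable_local_error M0 bM ib T0 filtF rW mxi (sampling_measurable samp)).
apply: ge_ereal_sup => _ [t /= tI <-].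
move: tI; rewrite in_itv /= => /andP[t0 tT].
rewrite /quad_error unlock /=.
rewrite (@integral_eq_off_null _ _ _ P N _
  (fun w => (\int[mu]_(s in `[0%R, t]) g (s, w)) ^+ 2)) //.
- apply: (recK _ _ P g h mg) => //.
    by move=> z; exact: (normr_local_error_le bM ib).
  exact: (blockC _ _ P F W' xi eta h).
- apply: measurable_funX; exact: measurable_Rintegral_itv.
(* Off [N] the two processes agree on the horizon, which contains both [s] and its last node. *)
- move=> w Nw; rewrite real_normK ?num_real //; congr (_ ^+ 2).
  apply: eq_Rintegral => s; rewrite inE /= in_itv /= => /andP[s0 st].
  have sT := le_trans st tT.
  have e0 := sampling_ge0 samp s0 sT; have es := sampling_le samp s0 sT.
  by rewrite /g /local_error /= !W'W // in_itv /= ?s0 ?e0 //= (le_trans es).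
Qed.

End quadrature.

Theorem theorem3p7 (R : realType) (T : R) (hT : 0 < T) (b : R -> R)
    (b_bounded : bounded_fun b)
    (b_L1 : (@lebesgue_measure R).-integrable setT (EFin \o b))
    (kappa : R) (kappa_gt0 : 0 < kappa) (kappa_lt1 : kappa < 1)
    (b_kappa : (sobolev_slobodeckij kappa b < +oo)%E) :
  exists Cequi Cstar : R, 0 < Cequi /\ 0 < Cstar /\
    forall (mu a : R -> R),
      measurable_fun setT mu -> mu <> cst 0 -> (forall x, mu x = a x + b x) ->
      bounded_fun a -> Cb2 a ->
    forall (d : measure_display) (Omega : measurableType d)
      (P : probability Omega R) (F : R -> set (set Omega))
      (W : R -> Omega -> R) (xi : Omega -> R),
      filtration T F -> usual_conditions P T F -> brownian_motion P T F W ->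
      sigma_rv xi `<=` F 0 -> finite_norm P 2%:E xi ->
      independent_systems P (sigma_rv xi) (sigma_process T W) ->
    forall n : nat, (0 < n)%N ->
      (sup_quad_error P T W xi b n (equi_grid T n)
        <= (Cequi * (1 / n%:R `^ (1 + kappa) + 1 / n%:R `^ (3 / 2)))%:E)%E /\
      (sup_quad_error P T W xi b n (star_grid T n)
        <= (Cstar * ((1 + ln n%:R) / n%:R `^ (1 + kappa)))%:E)%E.
Proof.
have [K K0 errK] := sup_quad_error_le hT b_bounded b_L1 kappa_gt0 kappa_lt1 b_kappa.
(* The added 1 makes the constants positive even if [K] is zero. *)
have C0 x : 0 < K * x `^ (1 + kappa) + 1 by rewrite ltr_wpDl // mulr_ge0 // powR_ge0.
exists (K * T `^ (1 + kappa) + 1), (K * (2 * T) `^ (1 + kappa) + 1).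
split => //; split => // _ _ _ _ _ _ _ d Omega P F W xi filtF usual bm xiF _ _ n n0.
have n1 : 1 <= n%:R :> R by rewrite ler1n.
have nR0 : 0 < n%:R :> R by rewrite ltr0n.
have T2 : T <= 2 * T by lra.
have p0 x : 0 <= 1 / n%:R `^ x :> R by rewrite divr_ge0 // powR_ge0.
split.
- have h0 : 0 < T / n%:R by rewrite divr_gt0.
  have hT2 : T / n%:R <= 2 * T.
    by apply: le_trans T2; rewrite ler_pdivrMr // ler_peMr // ltW.
  apply: (le_trans (errK _ _ P F W xi n _ _ filtF usual bm xiF (sampling_equi_grid hT n0) h0 hT2)).
  rewrite lee_fin powR_div_nat ?(ltW hT) // [leLHS]mulrA [leRHS]mulrDr.
  apply: (@le_trans _ _ ((K * T `^ (1 + kappa) + 1) * (1 / n%:R `^ (1 + kappa)))).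
    by rewrite ler_wpM2r // lerDl.
  by rewrite lerDl mulr_ge0 // ltW.
- have h0 : 0 < 2 * T / n%:R by rewrite divr_gt0 // mulr_gt0.
  have hT2 : 2 * T / n%:R <= 2 * T.
    by rewrite ler_pdivrMr // ler_peMr // mulr_ge0 // ltW.
  apply: (le_trans (errK _ _ P F W xi n _ _ filtF usual bm xiF (sampling_star_grid hT n0) h0 hT2)).
  rewrite lee_fin powR_div_nat ?mulr_ge0 ?(ltW hT) // [leLHS]mulrA [(1 + _) / _]mulrDl.
  apply: (@le_trans _ _ ((K * (2 * T) `^ (1 + kappa) + 1) * (1 / n%:R `^ (1 + kappa)))).
    by rewrite ler_wpM2r // lerDl.
  by rewrite ler_wpM2l ?(ltW (C0 _)) // lerDl divr_ge0 ?ln_ge0 // powR_ge0.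
Qed.
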